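(* Suppose that the basic assumptions and the Lipschitz smoothness assumption (both stated in the context) hold, with $\theta\ge1$ the exponent in the error bound of the basic assumptions. Let $\{x_k\}$ be generated by the truncated Polyak momentum method (see context), and for $k\ge2$ let $\iota_k$ be a random variable drawn uniformly from $\{\lceil k/2\rceil+1,\dots,k\}$. Consider the condition $$(\star)\qquad\|c(x_{\iota_k})\|\le\epsilon\ \text{ (with certainty)},\qquad \mathbb{E}\left[\mathrm{dist}\left(0,\nabla f(x_{\iota_k})+\rho_{\iota_k-1}\nabla c(x_{\iota_k})c(x_{\iota_k})+\mathcal N_X(x_{\iota_k})\right)\right]\le\epsilon.$$ Then: (i) Suppose that $\theta\in[1,2)$ (with its value known) and $\rho_k=k^{\frac\theta4}$, $\eta_k=k^{-\frac12}/\log(k+2)$, $\alpha_k=k^{-\frac12}$. Then for any $\epsilon>0$ there exists some $T=\widetilde{\mathcal O}(\epsilon^{-4})$ such that $(\star)$ holds for all $k\ge T$. (ii) Suppose that $\theta\ge1$ and $\rho_k=k^{\frac12}$, $\eta_k=k^{-\frac12}/(4\log(k+2))$, $\alpha_k=k^{-\frac12}$. Then for any $\epsilon>0$ there exists some $T=\widetilde{\mathcal O}(\epsilon^{-\max\{4,2\theta\}})$ such that $(\star)$ holds for all $k\ge T$.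
   Context: Setting. $X\subseteq\mathbb{R}^n$ is a (nonempty) closed convex set; $\xi$ is a random variable with sample space $\Xi$; $\tilde f(\cdot,\xi)$ is continuously differentiable for each $\xi\in\Xi$; $f(x)=\mathbb{E}[\tilde f(x,\xi)]$; $c:\mathbb{R}^n\to\mathbb{R}^m$ is a deterministic smooth mapping. The problem is $\min_{x\in X} f(x)$ subject to $c(x)=0$. Notation. $\|\cdot\|$ is the Euclidean norm (operator norm for matrices); $\nabla c(x)$ is the transpose of the Jacobian of $c$ (an $n\times m$ matrix); $\mathcal N_X(x)$ is the normal cone of $X$ at $x$; $\mathrm{dist}(x,\Omega)$ is Euclidean distance; $\Pi_\Omega$ is Euclidean projection onto a closed convex set $\Omega$; $\mathscr B(r)=\{x:\|x\|\le r\}$; $\log$ is the natural logarithm. $T=\widetilde{\mathcal O}(\epsilon^{-p})$ is the asymptotic upper bound (as $\epsilon\to0$) ignoring logarithmic factors: there are constants $C,q>0$, depending on the problem data and $x_1$ but not on $\epsilon$, with $T\le C\epsilon^{-p}(\log(1/\epsilon))^q$ for all sufficiently small $\epsilon>0$. Basic assumptions. (i) The optimal value $f^*$ of the problem and $Q_1^*:=\min_{x\in X}\{f(x)+\|c(x)\|^2/2\}$ are finite. (ii) $f$ is differentiable and $L_f$-Lipschitz continuous in an open neighborhood of $X$. (iii) For each $\xi\in\Xi$, $\tilde f(\cdot,\xi)$ is differentiable on $X$, and for some $\sigma\ge0$, $\mathbb{E}[\nabla\tilde f(x,\xi)]=\nabla f(x)$ and $\mathbb{E}[\|\nabla\tilde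 f(x,\xi)-\nabla f(x)\|^2]\le\sigma^2$ for all $x\in X$. (iv) $c$ is $L_c$-Lipschitz continuous and $L_{\nabla c}$-smooth (i.e. $\nabla c$ is $L_{\nabla c}$-Lipschitz) in an open neighborhood of $X$; $\|c(x)\|\le C_c$ for all $x\in X$; and there exist constants $\gamma>0$ and $\theta\ge1$ with $\mathrm{dist}(0,\nabla c(x)c(x)+\mathcal N_X(x))\ge\gamma\|c(x)\|^\theta$ for all $x\in X$ (the error bound). Lipschitz smoothness assumption. $\|\nabla f(u)-\nabla f(v)\|\le L_{\nabla f}\|u-v\|$ for all $u,v\in X$. Truncated Polyak momentum method. Input: a (deterministic) $x_1\in X$, $\{\alpha_k\}\subset(0,1]$, $\{\rho_k\},\{\eta_k\}\subset(0,\infty)$. Let $\xi_1,\xi_2,\dots$ be independent samples of $\xi$. Set $g_1=\Pi_{\mathscr B(L_f)}(\nabla\tilde f(x_1,\xi_1))$. For $k=1,2,\dots$: $G_k=g_k+\rho_k\nabla c(x_k)c(x_k)$; $x_{k+1}=\Pi_X(x_k-\eta_kG_k)$; $g_{k+1}=\Pi_{\mathscr B(L_f)}\big((1-\alpha_k)g_k+\alpha_k\nabla\tilde f(x_{k+1},\xi_{k+1})\big)$. The index $\iota_k$ is drawn independently of the samples. *)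

(* Defs.v *)
From HB Require Import structures.
From mathcomp Require Import all_boot all_order all_algebra finmap.
From mathcomp Require Import all_classical all_reals all_analysis.

Set Implicit Arguments.
Unset Strict Implicit.
Unset Printing Implicit Defensive.

Import Order.TTheory GRing.Theory Num.Theory.
Import numFieldNormedType.Exports.

Local Open Scope classical_set_scope.
Local Open Scope ring_scope.

(* Vectors are row vectors.  The library's norm on 'rV[R]_n is the sup norm; it
   is only used here through the topology and the differential, which do not
   depend on the choice of norm. *)

Definition dotp (R : realType) (n : nat) (u v : 'rV[R]_n) : R :=
  \sum_(i < n) u 0 i * v 0 i.

Definition enorm (R : realType) (n : nat) (u : 'rV[R]_n) : R :=
  Num.sqrt (\sum_(i < n) u 0 i ^+ 2).

(* A *m u for a column vector u is u *m A^T in row-vector form. *)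
Definition opnorm (R : realType) (n m : nat) (A : 'M[R]_(n, m)) : R :=
  sup [set enorm (u *m A^T) | u in [set u : 'rV[R]_m | enorm u <= 1]].

Definition grad (R : realType) (n : nat) (f : 'rV[R]_n -> R) (x : 'rV[R]_n) :
    'rV[R]_n :=
  \row_i 'D_(delta_mx 0 i) f x.

(* Since 'd c x v = v *m 'J c x, the n x m matrix 'J c x is the transpose of the
   usual Jacobian matrix, so it is $\nabla c(x)$. *)
Definition grad_map (R : realType) (n m : nat) (c : 'rV[R]_n -> 'rV[R]_m)
    (x : 'rV[R]_n) : 'M[R]_(n, m) :=
  'J c x.

(* The row-vector form of $\nabla c(x) c(x)$. *)
Definition grad_map_val (R : realType) (n m : nat) (c : 'rV[R]_n -> 'rV[R]_m)
    (x : 'rV[R]_n) : 'rV[R]_n :=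
  c x *m (grad_map c x)^T.

(* Empty at the points outside X. *)
Definition normal_cone (R : realType) (n : nat) (X : set 'rV[R]_n)
    (x : 'rV[R]_n) : set 'rV[R]_n :=
  [set v | X x /\ forall y, X y -> dotp v (y - x) <= 0].

(* Extended-real valued, so that the distance to the empty set is +oo. *)
Definition dist_to (R : realType) (n : nat) (x : 'rV[R]_n) (A : set 'rV[R]_n) :
    \bar R :=
  ereal_inf [set (enorm (x - a))%:E | a in A].

Definition translate (R : realType) (n : nat) (u : 'rV[R]_n)
    (A : set 'rV[R]_n) : set 'rV[R]_n :=
  [set u + a | a in A].

(* The nearest point of A; the default value 0 is only used if there is none,
   which does not happen for a nonempty closed convex set. *)
Definition projection (R : realType) (n : nat) (A : set 'rV[R]_n)
    (x : 'rV[R]_n) : 'rV[R]_n :=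
  xget 0 [set p | A p /\ forall q, A q -> enorm (x - p) <= enorm (x - q)].

Definition cball (R : realType) (n : nat) (r : R) : set 'rV[R]_n :=
  [set x | enorm x <= r].

Definition objective (R : realType) (n : nat) (dXi : measure_display)
    (Xi : measurableType dXi) (mu : probability Xi R)
    (ft : 'rV[R]_n -> Xi -> R) (x : 'rV[R]_n) : R :=
  fine 'E_mu[ft x].

Record basic_assumptions (R : realType) (n m : nat) (dXi : measure_display)
    (Xi : measurableType dXi) (mu : probability Xi R) (X : set 'rV[R]_n)
    (ft : 'rV[R]_n -> Xi -> R) (c : 'rV[R]_n -> 'rV[R]_m)
    (Lf sigma Lc Lnc Cc gamma theta : R) : Prop := BasicAssumptions {
  optimal_value_finite :
    ereal_inf [set (objective mu ft x)%:E | x in X `&` [set x | c x = 0]]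
      \is a fin_num ;
  Q1_finite :
    ereal_inf [set (objective mu ft x + enorm (c x) ^+ 2 / 2)%:E | x in X]
      \is a fin_num ;
  (* Integrability says that $f(x) = E[\tilde f(x, \xi)]$ is well defined. *)
  objective_regular :
    exists U : set 'rV[R]_n,
      [/\ open U, X `<=` U,
          forall x, U x -> mu.-integrable setT (EFin \o ft x),
          forall x, U x -> differentiable (objective mu ft) x
        & forall x y, U x -> U y ->
            `|objective mu ft x - objective mu ft y| <= Lf * enorm (x - y)] ;
  sigma_ge0 : 0 <= sigma ;
  gradient_unbiased :
    forall x, X x -> forall i,
      ('E_mu[fun s => grad (ft^~ s) x 0%R i])%E
        = (grad (objective mu ft) x 0 i)%:E ;
  gradient_variance :
    forall x, X x ->
      ('E_mu[fun s =>
               (enorm (grad (ft^~ s) x - grad (objective mu ft) x) ^+ 2)%R]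
        <= (sigma ^+ 2)%:E)%E ;
  constraint_regular :
    exists V : set 'rV[R]_n,
      [/\ open V, X `<=` V,
          forall x, V x -> differentiable c x,
          forall x y, V x -> V y -> enorm (c x - c y) <= Lc * enorm (x - y)
        & forall x y, V x -> V y ->
            opnorm (grad_map c x - grad_map c y) <= Lnc * enorm (x - y)] ;
  constraint_bounded : forall x, X x -> enorm (c x) <= Cc ;
  gamma_gt0 : 0 < gamma ;
  theta_ge1 : 1 <= theta ;
  error_bound :
    forall x, X x ->
      ((gamma * enorm (c x) `^ theta)%:E
        <= dist_to 0 (translate (grad_map_val c x) (normal_cone X x)))%E
}.

(* Sequences are indexed from 1; their terms of index 0 play no role. *)
Record truncated_polyak_momentum (R : realType) (n m : nat)
    (dXi : measure_display) (Xi : measurableType dXi) (X : set 'rV[R]_n)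
    (ft : 'rV[R]_n -> Xi -> R) (c : 'rV[R]_n -> 'rV[R]_m) (Lf : R)
    (x1 : 'rV[R]_n) (rho eta alpha : nat -> R)
    (xi : nat -> Xi) (x g : nat -> 'rV[R]_n) : Prop := TruncatedPolyakMomentum {
  tpm_x1 : x 1%N = x1 ;
  tpm_g1 : g 1%N = projection (cball Lf) (grad (ft^~ (xi 1%N)) x1) ;
  tpm_x : forall k, (0 < k)%N ->
    x k.+1 =
      projection X (x k - eta k *: (g k + rho k *: grad_map_val c (x k))) ;
  tpm_g : forall k, (0 < k)%N ->
    g k.+1 =
      projection (cball Lf)
        ((1 - alpha k) *: g k + alpha k *: grad (ft^~ (xi k.+1)) (x k.+1))
}.

Definition mutually_independent (R : realType) (dO dXi : measure_display)
    (Omega : measurableType dO) (P : probability Omega R)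
    (Xi : measurableType dXi) (I : set nat) (xi : nat -> {RV P >-> Xi}) : Prop :=
  forall (J : {fset nat}) (A : nat -> set Xi),
    [set` J] `<=` I -> (forall j, measurable (A j)) ->
    (P (\bigcap_(j in [set` J]) xi j @^-1` A j)
      = \prod_(j <- J) P (xi j @^-1` A j))%E.

Definition iid_samples (R : realType) (dO dXi : measure_display)
    (Omega : measurableType dO) (P : probability Omega R)
    (Xi : measurableType dXi) (mu : probability Xi R)
    (xi : nat -> {RV P >-> Xi}) : Prop :=
  mutually_independent [set j | (0 < j)%N] xi /\
  forall j, (0 < j)%N -> forall A, measurable A -> distribution P (xi j) A = mu A.

Definition independent_of_samples (R : realType) (dO dXi : measure_display)
    (Omega : measurableType dO) (P : probability Omega R)
    (Xi : measurableType dXi) (xi : nat -> {RV P >-> Xi})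
    (iota : {RV P >-> nat}) : Prop :=
  forall (A : set Omega) (B : set nat),
    <<s \bigcup_(j in [set j | (0 < j)%N])
          preimage_set_system setT (xi j) measurable >> A ->
    (P (A `&` iota @^-1` B) = P A * P (iota @^-1` B))%E.

(* uphalf k is the ceiling of k / 2, so the range is
   {ceil(k / 2) + 1, ..., k}, with k - uphalf k elements. *)
Definition uniform_upper_half (R : realType) (dO : measure_display)
    (Omega : measurableType dO) (P : probability Omega R) (k : nat)
    (iota : {RV P >-> nat}) : Prop :=
  (forall w, (uphalf k < iota w <= k)%N) /\
  forall i, (uphalf k < i <= k)%N ->
    P (iota @^-1` [set i]) = ((k - uphalf k)%:R^-1)%:E.

Definition eps_stationary (R : realType) (n m : nat) (dO : measure_display)
    (Omega : measurableType dO) (P : probability Omega R) (X : set 'rV[R]_n)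
    (f : 'rV[R]_n -> R) (c : 'rV[R]_n -> 'rV[R]_m) (rho : nat -> R)
    (x : nat -> Omega -> 'rV[R]_n) (iota : {RV P >-> nat}) (eps : R) : Prop :=
  (forall w, enorm (c (x (iota w) w)) <= eps) /\
  (\int[P]_w
     dist_to 0 (translate
                  (grad f (x (iota w) w)
                   + rho (iota w).-1 *: grad_map_val c (x (iota w) w))%R
                  (normal_cone X (x (iota w) w)))
   <= eps%:E)%E.

(* $T = \widetilde{O}(\epsilon^{-p})$ as $\epsilon \to 0$. *)
Definition soft_O (R : realType) (p : R) (T : R -> nat) : Prop :=
  exists C q eps0 : R,
    [/\ 0 < C, 0 < q, 0 < eps0
      & forall eps, 0 < eps < eps0 ->
          (T eps)%:R <= C * eps `^ (- p) * ln (eps^-1) `^ q].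

(* T is chosen before the probability space and the random choices, so it
   depends only on eps, the problem data and x1. *)
Definition complexity_bound (R : realType) (n m : nat) (dXi : measure_display)
    (Xi : measurableType dXi) (mu : probability Xi R) (X : set 'rV[R]_n)
    (ft : 'rV[R]_n -> Xi -> R) (c : 'rV[R]_n -> 'rV[R]_m) (Lf : R)
    (x1 : 'rV[R]_n) (rho eta alpha : nat -> R) (p : R) : Prop :=
  exists2 T : R -> nat, soft_O p T &
    forall eps : R, 0 < eps ->
    forall (dO : measure_display) (Omega : measurableType dO)
      (P : probability Omega R) (xi : nat -> {RV P >-> Xi})
      (iota : nat -> {RV P >-> nat}) (x g : nat -> Omega -> 'rV[R]_n),
      iid_samples mu xi ->
      (forall w, truncated_polyak_momentum X ft c Lf x1 rho eta alpha
                   (xi^~ w) (x^~ w) (g^~ w)) ->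
      (forall k, (2 <= k)%N -> uniform_upper_half k (iota k)) ->
      (forall k, (2 <= k)%N -> independent_of_samples xi (iota k)) ->
      forall k, (2 <= k)%N -> (T eps <= k)%N ->
        eps_stationary X (objective mu ft) c rho x (iota k) eps.

(* Main.v *)
Require Import Defs.
From HB Require Import structures.
From mathcomp Require Import all_boot all_order all_algebra finmap.
From mathcomp Require Import all_classical all_reals all_analysis.
From mathcomp Require Import measurable_realfun.
From mathcomp Require Import zify ring lra.

Set Implicit Arguments.
Unset Strict Implicit.
Unset Printing Implicit Defensive.

Import Order.TTheory GRing.Theory Num.Theory.
Import numFieldNormedType.Exports.

Local Open Scope classical_set_scope.
Local Open Scope ring_scope.

(* The feasibility a_k = |c(x_k)|^2 obeys the deterministic recursion
   a_{k+1} + c1 rho_k eta_k a_{k+1}^theta <= a_k + c2 eta_k / rho_k: one step decreases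
   |c|^2 / 2 by a multiple of |d_k|^2 / (rho_k eta_k), where d_k = x_{k+1} - x_k, and the error
   bound at x_{k+1} controls a_{k+1}^theta by |d_k| and 1 / rho_k.  Writing rho_k = k^r and
   s = 2 r / theta, this forces a_k = O(k^-s).  Stationarity comes from the potential
   f + rho_k |c|^2 / 2 together with the momentum error |g_k - grad f(x_k)|^2: their decrease
   dominates |d_k|^2 / eta_k + alpha_k |g_k - grad f(x_k)|^2, and the growth of rho_k costs only
   the sum of k^(r-s-1).  Both parts of the corollary are instances of 0 < r <= 1/2 with
   complexity exponent p satisfying 2 / p <= min(1/2, s). *)

(** Feasibility holds with certainty because truncation keeps |g_k| <= |Lf| for every outcome of the
    samples: the recursion for |c(x_k)|^2 uses nothing else about g_k, and its constant is fixed
    before the run. The logarithm in eta_k makes alpha_k / eta_k grow without bound, so that from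
    some index on every Lipschitz constant is outweighed although the step sizes do not know it.
    Displacement and momentum error feed each other; each of the two inequalities controls twice its
    own half of the energy and pays once the other half, so that their sum closes. The probabilistic
    obstacle is the cross term with the fresh sample. It vanishes because x_{k+1} depends on the
    first k samples only; to use this, the iterates are shown measurable for the sigma-algebra of
    those samples and the expectation becomes an iterated integral. The distance in the conclusion
    is never shown measurable: it is dominated by a measurable quantity, and Young's inequality with
    a free parameter replaces Jensen's. *)

Section Euclid.
Context {R : realType}.
Implicit Types n m : nat.

(** * Euclidean geometry of row vectors *)

Lemma dotpC n (u v : 'rV[R]_n) : dotp u v = dotp v u.
Proof. by apply: eq_bigr => i _; rewrite mulrC. Qed.

Lemma dotpDl n (u v w : 'rV[R]_n) : dotp (u + v) w = dotp u w + dotp v w.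
Proof. by rewrite -big_split; apply: eq_bigr => i _; rewrite mxE mulrDl. Qed.

Lemma dotpZl n a (u v : 'rV[R]_n) : dotp (a *: u) v = a * dotp u v.
Proof. by rewrite /dotp mulr_sumr; apply: eq_bigr => i _; rewrite mxE mulrA. Qed.

Lemma dotpNl n (u v : 'rV[R]_n) : dotp (- u) v = - dotp u v.
Proof. by rewrite -scaleN1r dotpZl mulN1r. Qed.

Lemma dotpBl n (u v w : 'rV[R]_n) : dotp (u - v) w = dotp u w - dotp v w.
Proof. by rewrite dotpDl dotpNl. Qed.

Lemma dotpDr n (u v w : 'rV[R]_n) : dotp w (u + v) = dotp w u + dotp w v.
Proof. by rewrite dotpC dotpDl !(dotpC w). Qed.

Lemma dotpZr n a (u v : 'rV[R]_n) : dotp v (a *: u) = a * dotp v u.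
Proof. by rewrite dotpC dotpZl dotpC. Qed.

Lemma dotpNr n (u v : 'rV[R]_n) : dotp v (- u) = - dotp v u.
Proof. by rewrite dotpC dotpNl dotpC. Qed.

Definition dotpE := (dotpDl, dotpDr, dotpNl, dotpNr, dotpZl, dotpZr).

Lemma enorm_ge0 n (u : 'rV[R]_n) : 0 <= enorm u.
Proof. exact: sqrtr_ge0. Qed.

Lemma enormE2 n (u : 'rV[R]_n) : enorm u ^+ 2 = dotp u u.
Proof.
rewrite sqr_sqrtr; last by apply: sumr_ge0 => i _; exact: sqr_ge0.
by apply: eq_bigr => i _; rewrite expr2.
Qed.

Lemma enorm_le n m (u : 'rV[R]_n) (v : 'rV[R]_m) :
  dotp u u <= dotp v v -> enorm u <= enorm v.
Proof. by rewrite -!enormE2 ler_sqr// nnegrE enorm_ge0. Qed.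

Lemma enorm0 n : enorm (0 : 'rV[R]_n) = 0.
Proof. by rewrite /enorm big1 ?sqrtr0// => i _; rewrite mxE expr0n. Qed.

Lemma enormZ n a (u : 'rV[R]_n) : enorm (a *: u) = `|a| * enorm u.
Proof.
rewrite /enorm -sqrtr_sqr -sqrtrM ?sqr_ge0// mulr_sumr; congr Num.sqrt.
by apply: eq_bigr => i _; rewrite mxE exprMn.
Qed.

Lemma enormN n (u : 'rV[R]_n) : enorm (- u) = enorm u.
Proof. by rewrite -scaleN1r enormZ normrN1 mul1r. Qed.

Lemma enormBC n (u v : 'rV[R]_n) : enorm (u - v) = enorm (v - u).
Proof. by rewrite -enormN opprB. Qed.

Lemma dotp_eq0 n (u : 'rV[R]_n) : dotp u u = 0 -> u = 0.
Proof.
move=> /eqP; rewrite psumr_eq0 => [|i _]; last by rewrite -expr2 sqr_ge0.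
move=> /allP u0; apply/rowP => i; rewrite mxE.
by have := u0 i (mem_index_enum i); rewrite -expr2 sqrf_eq0 => /eqP.
Qed.

Lemma enorm_eq0 n (u : 'rV[R]_n) : enorm u = 0 -> u = 0.
Proof. by move=> u0; apply: dotp_eq0; rewrite -enormE2 u0 expr0n. Qed.

Lemma dotp0r n (u : 'rV[R]_n) : dotp u 0 = 0.
Proof. by apply: big1 => i _; rewrite mxE mulr0. Qed.

(** Cauchy-Schwarz: the squared norm of |v|^2 u - <u, v> v equals |v|^2 (|u|^2 |v|^2 - <u, v>^2). *)
Lemma dotp_le n (u v : 'rV[R]_n) : dotp u v <= enorm u * enorm v.
Proof.
have [v0|v0] := eqVneq (dotp v v) 0.
  by rewrite (dotp_eq0 v0) dotp0r enorm0 mulr0.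
have vp : 0 < dotp v v by rewrite lt_neqAle eq_sym v0 -enormE2 sqr_ge0.
have : 0 <= dotp (dotp v v *: u - dotp u v *: v) (dotp v v *: u - dotp u v *: v).
  by rewrite -enormE2 sqr_ge0.
rewrite !dotpE (dotpC v u) => h.
have {}h : 0 <= dotp v v * (dotp u u * dotp v v - dotp u v ^+ 2).
  by apply: le_trans h _; rewrite le_eqVlt; apply/orP; left; apply/eqP; ring.
rewrite pmulr_rge0// subr_ge0 -!enormE2 -exprMn in h.
apply: le_trans (ler_norm _) _.
by rewrite -(ler_pXn2r (n:=2))// ?nnegrE ?mulr_ge0 ?enorm_ge0// real_normK// num_real.
Qed.

Lemma ler_enormD n (u v : 'rV[R]_n) : enorm (u + v) <= enorm u + enorm v.
Proof.
rewrite -(ler_pXn2r (n:=2))// ?nnegrE ?addr_ge0 ?enorm_ge0//.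
rewrite sqrrD !enormE2 !dotpE (dotpC v u); have := dotp_le u v; lra.
Qed.

Lemma ler_enormB n (u v : 'rV[R]_n) : enorm (u - v) <= enorm u + enorm v.
Proof. by rewrite -(enormN v) ler_enormD. Qed.

Lemma ler_enorm_dist n (u v : 'rV[R]_n) : `|enorm u - enorm v| <= enorm (u - v).
Proof.
rewrite ler_norml; apply/andP; split.
  have := ler_enormD (v - u) u; rewrite subrK enormBC; lra.
have := ler_enormD (u - v) v; rewrite subrK; lra.
Qed.

Lemma coord_le_enorm n (u : 'rV[R]_n) i : `|u 0 i| <= enorm u.
Proof.
rewrite -(ler_pXn2r (n:=2))// ?nnegrE ?enorm_ge0// real_normK ?num_real//.
rewrite enormE2 /dotp (bigD1 i)//= -expr2 lerDl.
by apply: sumr_ge0 => j _; rewrite -expr2 sqr_ge0.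
Qed.

Lemma mxnorm_le_enorm n (u : 'rV[R]_n) : `|u| <= enorm u.
Proof.
rewrite {1}/Num.norm /= mx_normrE; apply/bigmax_leP; split; first exact: enorm_ge0.
by move=> [i j] _ /=; rewrite ord1 coord_le_enorm.
Qed.

Lemma enorm_le_mxnorm n (u : 'rV[R]_n) : enorm u <= n%:R * `|u|.
Proof.
rewrite -(ler_pXn2r (n:=2))// ?nnegrE ?mulr_ge0 ?enorm_ge0//.
rewrite enormE2; have -> : (n%:R * `|u|) ^+ 2 = \sum_(i < n) n%:R * `|u| ^+ 2.
  by rewrite sumr_const card_ord -mulr_natl; ring.
apply: ler_sum => i _; rewrite -expr2.
have n1 : 1 <= n%:R :> R by rewrite ler1n (leq_trans _ (ltn_ord i)).
apply: le_trans (_ : `|u| ^+ 2 <= _); last by rewrite ler_peMl// sqr_ge0.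
rewrite -(real_normK (num_real (u 0 i))) lerXn2r ?nnegrE//.
have -> : `|u| = mx_norm u by [].
rewrite mx_normrE; apply/bigmax_geP; right; by exists (0, i).
Qed.

Lemma continuous_lip (V W : pseudoMetricNormedZmodType R) (phi : V -> W) K :
  (forall u v, `|phi u - phi v| <= K * `|u - v|) -> continuous phi.
Proof.
move=> lip u; apply/cvgrPdist_le => e e0; near=> v.
apply: le_trans (lip _ _) _.
(* The constant K may have any sign; |K| + 1 is a positive divisor for the radius. *)
apply: le_trans (_ : (`|K| + 1) * `|u - v| <= _).
  by rewrite ler_wpM2r// (le_trans (ler_norm _))// lerDl.
have K1 : 0 < `|K| + 1 by rewrite ltr_wpDl.
rewrite mulrC -ler_pdivlMr//; near: v.
by apply/nbhs_normP; exists (e / (`|K| + 1)); [exact: divr_gt0|move=> z /= /ltW].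
Unshelve. all: by end_near. Qed.

(** The topology comes from the sup norm, the estimates are Euclidean; this is the passage from one
    to the other. *)
Lemma enorm_continuous_lip n (W : pseudoMetricNormedZmodType R)
    (phi : 'rV[R]_n -> W) K :
  (forall u v, `|phi u - phi v| <= K * enorm (u - v)) -> continuous phi.
Proof.
move=> lip; apply: (@continuous_lip _ _ _ (`|K| * n%:R)) => u v.
apply: le_trans (lip _ _) _; rewrite -mulrA.
apply: le_trans (_ : `|K| * enorm (u - v) <= _).
  by rewrite ler_wpM2r ?enorm_ge0 ?ler_norm.
by rewrite ler_wpM2l ?enorm_le_mxnorm.
Qed.

Lemma continuous_enorm n : continuous (@enorm R n).
Proof.
by apply: (@enorm_continuous_lip _ _ _ 1) => u v; rewrite mul1r ler_enorm_dist.
Qed.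

Lemma continuous_coord n (phi : 'rV[R]_n -> 'rV[R]_n) K i :
  (forall u v, enorm (phi u - phi v) <= K * enorm (u - v)) ->
  continuous (fun u => phi u 0 i).
Proof.
move=> lip; apply: (@enorm_continuous_lip _ _ _ K) => u v.
by apply: le_trans (lip u v); have := coord_le_enorm (phi u - phi v) i; rewrite !mxE.
Qed.

End Euclid.

(** * Projection onto a closed convex set *)

Section Projection.
Context {R : realType} {n : nat}.
Variable A : set 'rV[R]_n.
Hypotheses (A0 : A !=set0) (A_closed : closed A).
Implicit Types x y p q : 'rV[R]_n.

(** Cutting A down to the points no farther from x than a fixed point of A leaves a compact set,
    where the distance attains its minimum. *)
Lemma projection_exists x :
  exists p, A p /\ forall q, A q -> enorm (x - p) <= enorm (x - q).
Proof.
have [a Aa] := A0.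
pose B := A `&` [set p | enorm (x - p) <= enorm (x - a)].
have cxp : continuous (fun p => enorm (x - p)).
  apply: (@enorm_continuous_lip _ _ _ _ 1) => u v.
  rewrite mul1r; apply: le_trans (ler_enorm_dist _ _) _.
  by rewrite opprB addrC addrA subrK enormBC.
have Bcl : closed B.
  apply: closedI => //; rewrite (_ : mkset _ =
    (fun p => enorm (x - p)) @^-1` [set y | y <= enorm (x - a)])//.
  by have /continuous_closedP := cxp; apply; exact: closed_le.
have Bcp : compact B.
  apply: bounded_closed_compact => //.
  exists (enorm x + enorm (x - a)); split => [|M]; first exact: num_real.
  move=> /ltW hM p [_ /= hp]; apply: le_trans hM.
  apply: le_trans (mxnorm_le_enorm _) _.
  have := ler_enormB x (x - p); rewrite subKr => h; apply: le_trans h _.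
  by rewrite lerD2l.
have B0 : B !=set0 by exists a; split => //=.
have [p + pmin] := compact_EVT_min B0 Bcp (continuous_subspaceT cxp).
rewrite inE => -[Ap xp]; exists p; split => // q Aq.
have [qa|/ltW qa] := leP (enorm (x - q)) (enorm (x - a)).
  by apply: pmin; rewrite inE.
exact: le_trans qa.
Qed.

Lemma projection_spec x : A (projection A x) /\
  forall q, A q -> enorm (x - projection A x) <= enorm (x - q).
Proof. exact: (xgetPex 0 (projection_exists x)). Qed.

Lemma projection_in x : A (projection A x).
Proof. by have [] := projection_spec x. Qed.

Lemma projection_id x : A x -> projection A x = x.
Proof.
move=> Ax; have [_ /(_ _ Ax)] := projection_spec x.
rewrite subrr enorm0 => h; apply/esym/eqP; rewrite -subr_eq0; apply/eqP.
by apply: enorm_eq0; apply/le_anti; rewrite h enorm_ge0.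
Qed.

Hypothesis A_convex :
  forall x y t, A x -> A y -> 0 <= t <= 1 -> A (x + t *: (y - x)).

Lemma projection_obtuse x y : A y ->
  dotp (x - projection A x) (y - projection A x) <= 0.
Proof.
move=> Ay; have [Ap pmin] := projection_spec x.
set p := projection A x in Ap pmin *; set c := dotp _ _.
have [//|c0] := leP c 0.
set b := dotp (y - p) (y - p).
have b0 : 0 <= b by rewrite /b -enormE2 sqr_ge0.
have cb : 0 < c + b by rewrite ltr_wpDr.
(* If the angle were acute, moving from p towards y by this t would get closer to x: minimality
   forces 2 c <= t b, while t b <= c. The denominator c + b gives t <= 1 and is positive even for y
   = p. *)
pose t := c / (c + b).
have t0 : 0 < t by rewrite divr_gt0.
have t1 : t <= 1 by rewrite ler_pdivrMr// mul1r lerDl.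
have := pmin _ (A_convex Ap Ay (_ : 0 <= t <= 1)).
rewrite (ltW t0) t1 => /(_ isT).
rewrite opprD addrA -(ler_pXn2r (n:=2))// ?nnegrE ?enorm_ge0// !enormE2.
rewrite (_ : forall u v : 'rV[R]_n, dotp (u - t *: v) (u - t *: v) =
   dotp u u - 2 * t * dotp u v + t ^+ 2 * dotp v v); last first.
  by move=> u v; rewrite !dotpE (dotpC v u); ring.
rewrite -/c -/b => h.
have {h} : t * (2 * c) <= t * (t * b) by rewrite expr2 in h; lra.
rewrite ler_pM2l// => h.
have : t * b <= c.
  by rewrite /t mulrAC ler_pdivrMr// ler_pM2l// lerDr ltW.
lra.
Qed.

(** The sum of the two obtuse-angle inequalities, each tested at the other projection, followed by
    Cauchy-Schwarz. *)
Lemma projection_nonexpansive x y :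
  enorm (projection A x - projection A y) <= enorm (x - y).
Proof.
have := projection_obtuse x (projection_in y).
have := projection_obtuse y (projection_in x).
set p := projection A x; set q := projection A y => h1 h2.
have h : dotp (p - q) (p - q) <= dotp (x - y) (p - q).
  by move: h1 h2; rewrite !dotpE !(dotpC q p); lra.
have := le_trans h (dotp_le _ _); rewrite -enormE2 expr2.
have [->|pq] := eqVneq (enorm (p - q)) 0; first by rewrite enorm_ge0.
by rewrite ler_pM2r// lt_neqAle eq_sym pq enorm_ge0.
Qed.

End Projection.

Section Ball.
Context {R : realType} {n : nat}.

Lemma cball_closed (r : R) : closed (cball r : set 'rV[R]_n).
Proof.
rewrite /cball (_ : mkset _ = (@enorm R n) @^-1` [set y | y <= r])//.
by have /continuous_closedP := @continuous_enorm R n; apply; exact: closed_le.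
Qed.

Lemma cball_nonempty (r : R) : 0 <= r -> (cball r : set 'rV[R]_n) !=set0.
Proof. by exists 0; rewrite /cball /= enorm0. Qed.

Lemma cball_convex (r : R) (x y : 'rV[R]_n) t : cball r x -> cball r y ->
  0 <= t <= 1 -> cball r (x + t *: (y - x)).
Proof.
rewrite /cball /= => xr yr /andP[t0 t1].
have -> : x + t *: (y - x) = (1 - t) *: x + t *: y.
  by rewrite scalerBr scalerBl scale1r addrA addrAC.
apply: le_trans (ler_enormD _ _) _; rewrite !enormZ (ger0_norm t0) ger0_norm; last lra.
have := ler_wpM2l t0 yr; have : (1 - t) * enorm x <= (1 - t) * r.
  by rewrite ler_wpM2l//; lra.
lra.
Qed.

End Ball.

(** * Derivatives, mean values and descent along segments *)

Section Calculus.
Context {R : realType} {n : nat}.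
Implicit Types x y v : 'rV[R]_n.

Lemma derive_dotp_grad (f : 'rV[R]_n -> R) x v :
  differentiable f x -> 'D_v f x = dotp (grad f x) v.
Proof.
move=> df; rewrite deriveE// {1}(row_sum_delta v) linear_sum /dotp.
by apply: eq_bigr => i _; rewrite linearZ mxE deriveE// mulrC.
Qed.

(** The difference quotients lie in the closed set of all w with N w <= L |v|, hence so does their
    limit. N is kept apart from the norm of W because the Euclidean norm is needed for vector-valued
    F. *)
Lemma derive_lip_le (W : normedModType R) (N : W -> R) (F : 'rV[R]_n -> W)
    (U : set 'rV[R]_n) L x v :
  continuous N -> (forall a w, N (a *: w) = `|a| * N w) ->
  open U -> U x -> (forall y z, U y -> U z -> N (F y - F z) <= L * enorm (y - z)) ->
  differentiable F x -> N ('D_v F x) <= L * enorm v.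
Proof.
move=> cN NZ oU Ux lip dF.
have dFv := @diff_derivable _ _ _ F x v dF.
pose A := [set w | N w <= L * enorm v].
have Acl : closed A := (continuous_closedP N).1 cN _ (@closed_le _ (L * enorm v)).
pose q := fun h : R => h^-1 *: ((F \o shift x) (h *: v) - F x).
have dFq : q h @[h --> 0^'] --> 'D_v F x by [].
have : \forall h \near 0^', A (q h); last first.
  by move=> /(@closed_cvg _ _ _ _ q A Acl) /(_ _ dFq).
near=> h; rewrite /A /=.
have h0 : h != 0 by near: h; exact: nbhs_dnbhs_neq.
rewrite NZ normrV ?unitfE// mulrC ler_pdivrMr ?normr_gt0//.
have Uh : U (h *: v + x).
  near: h.
  have c0 : (h *: v + x) @[h --> (0 : R)] --> x.
    rewrite -[in X in _ --> X](add0r x) -(scale0r v).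
    by apply: cvgD; [apply: cvgZr_tmp; exact: cvg_id | exact: cvg_cst].
  by apply: cvg_within; apply: c0; exact: open_nbhs_nbhs.
by apply: le_trans (lip _ _ Uh Ux) _; rewrite addrK enormZ -mulrA (mulrC `|h|).
Unshelve. all: by end_near. Qed.

Lemma mean_value_dotp (X : set 'rV[R]_n) (F : 'rV[R]_n -> R)
    (G : 'rV[R]_n -> 'rV[R]_n) x y :
  (forall a b (t : R), X a -> X b -> 0 <= t <= 1 -> X (a + t *: (b - a))) ->
  (forall z v, X z -> is_derive z v F (dotp (G z) v)) -> X x -> X y ->
  exists2 t, 0 <= t <= 1 & F y - F x = dotp (G (x + t *: (y - x))) (y - x).
Proof.
move=> cvx dF Xx Xy; set d : 'rV[R]_n := y - x.
pose phi (t : R) := F (x + t *: d).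
have dphi (t : R) : 0 <= t <= 1 -> is_derive t 1 phi (dotp (G (x + t *: d)) d).
  move=> t01; have Xt := cvx _ _ _ Xx Xy t01.
  (* The difference quotients of phi at t are those of F at x + t d in direction d, so derivability
     and derivative carry over without a chain rule. *)
  have E : (fun h : R => h^-1 *: ((phi \o shift t) (h *: 1) - phi t)) =
      (fun h => h^-1 *: ((F \o shift (x + t *: d)) (h *: d) - F (x + t *: d))).
    apply/funext => h; rewrite /phi /= scaler1.
    by rewrite scalerDl addrCA.
  have [dd dE] := dF _ d Xt.
  split; first by rewrite /derivable E.
  by rewrite /derive E.
have [|t|t] := @MVT_segment R phi (fun t => dotp (G (x + t *: d)) d) 0 1 ler01.
- by move=> t /[!in_itv]/= /andP[t0 t1]; apply: dphi; rewrite !ltW.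
- apply: derivable_within_continuous => u /[!in_itv]/= u01.
  by have [] := dphi u u01.
rewrite in_itv/= => t01; rewrite subr0 mulr1 /phi scale1r scale0r addr0.
by rewrite (subrKC x) => h; exists t.
Qed.

(** Evaluating the gradient at a mean value point instead of integrating along the segment gives L
    in place of the sharp L / 2. *)
Lemma descent_of_lipschitz (X : set 'rV[R]_n) (F : 'rV[R]_n -> R)
    (G : 'rV[R]_n -> 'rV[R]_n) L x y :
  (forall a b (t : R), X a -> X b -> 0 <= t <= 1 -> X (a + t *: (b - a))) ->
  (forall z v, X z -> is_derive z v F (dotp (G z) v)) ->
  0 <= L -> (forall u v, X u -> X v -> enorm (G u - G v) <= L * enorm (u - v)) ->
  X x -> X y -> F y <= F x + dotp (G x) (y - x) + L * enorm (y - x) ^+ 2.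
Proof.
move=> cvx dF L0 lip Xx Xy.
have [t t01 E] := mean_value_dotp cvx dF Xx Xy.
have [t0 t1] := andP t01.
set z := x + t *: (y - x) in E.
have : dotp (G z - G x) (y - x) <= L * enorm (y - x) ^+ 2.
  apply: le_trans (dotp_le _ _) _; rewrite expr2 mulrA ler_wpM2r ?enorm_ge0//.
  apply: le_trans (lip _ _ (cvx _ _ _ Xx Xy t01) Xx) _.
  rewrite addrC addKr enormZ ger0_norm// ler_wpM2l//.
  by rewrite ler_piMl ?enorm_ge0.
rewrite dotpBl; lra.
Qed.

End Calculus.

(** * Estimates for a single projected step and momentum update *)

Section Step.
Context {R : realType} {n : nat} (X : set 'rV[R]_n).
Context (X_nonempty : X !=set0) (X_closed : closed X).
Context (X_convex : forall a b (t : R), X a -> X b -> 0 <= t <= 1 ->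
  X (a + t *: (b - a))).
Implicit Types x y g v G : 'rV[R]_n.

(** The obtuse-angle inequality at the new point, tested at the old point x. *)
Lemma step_dotp x G eta : X x ->
  enorm (projection X (x - eta *: G) - x) ^+ 2 +
    eta * dotp G (projection X (x - eta *: G) - x) <= 0.
Proof.
move=> Xx; set d := _ - x.
have := projection_obtuse X_nonempty X_closed X_convex (x - eta *: G) Xx.
rewrite -[projection _ _](subrK x) -/d enormE2.
rewrite (_ : x - eta *: G - (d + x) = - (d + eta *: G)); last first.
  by apply/rowP => i; rewrite !mxE; ring.
rewrite (_ : x - (d + x) = - d); last by rewrite opprD addrCA subrr addr0.
by rewrite dotpNl dotpNr opprK !dotpE.
Qed.

Lemma step_norm x G eta : X x -> 0 <= eta ->
  enorm (projection X (x - eta *: G) - x) <= eta * enorm G.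
Proof.
move=> Xx eta0; have := step_dotp G eta Xx; set d := _ - x => h.
have : enorm d ^+ 2 <= eta * enorm G * enorm d.
  have := ler_wpM2l eta0 (dotp_le (- G) d); rewrite enormN dotpNl; lra.
have [->|d0] := eqVneq (enorm d) 0; first by rewrite mulr_ge0 ?enorm_ge0.
by rewrite expr2 ler_pM2r// lt_neqAle eq_sym d0 enorm_ge0.
Qed.

Lemma step_normal x G eta : X x -> 0 < eta ->
  let x' := projection X (x - eta *: G) in
  normal_cone X x' (- (eta^-1 *: (x' - x)) - G).
Proof.
move=> Xx eta0 x'; split; first exact: projection_in.
move=> y Xy.
have := projection_obtuse X_nonempty X_closed X_convex (x - eta *: G) Xy.
rewrite -/x' (_ : x - eta *: G - x' = eta *: (- (eta^-1 *: (x' - x)) - G)).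
  by rewrite dotpZl pmulr_rle0.
rewrite scalerBr scalerN scalerA divff ?gt_eqF// scale1r opprB.
by rewrite addrAC.
Qed.

Lemma normal_coneZ x v a : 0 <= a -> normal_cone X x v -> normal_cone X x (a *: v).
Proof.
by move=> a0 [Xx h]; split => // y /h vy; rewrite dotpZl mulr_ge0_le0.
Qed.

(** Here h stands for |c|^2 / 2, B for the bound on the momentum and E for the lower bound that the
    error bound supplies at x'. The step decreases t h, with t = rho eta, by a multiple of D^2, and
    D in turn bounds t E; multiplying everything by t avoids quotients. *)
Lemma feasibility_step (h : 'rV[R]_n -> R) (gh : 'rV[R]_n -> 'rV[R]_n)
    x g rho eta B L E :
  X x -> 0 < rho -> 0 < eta -> 0 <= L -> 0 <= E -> enorm g <= B ->
  4 * L * (rho * eta) <= 1 ->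
  let x' := projection X (x - eta *: (g + rho *: gh x)) in
  h x' <= h x + dotp (gh x) (x' - x) + L * enorm (x' - x) ^+ 2 ->
  enorm (gh x' - gh x) <= L * enorm (x' - x) ->
  (forall v, normal_cone X x' v -> E <= enorm (gh x' + v)) ->
  rho * eta * (h x' - h x) + (rho * eta * E) ^+ 2 / 16 <= 2 * (eta * B) ^+ 2.
Proof.
move=> Xx rho0 eta0 L0 E0 gB Lre x' hx' ghx' err.
have sd := step_dotp (g + rho *: gh x) eta Xx.
have sn := step_normal (g + rho *: gh x) Xx eta0.
rewrite -/x' in sd sn; cbv zeta in sn.
set d := x' - x in sd sn hx' ghx'; clearbody d; set D := enorm d in sd hx' ghx'.
have D0 : 0 <= D := enorm_ge0 d.
set t := rho * eta in Lre *; have t0 : 0 < t by rewrite mulr_gt0.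
have B0 : 0 <= B := le_trans (enorm_ge0 g) gB.
have etaB : eta * - dotp g d <= eta * (B * D).
  rewrite ler_pM2l// -dotpNl; apply: le_trans (dotp_le _ _) _.
  by rewrite enormN ler_wpM2r.
have step : t * dotp (gh x) d <= - D ^+ 2 + eta * (B * D).
  rewrite /t; move: sd; rewrite !dotpE; lra.
(* The normal vector of the step, divided by rho, added to gh x' leaves (gh x' - gh x) - d / t - g /
   rho. After multiplication by t the first term costs at most D / 4, since 4 L t <= 1. *)
have tE : t * E <= 2 * D + eta * B.
  have := err _ (normal_coneZ (ltW (_ : 0 < rho^-1)) sn).
  rewrite invr_gt0 => /(_ rho0) h1.
  have h2 : E <= L * D + t^-1 * D + rho^-1 * B.
    apply: le_trans h1 _.
    rewrite (_ : _ + _ = (gh x' - gh x) + - (t^-1 *: d) + - (rho^-1 *: g)); last first.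
      apply/rowP => i; rewrite !mxE /t; field.
      by rewrite !gt_eqF.
    apply: le_trans (ler_enormD _ _) _; rewrite lerD//; last first.
      by rewrite enormN enormZ gtr0_norm ?invr_gt0// ler_pM2l ?invr_gt0.
    apply: le_trans (ler_enormD _ _) _; rewrite lerD//.
    by rewrite enormN enormZ gtr0_norm ?invr_gt0.
  have := ler_wpM2l (ltW t0) h2.
  rewrite !mulrDr !mulrA divff ?gt_eqF// mul1r.
  have -> : t / rho = eta by rewrite /t mulrAC divff ?gt_eqF// mul1r.
  have := ler_wpM2r D0 Lre; lra.
have tE2 : (t * E) ^+ 2 <= 8 * D ^+ 2 + 2 * (eta * B) ^+ 2.
  apply: le_trans (_ : (2 * D + eta * B) ^+ 2 <= _).
    by rewrite lerXn2r ?nnegrE ?addr_ge0 ?mulr_ge0// ltW.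
  have := sqr_ge0 (2 * D - eta * B); rewrite !expr2; lra.
have th : t * (h x' - h x) <= - D ^+ 2 + eta * (B * D) + D ^+ 2 / 4.
  have e1 : t * (h x' - h x) <= t * (dotp (gh x) d + L * D ^+ 2).
    by rewrite ler_pM2l//; lra.
  have := ler_wpM2r (sqr_ge0 D) Lre; lra.
(* The square absorbs eta B D into D^2 / 4 + (eta B)^2. The remaining - D^2 / 2 pays for the D^2
   part of (t E)^2 / 16. *)
have := sqr_ge0 (D / 2 - eta * B); have := sqr_ge0 (eta * B).
rewrite !expr2 in tE2 th *; lra.
Qed.

(** The step is an inexact projected gradient step for f + rho h, whose gradient error is g - gf x.
    Of the D^2 gained, D^2 / 4 pays for smoothness and D^2 / 4 for the error. *)
Lemma penalty_descent_step (f h : 'rV[R]_n -> R) (gf gh : 'rV[R]_n -> 'rV[R]_n)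
    x g rho eta L1 L2 :
  X x -> 0 < rho -> 0 < eta -> 4 * (eta * (L1 + rho * L2)) <= 1 ->
  let x' := projection X (x - eta *: (g + rho *: gh x)) in
  f x' <= f x + dotp (gf x) (x' - x) + L1 * enorm (x' - x) ^+ 2 ->
  h x' <= h x + dotp (gh x) (x' - x) + L2 * enorm (x' - x) ^+ 2 ->
  f x' + rho * h x' + enorm (x' - x) ^+ 2 / (2 * eta) <=
    f x + rho * h x + eta * enorm (g - gf x) ^+ 2.
Proof.
move=> Xx rho0 eta0 Lre x' fx' hx'.
have sd := step_dotp (g + rho *: gh x) eta Xx.
rewrite -/x' in sd.
set d := x' - x in sd hx' fx' *; clearbody d; set D := enorm d in sd hx' fx' *.
set e := enorm (g - gf x).
have ed : eta * - dotp (g - gf x) d <= eta * (e * D).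
  by rewrite ler_pM2l// -dotpNl; apply: le_trans (dotp_le _ _) _; rewrite enormN.
have rh : rho * h x' <= rho * (h x + dotp (gh x) d + L2 * D ^+ 2).
  by rewrite ler_pM2l.
rewrite -(ler_pM2l eta0) mulrDr.
have -> : eta * (D ^+ 2 / (2 * eta)) = D ^+ 2 / 2.
  by field; rewrite gt_eqF.
have h1 : eta * (f x' + rho * h x') <=
    eta * (f x + dotp (gf x) d + L1 * D ^+ 2 + rho * (h x + dotp (gh x) d + L2 * D ^+ 2)).
  by rewrite ler_pM2l// lerD.
have h2 := ler_wpM2r (sqr_ge0 D) Lre.
have h3 := sqr_ge0 (D / 2 - eta * e).
move: sd ed; rewrite !dotpE; rewrite !expr2 in h1 h2 h3 *; lra.
Qed.

(** The normal vector produced by the step itself is the witness for the distance. It carries the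
    weight rho of the step that leads to x', which is why the stationarity condition has the index
    iota - 1 on rho. *)
Lemma stationarity_step (gf gh : 'rV[R]_n -> 'rV[R]_n) x g rho eta L1 L2 :
  X x -> 0 < rho -> 0 < eta -> 4 * (eta * (L1 + rho * L2)) <= 1 ->
  let x' := projection X (x - eta *: (g + rho *: gh x)) in
  enorm (gf x' - gf x) <= L1 * enorm (x' - x) ->
  enorm (gh x' - gh x) <= L2 * enorm (x' - x) ->
  (dist_to 0 (translate (gf x' + rho *: gh x') (normal_cone X x'))
    <= (enorm (g - gf x) + 2 * (enorm (x' - x) / eta))%:E)%E.
Proof.
move=> Xx rho0 eta0 Lre x' gfx' ghx'.
have sn := step_normal (g + rho *: gh x) Xx eta0.
rewrite -/x' in sn; cbv zeta in sn.
set d := x' - x in sn gfx' ghx' *; clearbody d; set D := enorm d in gfx' ghx' *.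
apply: (@le_trans _ _ (enorm (0 - (gf x' + rho *: gh x' +
    (- (eta^-1 *: d) - (g + rho *: gh x)))))%:E).
  by apply: ereal_inf_lbound => /=; eexists; [eexists; [exact: sn|reflexivity]|].
rewrite lee_fin sub0r enormN.
rewrite (_ : _ + _ = (gf x' - gf x) - (g - gf x) + rho *: (gh x' - gh x)
   - eta^-1 *: d); last first.
  by apply/rowP => i; rewrite !mxE; ring.
apply: le_trans (ler_enormB _ _) _; rewrite enormZ gtr0_norm ?invr_gt0//.
have h1 := ler_enormD (gf x' - gf x - (g - gf x)) (rho *: (gh x' - gh x)).
have h2 := ler_enormB (gf x' - gf x) (g - gf x).
rewrite enormZ gtr0_norm// in h1.
have h3 := ler_wpM2l (ltW rho0) ghx'.
have h4 : (L1 + rho * L2) * D <= D / eta.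
  rewrite ler_pdivlMr// -mulrA (mulrC D) mulrA ler_piMl ?enorm_ge0//; lra.
rewrite -/D (mulrC eta^-1); lra.
Qed.

End Step.

(** The vector v lies in the ball and is its own projection, so truncation, being nonexpansive,
    brings nothing farther from v. *)
Lemma momentum_step {R : realType} {n : nat} (B al : R) (g s v : 'rV[R]_n) :
  0 <= B -> enorm v <= B ->
  enorm (projection (cball B) ((1 - al) *: g + al *: s) - v) <=
  enorm ((1 - al) *: (g - v) + al *: (s - v)).
Proof.
move=> B0 vB.
have pv := projection_id (@cball_nonempty R n B B0) (@cball_closed R n B) vB.
rewrite -{1}pv; apply: le_trans (projection_nonexpansive _ _ _ _ _) _.
- exact: cball_nonempty.
- exact: cball_closed.
- exact: cball_convex.
by apply: enorm_le; rewrite le_eqVlt; apply/orP; left; apply/eqP;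
  congr (dotp _ _); apply/rowP => i; rewrite !mxE; ring.
Qed.

Lemma momentum_young {R : realFieldType} (al e w v : R) :
  0 < al <= 1 -> 0 <= e -> 0 <= w -> 0 <= v <= e + w ->
  (1 - al) ^+ 2 * v ^+ 2 <= (1 - al) * e ^+ 2 + w ^+ 2 / al.
Proof.
move=> /andP[a0 a1] e0 w0 /andP[v0 vew].
apply: (@le_trans _ _ ((1 - al) ^+ 2 * (e + w) ^+ 2)).
  by rewrite ler_wpM2l ?sqr_ge0// lerXn2r ?nnegrE ?addr_ge0.
rewrite -(ler_pM2l a0) [leRHS]mulrDr mulrC.
have -> : al * (w ^+ 2 / al) = w ^+ 2 by rewrite mulrCA divff ?gt_eqF// mulr1.
have b0 : 0 <= 1 - al by lra.
(* Young's inequality for e w with weight al / (1 - al), multiplied out because al = 1 is allowed.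
   It spends one of the two factors 1 - al. *)
have := mulr_ge0 b0 (sqr_ge0 (al * e - (1 - al) * w)).
have := mulr_ge0 (mulr_ge0 b0 b0) (sqr_ge0 w).
have := mulr_ge0 b0 (mulr_ge0 (ltW a0) (sqr_ge0 w)).
have := mulr_ge0 (mulr_ge0 b0 (mulr_ge0 (ltW a0) (ltW a0))) (sqr_ge0 e).
have := mulr_ge0 (ltW a0) (sqr_ge0 w).
rewrite !expr2; nra.
Qed.

(** * Real sequences: power rates, logarithms and inversion of a rate *)

Section Rates.
Context {R : realType}.
Implicit Types (r s theta : R) (k : nat).

Lemma powR_succ_le r k : (0 < k)%N -> 0 <= r <= 1 ->
  k.+1%:R `^ r - k%:R `^ r <= k%:R `^ r / k%:R.
Proof.
move=> k0 /andP[r0 r1].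
have k0' : (0 : R) < k%:R by rewrite ltr0n.
have -> : k.+1%:R = k%:R * (1 + k%:R^-1) :> R.
  by rewrite mulrDr mulr1 divff ?gt_eqF// -natr1.
rewrite powRM ?addr_ge0 ?invr_ge0 ?(ltW k0')//.
have : (1 + k%:R^-1) `^ r <= 1 + k%:R^-1 :> R.
  by apply: ler1_powR => //; rewrite lerDl invr_ge0 ltW.
move=> /(ler_wpM2l (powR_ge0 (k%:R : R) r)); rewrite mulrDr mulr1; lra.
Qed.

Lemma powRN_succ_ge s k : (0 < k)%N -> 0 <= s <= 1 ->
  k%:R `^ (- s) / (1 + k%:R^-1) <= k.+1%:R `^ (- s).
Proof.
move=> k0 /andP[s0 s1].
have k0' : (0 : R) < k%:R by rewrite ltr0n.
have -> : k.+1%:R = k%:R * (1 + k%:R^-1) :> R.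
  by rewrite mulrDr mulr1 divff ?gt_eqF// -natr1.
have K1 : 1 <= 1 + k%:R^-1 :> R by rewrite lerDl invr_ge0 ltW.
rewrite powRM ?addr_ge0 ?invr_ge0 ?(ltW k0')// ler_wpM2l ?powR_ge0//.
rewrite powRN lef_pV2 ?posrE ?powR_gt0 ?(lt_le_trans ltr01)//.
exact: ler1_powR.
Qed.

Lemma powRN_succ_half s k : (0 < k)%N -> 0 <= s <= 1 ->
  k%:R `^ (- s) / 2 <= k.+1%:R `^ (- s).
Proof.
move=> k0 s01; apply: le_trans (powRN_succ_ge k0 s01).
rewrite ler_wpM2l ?powR_ge0// lef_pV2 ?posrE//.
by rewrite (_ : 2 = 1 + 1)// lerD2l invf_le1 ?ltr0n// ler1n.
Qed.

Lemma powRN_succ_diff s k : (0 < k)%N -> 0 <= s <= 1 ->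
  k%:R `^ (- s) <= k.+1%:R `^ (- s) + k%:R `^ (- s) / k%:R.
Proof.
move=> k0 s01; apply: le_trans (lerD (powRN_succ_ge k0 s01) (lexx _)).
have : (0 : R) < k%:R^-1 by rewrite invr_gt0 ltr0n.
set q := k%:R^-1 => q0.
rewrite -lerBlDr -{1}[_ `^ _]mulr1 -mulrBr.
rewrite ler_wpM2l ?powR_ge0//.
rewrite -[leRHS]mul1r ler_pdivlMr; last lra.
have := sqr_ge0 q; rewrite expr2; lra.
Qed.

Lemma ler_powR_nat r k (l : nat) : 0 <= r -> (k <= l)%N -> k%:R `^ r <= l%:R `^ r :> R.
Proof. by move=> r0 kl; rewrite ge0_ler_powR// ?nnegrE// ler_nat. Qed.

Lemma powR_nat_gt0 r k : (0 < k)%N -> 0 < k%:R `^ r :> R.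
Proof. by move=> k0; rewrite powR_gt0// ltr0n. Qed.

(** Each term satisfies 1 / k <= 2 / (k + 1) <= 2 (ln (k + 1) - ln k). The induction runs with the
    bound 2 ln k, which telescopes; ln (k + 2) is the form in the step sizes and is positive even at
    k = 0. *)
Lemma harmonic_le k0 k : (0 < k0)%N ->
  \sum_(k0 <= j < k) (j%:R^-1 : R) <= 2 * ln (k%:R + 2).
Proof.
move=> k00; have lnk2 l : 0 <= ln (l%:R + 2) :> R.
  by apply: ln_ge0; have := ler0n R l; lra.
have [kk0|k0k] := leqP k k0; first by rewrite big_geq// mulr_ge0.
apply: (@le_trans _ _ (2 * ln k%:R)); last first.
  rewrite ler_pM2l// ler_ln ?posrE ?ltr0n ?(leq_ltn_trans _ k0k) ?ltr_wpDl//.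
  by rewrite lerDl.
have {k0k} := ltnW k0k; elim: k => [|k IH]; first by case: k0 k00.
rewrite leq_eqVlt => /predU1P[<-|].
  by rewrite big_geq// mulr_ge0// ln_ge0// ler1n.
rewrite ltnS => k0k; rewrite big_nat_recr//=.
have kp : (0 < k)%N := leq_trans k00 k0k.
have k0' : (0 : R) < k%:R by rewrite ltr0n.
have k1' : (0 : R) < k.+1%:R by rewrite ltr0n.
have : ln (1 + - k.+1%:R^-1) <= - k.+1%:R^-1 :> R.
  by apply: le_ln1Dx; rewrite ltrN2 invf_lt1// ltr1n ltnS.
have -> : 1 + - k.+1%:R^-1 = k%:R / k.+1%:R :> R.
  by rewrite -natr1; field; rewrite natr1 gt_eqF.
rewrite ln_div ?posrE// => h.
have : k%:R^-1 <= 2 * k.+1%:R^-1 :> R.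
  rewrite ler_pdivlMr// mulrC ler_pdivrMr// mulrC -natrM ler_nat; lia.
move: h (IH k0k); set q := k.+1%:R^-1; set q' := k%:R^-1.
by set ln1 := ln k.+1%:R; set ln0 := ln k%:R; set S := \sum_(_ <= _ < _) _; lra.
Qed.

Lemma eventually_ln_ge (A : R) : exists2 k0 : nat, (0 < k0)%N &
  forall k, (k0 <= k)%N -> A <= ln (k%:R + 2).
Proof.
exists (Num.truncn (expR A)).+1 => // k hk.
rewrite -(expRK A) ler_ln ?posrE ?expR_gt0//.
apply: le_trans (ltW (truncnS_gt _)) _.
by apply: le_trans (_ : k%:R <= _); [rewrite ler_nat|rewrite lerDl].
Qed.

(** Half of the exponent, t = s / 2, absorbs the logarithm through ln (k + 2) <= (3 k)^t / t; the
    other half makes the product small. *)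
Lemma eventually_powRN_ln_le s (B : R) : 0 < s -> 0 < B ->
  exists2 k0 : nat, (0 < k0)%N &
  forall k, (k0 <= k)%N -> k%:R `^ (- s) * ln (k%:R + 2) <= B.
Proof.
move=> s0 B0; pose t := s / 2.
have t0 : 0 < t by rewrite divr_gt0.
pose D := t^-1 * 3 `^ t / B.
exists (Num.truncn (D `^ (t^-1))).+1 => // k hk.
have kp : (0 < k)%N by apply: leq_trans hk.
have k0' : (0 : R) < k%:R by rewrite ltr0n.
have kt : 0 < k%:R `^ t :> R by exact: powR_nat_gt0.
have D0 : 0 <= D by rewrite !mulr_ge0 ?invr_ge0 ?powR_ge0// ltW.
have Dk : D <= k%:R `^ t.
  apply: (@le_trans _ _ ((D `^ t^-1) `^ t)).
    by rewrite -powRrM mulVf ?lt0r_neq0// powRr1.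
  rewrite ge0_ler_powR ?nnegrE ?powR_ge0 ?ler0n ?(ltW t0)//.
  by apply/ltW; apply: lt_le_trans (truncnS_gt _) _; rewrite ler_nat.
have lnk : ln (k%:R + 2) <= t^-1 * (3 `^ t * k%:R `^ t) :> R.
  rewrite mulrC ler_pdivlMr// mulrC -ln_powR -powRM//.
  have k2 : (0 : R) < k%:R + 2 by rewrite ltr_wpDl.
  apply: le_trans (ltW (ln_sublinear (powR_gt0 _ k2))) _.
  rewrite ge0_ler_powR ?nnegrE ?(ltW k2) ?(ltW t0)// ?mulr_ge0//.
  have : (1 : R) <= k%:R by rewrite ler1n.
  lra.
apply: (@le_trans _ _ (k%:R `^ (- s) * (t^-1 * (3 `^ t * k%:R `^ t)))).
  by rewrite ler_wpM2l ?powR_ge0.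
have -> : k%:R `^ (- s) = (k%:R `^ t)^-1 * (k%:R `^ t)^-1 :> R.
  have -> : - s = - t + - t by rewrite /t; lra.
  by rewrite powRD ?(gt_eqF k0') ?implybT ?powRN.
have DB : D * B = t^-1 * 3 `^ t by rewrite /D divfK ?gt_eqF.
rewrite (mulrA t^-1) -DB; set w := k%:R `^ t in kt Dk *.
have -> : w^-1 / w * (D * B * w) = D * B / w by field; rewrite gt_eqF.
by rewrite ler_pdivrMr// mulrC ler_pM2l.
Qed.

(** Induction by contradiction: if a k.+1 exceeded M (k + 1)^-s, the dissipation would beat both the
    noise and the drop of k^-s in one step. The relation s theta = 2 r makes dissipation and noise
    scale alike. M precedes a, so one constant serves all runs. *)
Lemma recursion_rate theta s r (c1 c2 kap A : R) k0 :
  1 <= theta -> 0 < s -> s <= 1 -> 0 < r -> r <= 1 / 2 -> s * theta = 2 * r ->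
  0 < c1 -> 0 <= c2 -> 0 < kap -> (0 < k0)%N ->
  (forall k, (k0 <= k)%N -> k%:R `^ (- s) * (kap * ln (k%:R + 2)) * 4 <= c1) ->
  exists2 M, 0 <= M & forall a : nat -> R, (forall k, 0 <= a k) -> a k0 <= A ->
  (forall k, (k0 <= k)%N ->
    let tau := k%:R `^ r * (k%:R `^ (- (1 / 2)) / (kap * ln (k%:R + 2))) in
    a k.+1 + c1 * tau * (a k.+1) `^ theta <= a k + c2 * tau * k%:R `^ (- (2 * r))) ->
  forall k, (k0 <= k)%N -> a k <= M * k%:R `^ (- s).
Proof.
move=> th1 s0 s1 r0 r12 sth c10 c20 kap0 k00 small.
(* The summands serve M <= M^theta, the bound of the noise by half of the dissipation, and the
   initial index k0, in this order. *)
pose M := 1 + 4 * c2 / c1 + `|A| * k0%:R `^ s.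
have M1 : 1 <= M.
  rewrite /M -addrA lerDl; apply: addr_ge0.
    by rewrite !mulr_ge0 ?invr_ge0 ?(ltW c10).
  by rewrite mulr_ge0 ?powR_ge0.
have Mc2 : 4 * c2 <= c1 * M.
  rewrite /M !mulrDr; have -> : c1 * (4 * c2 / c1) = 4 * c2 by field; rewrite gt_eqF.
  have := mulr_ge0 (ltW c10) (mulr_ge0 (normr_ge0 A) (powR_ge0 (k0%:R : R) s)); lra.
have M0 : 0 <= M := le_trans ler01 M1.
exists M => // a a0 aA rec; elim=> [|k IH]; first by rewrite leqNgt k00.
rewrite leq_eqVlt => /predU1P[<-|].
  apply: le_trans aA _; rewrite /M mulrDl.
  rewrite -[X in _ <= _ + X]mulrA -powRD; last by rewrite pnatr_eq0 -lt0n k00 implybT.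
  rewrite subrr powRr0 mulr1.
  have : 0 <= (1 + 4 * c2 / c1) * k0%:R `^ (- s).
    rewrite mulr_ge0 ?powR_ge0//; apply: addr_ge0 => //.
    by rewrite !mulr_ge0 ?invr_ge0 ?(ltW c10).
  by have := ler_norm A; lra.
rewrite ltnS => k0k; have {IH} ak := IH k0k.
have {rec} := rec k k0k; set tau := _ * (_ / _) => /= rec.
have kp : (0 < k)%N := leq_trans k00 k0k.
have k0' : (0 : R) < k%:R by rewrite ltr0n.
have l0 : 0 < ln (k%:R + 2) :> R.
  by apply: ln_gt0; have := ler0n R k; lra.
have tau0 : 0 <= tau.
  by rewrite /tau !mulr_ge0 ?powR_ge0 ?invr_ge0 ?mulr_ge0 ?(ltW kap0) ?(ltW l0).
have [//|big] := leP (a k.+1) _.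
exfalso.
set K1 := k.+1%:R `^ (- s) in big *.
have K10 : 0 <= K1 by exact: powR_ge0.
have s01 : 0 <= s <= 1 by rewrite ltW.
have diff := powRN_succ_diff kp s01; rewrite -/K1 in diff.
set ks := k%:R `^ (- s) in ak diff.
set k2r := k%:R `^ (- (2 * r)) in rec.
have k2r0 : 0 <= k2r by exact: powR_ge0.
(* Here theta >= 1 and M >= 1 give M^theta >= M, and passing from k + 1 to k costs at most a factor
   2. *)
have apow : M * (k2r / 2) <= (a k.+1) `^ theta.
  apply: (@le_trans _ _ ((M * K1) `^ theta)); last first.
    by rewrite ge0_ler_powR ?nnegrE ?(ltW big) ?mulr_ge0// (le_trans _ th1).
  rewrite powRM//; apply: ler_pM => //; first by rewrite divr_ge0.
    exact: le1r_powR.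
  rewrite /K1 -powRrM mulNr sth; apply: powRN_succ_half => //.
  by apply/andP; split; lra.
have h1 : c1 * tau * (M * (k2r / 2)) <= c1 * tau * (a k.+1) `^ theta.
  by rewrite ler_wpM2l// mulr_ge0// ltW.
have h2 : M * ks <= M * K1 + M * (ks / k%:R) by rewrite -mulrDr ler_wpM2l.
have h3 : c2 * (tau * k2r) <= c1 * M / 4 * (tau * k2r).
  by apply: ler_wpM2r; [rewrite mulr_ge0|rewrite ler_pdivlMr// mulrC].
have h4 : c1 * tau * (M * (k2r / 2)) - c1 * M / 4 * (tau * k2r) < M * (ks / k%:R).
  lra.
have h5 : M * (c1 / 4 * (tau * k2r)) < M * (ks / k%:R) by lra.
rewrite ltr_pM2l in h5; last by rewrite (lt_le_trans ltr01).
have := small k k0k; rewrite -/ks => sm.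
(* Up to the logarithm, tau k^(-2r) is k^(-r - 1/2), which is at least 1 / k because r <= 1 / 2. The
   factor k^-s on the left is left over to beat the logarithm. *)
suff : ks / k%:R <= c1 / 4 * (tau * k2r) by lra.
have e1 : k%:R^-1 <= k%:R `^ r * k%:R `^ (- (1 / 2)) * k2r :> R.
  rewrite /k2r -!powRD ?(gt_eqF k0') ?implybT// -powR_inv1; last exact: ltW.
  apply: ler_powR; first by rewrite ler1n.
  lra.
set l := kap * ln _ in sm *.
have lp : 0 < l by rewrite mulr_gt0.
rewrite -/l /tau.
have -> : c1 / 4 * (k%:R `^ r * (k%:R `^ (- (1 / 2)) / (kap * ln (k%:R + 2))) * k2r) =
   (c1 / (4 * l)) * (k%:R `^ r * k%:R `^ (- (1 / 2)) * k2r).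
  by rewrite /l; field; rewrite !gt_eqF.
apply: ler_pM => //; rewrite ?powR_ge0 ?invr_ge0 ?ler0n//.
by rewrite ler_pdivlMr ?mulr_gt0//; lra.
Qed.

(** The threshold is eps^-p ln(1 / eps)^(2p): there k^(-1/p) is at most eps / ln(1 / eps)^2, one
    logarithm cancels ln (k + 2), and the other absorbs C. For large eps the threshold of the fixed
    value e0 is used. *)
Lemma soft_O_powR_ln (p C : R) (K0 : nat) : 1 <= p -> 0 <= C ->
  exists2 T : R -> nat, soft_O p T & forall eps k, 0 < eps -> (T eps <= k)%N ->
    (K0 <= k)%N /\ C * (k%:R `^ (- p^-1) * ln (k%:R + 2)) <= eps.
Proof.
move=> p1 C0; have p0 : 0 < p := lt_le_trans ltr01 p1.
(* A lower bound for ln(1 / e): the summands make the iterated logarithm nonnegative, push k beyond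
   K0, and outweigh the constant C (4 p + 2) obtained at the end. *)
pose L0 := 1 + K0%:R + C * (4 * p + 2).
have C1 : 0 <= C * (4 * p + 2) by rewrite mulr_ge0//; lra.
have L01 : 1 <= L0 by rewrite /L0; have := ler0n R K0; lra.
pose e0 := expR (- L0).
pose Y e := e `^ (- p) * ln e^-1 `^ (2 * p) : R.
pose T eps := (Num.truncn (Y (Num.min eps e0))).+1.
have eP e : 0 < e -> e <= e0 -> [/\ L0 <= ln e^-1, 1 <= Y e,
    ln (Y e) = p * (ln e^-1 + 2 * ln (ln e^-1)) & e = expR (- ln e^-1)].
  move=> ep ee0.
  have L : L0 <= ln e^-1.
    rewrite lnV ?posrE// lerNr -(expRK (- L0)) ler_ln ?posrE ?expR_gt0//.
  have Lp : 0 < ln e^-1 by rewrite (lt_le_trans ltr01)// (le_trans L01).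
  have Y0 : 0 < Y e by rewrite mulr_gt0 ?powR_gt0.
  have lnY : ln (Y e) = p * (ln e^-1 + 2 * ln (ln e^-1)).
    rewrite lnM ?posrE ?powR_gt0// !ln_powR lnV ?posrE//; ring.
  split => //; last by rewrite lnV ?posrE// opprK lnK// posrE.
  rewrite -ler_ln ?posrE// ln1 lnY mulr_ge0 ?(ltW p0)//.
  have := ln_ge0 (le_trans L01 L); lra.
exists T.
  exists 2, (2 * p), e0; split => //; first by lra.
    exact: expR_gt0.
  move=> eps /andP[eps0 epse0]; have [_ Y1 _ _] := eP _ eps0 (ltW epse0).
  rewrite /T min_l; last exact: ltW.
  have -> : 2 * eps `^ (- p) * ln eps^-1 `^ (2 * p) = 2 * Y eps by rewrite mulrA.
  clearbody Y; rewrite -natr1.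
  have : (Num.truncn (Y eps))%:R <= Y eps by rewrite truncn_le; lra.
  lra.
move=> eps k eps0; rewrite /T; set e := Num.min eps e0 => Tk.
have ep : 0 < e by rewrite lt_min eps0 expR_gt0.
have ee0 : e <= e0 by rewrite ge_min lexx orbT.
have [L Y1 lnY eE] := eP _ ep ee0.
set l := ln e^-1 in L lnY eE.
have Yk : Y e <= k%:R.
  by apply: le_trans (ltW (truncnS_gt _)) _; rewrite ler_nat.
have k1 : 1 <= k%:R :> R by apply: le_trans Yk.
have kp : 0 < k%:R :> R by apply: lt_le_trans k1.
have l1 : 1 <= l by exact: le_trans L.
have lnl : 0 <= ln l by exact: ln_ge0.
have lnl_le : ln l <= l by rewrite ltW// ln_sublinear//; lra.
have lnYk : p * (l + 2 * ln l) <= ln k%:R.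
  by rewrite -lnY ler_ln ?posrE//; lra.
set u := ln k%:R in lnYk.
have pl : l <= p * (l + 2 * ln l).
  have := mulr_ge0 (_ : 0 <= p - 1) (_ : 0 <= l + 2 * ln l); lra.
have ku : u <= k%:R by rewrite ltW// ln_sublinear.
split.
  by rewrite -(ler_nat R); move: L C1; rewrite /L0; lra.
apply: (@le_trans _ _ e); last by rewrite ge_min lexx.
(* The excess of (ln k) / p over its value at the threshold. It contributes the factor exp (- t),
   and t exp (- t) <= 1 replaces a monotonicity argument for k^(-1/p) ln k. *)
pose t := u / p - (l + 2 * ln l).
have t0 : 0 <= t.
  by rewrite /t subr_ge0 ler_pdivlMr// mulrC.
have uE : u = p * (l + 2 * ln l + t) by rewrite /t; field; rewrite gt_eqF.
have kE : k%:R `^ (- p^-1) = expR (- l) * (l ^+ 2)^-1 * expR (- t).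
  rewrite /powR gt_eqF// -/u uE.
  have -> : - p^-1 * (p * (l + 2 * ln l + t)) = - l + - (ln l + ln l) + - t.
    by field; rewrite gt_eqF.
  by rewrite !expRD (expRN (ln l + ln l)) expRD lnK ?posrE ?expr2//; lra.
have lnk2 : ln (k%:R + 2) <= u + 2.
  have -> : k%:R + 2 = k%:R * (1 + 2 / k%:R) :> R by field; rewrite gt_eqF.
  have k20 : 0 < 2 / k%:R :> R by rewrite divr_gt0.
  rewrite lnM ?posrE// ?addr_gt0//.
  rewrite lerD2l; apply: le_trans (le_ln1Dx _) _.
    by apply: lt_trans k20; rewrite ltrN10.
  by rewrite ler_pdivrMr// ler_peMr.
have E0 : 0 <= expR (- t) := expR_ge0 _.
have E1 : expR (- t) <= 1 by rewrite expR_le1 oppr_le0 t0.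
have tE : t * expR (- t) <= 1.
  by rewrite expRN ler_pdivrMr ?expR_gt0// mul1r; have := expR_ge1Dx t; lra.
have uEt : (u + 2) * expR (- t) <= (4 * p + 2) * l.
  have h : (u + 2) * expR (- t) =
    (p * (l + 2 * ln l) + 2) * expR (- t) + p * (t * expR (- t)).
    by rewrite uE; ring.
  rewrite h; have a1 : p * (t * expR (- t)) <= p * l by rewrite ler_pM2l//; lra.
  have a2 : p * (l + 2 * ln l) <= p * (3 * l) by rewrite ler_pM2l//; lra.
  have a0 : 0 <= p * (l + 2 * ln l) + 2 by lra.
  have := ler_wpM2l a0 E1; lra.
have key : C * ((l ^+ 2)^-1 * ((4 * p + 2) * l)) <= 1.
  rewrite (_ : _ * _ = C * (4 * p + 2) / l); last by field; rewrite gt_eqF//; lra.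
  rewrite ler_pdivrMr; last lra.
  by rewrite mul1r; move: L; rewrite /L0; have := ler0n R K0; lra.
rewrite kE.
apply: (@le_trans _ _ (C * (expR (- l) * (l ^+ 2)^-1 * expR (- t) * (u + 2)))).
  rewrite ler_wpM2l// ler_wpM2l// !mulr_ge0 ?expR_ge0//.
  by rewrite invr_ge0 sqr_ge0.
apply: (@le_trans _ _ (expR (- l) * (C * ((l ^+ 2)^-1 * ((4 * p + 2) * l))))).
  rewrite (_ : C * _ = expR (- l) * (C * ((l ^+ 2)^-1 * ((u + 2) * expR (- t))))); last ring.
  by rewrite !ler_wpM2l ?expR_ge0// invr_ge0 sqr_ge0.
by rewrite [leRHS]eE -[leRHS]mulr1 ler_wpM2l ?expR_ge0.
Qed.

End Rates.

(** * Measurability of compositions, and comparison of integrals *)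

Section Measurability.
Context {R : realType} {d : measure_display} {T : measurableType d} {n : nat}.

(** The vector argument is rounded down to the grid of mesh 1 / (N + 1). It then takes countably
    many values, so the composition is measurable piece by piece; continuity in that argument gives
    the limit. Random vectors are measured through their coordinates. *)
Lemma measurable_caratheodory d2 (T2 : measurableType d2)
    (H : 'rV[R]_n -> T2 -> R) (x : T -> 'rV[R]_n) (t : T -> T2) :
  (forall s, continuous (H^~ s)) -> (forall u, measurable_fun setT (H u)) ->
  (forall i, measurable_fun setT (fun w => x w 0 i)) ->
  measurable_fun setT t -> measurable_fun setT (fun w => H (x w) (t w)).
Proof.
move=> cH mH mx mt.
pose grid N (z : 'rV[int]_n) : 'rV[R]_n := \row_i ((z 0 i)%:~R / N.+1%:R).
pose cell N w : 'rV[int]_n := \row_i Num.floor (N.+1%:R * x w 0 i).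
apply: (measurable_fun_cvg (h := fun N w => H (grid N (cell N w)) (t w))).
- move=> N _ A mA; rewrite setTI.
  rewrite (_ : _ @^-1` A = \bigcup_(z : 'rV[int]_n)
    ((\bigcap_(i : 'I_n) ((fun w => x w 0 i) @^-1`
        `[(z 0 i)%:~R / N.+1%:R, (z 0 i + 1)%:~R / N.+1%:R[)) `&`
     ((fun w => H (grid N z) (t w)) @^-1` A))); last first.
    have cellP w i (z : int) : (Num.floor (N.+1%:R * x w 0 i) == z) =
        (z%:~R / N.+1%:R <= x w 0 i < (z + 1)%:~R / N.+1%:R).
      by rewrite floor_eq ler_pdivrMr// ltr_pdivlMr// mulrC.
    apply/seteqP; split => [w /= Aw|w [z _ [/= zw Aw]]].
      exists (cell N w) => //; split => //= i _ /=.
      by rewrite in_itv/= -cellP mxE.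
    suff -> : cell N w = z by [].
    apply/rowP => i; rewrite mxE; apply/eqP; rewrite cellP.
    by have := zw i I; rewrite /= in_itv.
  apply: countable_bigcupT_measurable => [|z]; first exact: countableP.
  apply: measurableI.
    apply: fin_bigcap_measurable => [|i _]; first exact: finite_finset.
    by rewrite -[X in measurable X]setTI; apply: mx => //; exact: measurable_itv.
  rewrite -[X in measurable X]setTI.
  by apply: (measurableT_comp (mH (grid N z)) mt).
- move=> w _; have cg : grid N (cell N w) @[N --> \oo] --> x w.
    apply/cvgrPdist_le => e e0; near=> N.
    have N0 : (0 : R) < N.+1%:R by [].
    rewrite [X in X <= _](_ : _ = mx_norm (x w - grid N (cell N w)))// mx_normrE.
    apply/bigmax_leP; split => [|[i j] _ /=]; first exact: ltW.
    rewrite ord1 !mxE.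
    have /andP[f1 f2] := floor_itv (N.+1%:R * x w 0 j).
    set m := Num.floor _ in f1 f2 *; set a := x w 0 j in f1 f2 *.
    have -> : a - m%:~R / N.+1%:R = (N.+1%:R * a - m%:~R) / N.+1%:R.
      by rewrite mulrBl mulrAC divff ?mul1r// gt_eqF.
    rewrite normf_div (gtr0_norm N0) ger0_norm ?subr_ge0//.
    apply: (@le_trans _ _ N.+1%:R^-1).
      by rewrite ler_pdivrMr// mulVf ?gt_eqF// lerBlDl -(intrD _ _ 1) ltW// addrC.
    by apply: ltW; near: N; exact: (near_infty_natSinv_lt (PosNum e0)).
  by have := cvg_comp _ _ cg (cH (t w) (x w)); apply.
Unshelve. all: by end_near. Qed.

Lemma measurable_continuous_rV (phi : 'rV[R]_n -> R) (x : T -> 'rV[R]_n) :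
  continuous phi -> (forall i, measurable_fun setT (fun w => x w 0 i)) ->
  measurable_fun setT (fun w => phi (x w)).
Proof.
move=> cphi mx.
by apply: (@measurable_caratheodory _ T (fun u _ => phi u) x id).
Qed.

(** The integral of a nonnegative function is a supremum over simple functions below it, hence
    monotone for arbitrary functions. This allows bounding the integral of a distance to a random
    normal cone. *)
Lemma ge0_le_integral_nonmeasurable (mu : {measure set T -> \bar R})
    (f g : T -> \bar R) :
  (forall w, (0 <= f w)%E) -> (forall w, (f w <= g w)%E) ->
  (\int[mu]_w f w <= \int[mu]_w g w)%E.
Proof.
move=> f0 fg; rewrite !ge0_integralTE// => [|w]; last exact: le_trans (fg w).
apply: le_ereal_sup => _ [h hf <-]; exists h => // w.
exact: le_trans (hf w) (fg w).
Qed.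

End Measurability.

(** * Independence as iterated integration *)

Section Independent.
Local Open Scope ereal_scope.
Context {R : realType} {d d1 d2 : measure_display} {T : measurableType d}
  {T1 : measurableType d1} {T2 : measurableType d2}.
Context (P : probability T R) (nu : probability T2 R).

(** The product formula on rectangles identifies the joint law of X and Y with the product of the
    law of X and nu; Tonelli does the rest. *)
Lemma ge0_integral_independent (X : T -> T1) (Y : T -> T2)
    (psi : T1 * T2 -> \bar R) :
  measurable_fun setT X -> measurable_fun setT Y ->
  (forall A B, measurable A -> measurable B ->
    P (X @^-1` A `&` Y @^-1` B) = P (X @^-1` A) * nu B) ->
  measurable_fun setT psi -> (forall z, 0 <= psi z) ->
  \int[P]_w psi (X w, Y w) = \int[P]_w \int[nu]_s psi (X w, s).
Proof.
move=> mX mY indep mpsi psi0.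
pose XY := fun w : T => (X w, Y w).
have mXY : measurable_fun setT XY by exact: measurable_fun_pair.
pose X' : {mfun T >-> T1} := HB.pack X (isMeasurableFun.Build _ _ _ _ _ mX).
pose XY' : {mfun T >-> (T1 * T2)%type} :=
  HB.pack XY (isMeasurableFun.Build _ _ _ _ _ mXY).
transitivity (\int[distribution P XY']_z psi z).
  by rewrite /distribution (ge0_integral_pushforward (phi := XY)).
transitivity (\int[distribution P X' \x nu]_z psi z).
  apply: eq_measure_integral => A mA _; apply/esym.
  by apply: product_measure_unique => // B C mB mC; exact: indep.
rewrite fubini_tonelli1//.
rewrite /distribution (ge0_integral_pushforward (phi := X))//.
  exact: measurable_fun_fubini_tonelli_F.
by move=> w _; apply: integral_ge0.
Qed.

(** The identity into T with a coarser sigma-algebra is the random element that represents the past: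
    conditioning on G becomes the outer integral above. *)
Lemma measurable_g_sigma_id (G : set (set T)) : G `<=` measurable ->
  measurable_fun [set: T] (fun w : T => w : g_sigma_algebraType G).
Proof.
move=> GM _ A GA; rewrite setTI; apply: (smallest_sub _ GM) GA.
exact: sigma_algebra_measurable.
Qed.

End Independent.

Section Samples.
Context {R : realType} {dO dXi : measure_display} {Omega : measurableType dO}
  {Xi : measurableType dXi}.
Context (P : probability Omega R) (mu : probability Xi R).
Context (xi : nat -> {RV P >-> Xi}).

Definition samples_upto k : set (set Omega) :=
  \bigcup_(j in [set j | (0 < j <= k)%N]) preimage_set_system setT (xi j) measurable.

Lemma samples_upto_measurable k : samples_upto k `<=` measurable.
Proof.
by move=> _ [j _ [B mB <-]]; rewrite setTI -[X in measurable X]setTI; exact: measurable_funPT.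
Qed.

(** Mutual independence speaks of finite intersections of preimages only. These form a generating
    pi-system, and the events A with the product formula form a Dynkin system. *)
Lemma independent_next k A B : iid_samples mu xi ->
  <<s samples_upto k >> A -> measurable B ->
  (P (A `&` xi k.+1 @^-1` B) = P A * mu B)%E.
Proof.
move=> [indep dist] + mB.
(* All indices 1 to k occur, with [setT] where nothing is required, so the family is stable under
   intersection. *)
pose Pi : set (set Omega) := [set A | exists2 F : nat -> set Xi,
  (forall j, measurable (F j)) &
  A = \bigcap_(j in [set j | (0 < j <= k)%N]) xi j @^-1` F j].
have mxi j C : measurable C -> measurable (xi j @^-1` C).
  by move=> mC; rewrite -[X in measurable X]setTI; exact: measurable_funPT.
have PiG : <<s samples_upto k >> = <<s Pi >>.
  apply/seteqP; split; apply: smallest_sub; try exact: smallest_sigma_algebra.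
    move=> _ [j jk [C mC <-]]; apply: sub_gen_smallest; rewrite setTI.
    exists (fun i => if i == j then C else setT) => [i|]; first by case: ifP.
    apply/seteqP; split => [w Cw i ik|w /(_ j jk)] /=; rewrite ?eqxx//.
    by case: eqP => [->|//].
  move=> _ [F mF ->].
  apply: (@fin_bigcap_measurable _ (g_sigma_algebraType (samples_upto k))).
    by apply: (@sub_finite_set _ _ `I_k.+1) => // j /= /andP[_].
  move=> j jk; apply: sub_gen_smallest; exists j => //.
  by exists (F j) => //; rewrite setTI.
pose Y := xi k.+1 @^-1` B.
have mY : measurable Y by exact: mxi.
have PY : P Y = mu B by rewrite -(dist k.+1).
have Pi_indep A' : Pi A' -> (P (A' `&` Y) = P A' * mu B)%E.
  move=> [F mF ->].
  pose J : {fset nat} := [fset j in iota 1 k]%fset.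
  have JP j : (j \in J) = (0 < j <= k)%N.
    by rewrite /J !inE /= mem_iota add1n ltnS.
  have JE : [set j | (0 < j <= k)%N] = [set` J].
    by apply/seteqP; split => j /=; rewrite JP.
  pose F' j := if j == k.+1 then B else F j.
  have mF' j : measurable (F' j) by rewrite /F'; case: ifP.
  have kJ : k.+1 \notin J by rewrite JP ltnn andbF.
  have -> : \bigcap_(j in [set j | (0 < j <= k)%N]) xi j @^-1` F j `&` Y =
      \bigcap_(j in [set` (k.+1 |` J)%fset]) xi j @^-1` F' j.
    apply/seteqP; split => [w [Fw Yw] j /=|w FYw].
      rewrite in_fset1U => /orP[/eqP ->|]; first by rewrite /F' eqxx.
      move=> jJ; rewrite /F'; case: eqP => [->//|_].
      by apply: Fw; rewrite /= -JP.
    split => [j /= jk|].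
      have := FYw j; rewrite /= /F' in_fset1U JP jk orbT => /(_ isT).
      by case: eqP => // jk1; move: jk; rewrite jk1 ltnn andbF.
    by have := FYw k.+1; rewrite /= /F' in_fset1U eqxx => /(_ isT).
  rewrite (indep _ _ _ mF'); last first.
    move=> j /=; rewrite in_fset1U => /orP[/eqP ->//|].
    by rewrite JP => /andP[].
  rewrite big_fsetU1//= {1}/F' eqxx -/Y PY muleC JE (indep J F)//; last first.
    by move=> j /=; rewrite JP => /andP[].
  congr (_ * _)%E; rewrite big_seq [RHS]big_seq; apply: eq_bigr => j jJ.
  by rewrite /F'; case: eqP => // jk1; move: kJ; rewrite -jk1 jJ.
rewrite PiG => sA.
pose TPi := g_sigma_algebraType Pi.
have PiM : <<s Pi >> `<=` (measurable : set (set Omega)).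
  rewrite -PiG; apply: smallest_sub (@samples_upto_measurable k).
  exact: sigma_algebra_measurable.
have muBfin : mu B \is a fin_num by exact: fin_num_measure.
pose Q (A' : set Omega) := (P (A' `&` Y) = P A' * mu B)%E.
have QC (S : set Omega) : measurable S -> Q S -> Q (~` S).
  move=> mS PS; rewrite /Q setIC -setDE measureD//; last first.
    by rewrite -ge0_fin_numE// fin_num_measure.
  transitivity (mu B - P S * mu B)%E.
    by congr (_ - _)%E; [exact: PY|rewrite setIC; exact: PS].
  by rewrite probability_setC// muleBl ?mul1e.
have QU (F : nat -> set Omega) : (forall i, measurable (F i)) ->
    trivIset setT F -> (forall i, Q (F i)) -> Q (\bigcup_i F i).
  move=> mF tF PF; rewrite /Q setI_bigcupl measure_bigcup//; last 2 first.
  - by move=> i _; exact: measurableI.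
  - exact: trivIset_setIr.
  rewrite measure_bigcup// muleC -(fineK muBfin) -nneseriesZl//.
  by apply: eq_eseriesr => i _; rewrite fineK// muleC; exact: PF.
apply: (@dynkin_induction _ TPi Pi Q) => //.
- move=> _ _ [F mF ->] [F' mF' ->].
  exists (fun j => F j `&` F' j) => [j|]; first exact: measurableI.
  by rewrite -bigcapI.
- by rewrite /Q setTI PY probability_setT mul1e.
- by move=> S /PiM; exact: QC.
- by move=> F mF tF PF; apply: QU => // i; apply: PiM; exact: mF.
Qed.

End Samples.

(** * Operator norm and expansion of half squared norms *)

Section MatrixNorms.
Context {R : realType}.

Lemma dotp_mulmx_tr n m (A : 'M[R]_(n, m)) (u : 'rV[R]_m) (v : 'rV[R]_n) :
  dotp (u *m A^T) v = dotp u (v *m A).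
Proof.
have E k (a b : 'rV[R]_k) : dotp a b = (a *m b^T) 0 0.
  by rewrite mxE; apply: eq_bigr => i _; rewrite mxE.
by rewrite !E trmx_mul mulmxA.
Qed.

(** A supremum bounds its set only if the set is bounded; the Frobenius norm K of A provides this.
    Then u is rescaled to the unit ball. *)
Lemma opnorm_ge n m (A : 'M[R]_(n, m)) (u : 'rV[R]_m) :
  enorm (u *m A^T) <= opnorm A * enorm u.
Proof.
pose K := Num.sqrt (\sum_(i < n) enorm (row i A) ^+ 2).
have bound (w : 'rV[R]_m) : enorm (w *m A^T) <= enorm w * K.
  rewrite -[enorm w]ger0_norm ?enorm_ge0// -sqrtr_sqr -sqrtrM ?sqr_ge0//.
  apply: ler_wsqrtr; rewrite mulr_sumr; apply: ler_sum => i _.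
  rewrite -exprMn -(real_normK (num_real (_ 0 i))).
  rewrite lerXn2r ?nnegrE ?mulr_ge0 ?enorm_ge0//.
  have -> : (w *m A^T) 0 i = dotp w (row i A).
    by rewrite mxE; apply: eq_bigr => j _; rewrite !mxE.
  rewrite ler_norml dotp_le andbT -lerN2 opprK -dotpNl.
  by apply: le_trans (dotp_le _ _) _; rewrite enormN.
have [u0|u0] := eqVneq (enorm u) 0.
  by rewrite (enorm_eq0 u0) mul0mx !enorm0 mulr0.
have up : 0 < enorm u by rewrite lt_neqAle eq_sym u0 enorm_ge0.
rewrite -ler_pdivrMr// mulrC -[X in X * _]ger0_norm ?invr_ge0 ?enorm_ge0//.
rewrite -enormZ scalemxAl; apply: ub_le_sup.
  exists K => _ [w /= w1 <-]; apply: le_trans (bound w) _.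
  by rewrite ler_piMl//; exact: sqrtr_ge0.
exists ((enorm u)^-1 *: u) => //=.
by rewrite enormZ ger0_norm ?invr_ge0 ?enorm_ge0// mulVf.
Qed.

Lemma half_sqr_enorm_diff m (u v : 'rV[R]_m) : enorm v ^+ 2 / 2 =
  enorm u ^+ 2 / 2 + (dotp u v - dotp u u) + enorm (v - u) ^+ 2 / 2.
Proof. by rewrite !enormE2 !dotpE (dotpC v u); field. Qed.

Lemma half_sqr_combine (A B u1 u2 q p w : R) :
  u1 - u2 <= B * q -> p <= A * q -> 0 <= A * q ->
  w / 2 + u1 + p / 2 <= w / 2 + u2 + (A + B) * q.
Proof. lra. Qed.

End MatrixNorms.

Lemma convex_set_segment (R : realType) n (X : set 'rV[R]_n) : convex_set X ->
  forall a b (t : R), X a -> X b -> 0 <= t <= 1 -> X (a + t *: (b - a)).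
Proof.
move=> cX a b t Xa Xb /andP[t0 t1].
have := cX b a (Itv01 t0 t1) (mem_set Xb) (mem_set Xa).
rewrite inE => h; suff -> : a + t *: (b - a) = t *: b + (1 - t) *: a by [].
by rewrite scalerBr scalerBl scale1r addrCA.
Qed.

(** * Consequences of the assumptions on f and c *)

Section Problem.
Context {R : realType} {n m : nat} {dXi : measure_display}
  {Xi : measurableType dXi} {mu : probability Xi R} {X : set 'rV[R]_n}
  {ft : 'rV[R]_n -> Xi -> R} {c : 'rV[R]_n -> 'rV[R]_m}
  {Lf sigma Lc Lnc Cc gamma theta : R}.
Context (X_segment : forall a b (t : R), X a -> X b -> 0 <= t <= 1 ->
  X (a + t *: (b - a))).
Context (basic : basic_assumptions mu X ft c Lf sigma Lc Lnc Cc gamma theta).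

Local Notation f := (objective mu ft).
Local Notation gf := (grad f).
Local Notation gh := (grad_map_val c).

(** The constants carry no sign, so their absolute values are used from here on. *)
Lemma objective_lipschitz x y : X x -> X y -> `|f x - f y| <= `|Lf| * enorm (x - y).
Proof.
have [U [_ XU _ _ lip]] := objective_regular basic => Xx Xy.
apply: le_trans (lip _ _ (XU _ Xx) (XU _ Xy)) _.
by rewrite ler_wpM2r ?enorm_ge0// ler_norm.
Qed.

Lemma objective_is_derive x v : X x -> is_derive x v f (dotp (gf x) v).
Proof.
have [U [_ XU _ dU _]] := objective_regular basic => Xx.
have df := dU _ (XU _ Xx).
by split; [exact: diff_derivable|exact: derive_dotp_grad].
Qed.

Lemma grad_objective_le x : X x -> enorm (gf x) <= `|Lf|.
Proof.
have [U [oU XU _ dU lip]] := objective_regular basic => Xx.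
have df := dU _ (XU _ Xx).
have : `|'D_(gf x) f x| <= `|Lf| * enorm (gf x).
  apply: (@derive_lip_le _ _ _ Num.norm f U) => //.
  - exact: norm_continuous.
  - by move=> a w; rewrite normrM.
  - exact: XU.
  - move=> y z Uy Uz; apply: le_trans (lip _ _ Uy Uz) _.
    by rewrite ler_wpM2r ?enorm_ge0// ler_norm.
rewrite derive_dotp_grad// -enormE2 ger0_norm ?sqr_ge0// expr2.
have [->//|g0] := eqVneq (enorm (gf x)) 0.
by rewrite ler_pM2r// lt_neqAle eq_sym g0 enorm_ge0.
Qed.

(** Finiteness of Q_1^* bounds f + |c|^2 / 2 from below on X, and |c| <= Cc removes the second
    term. *)
Lemma objective_lower_bound : exists fl, forall x, X x -> fl <= f x.
Proof.
pose Q x := f x + enorm (c x) ^+ 2 / 2.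
have Qfin := Q1_finite basic.
exists (fine (ereal_inf [set (Q x)%:E | x in X]) - Cc ^+ 2 / 2) => x Xx.
have : (ereal_inf [set (Q x)%:E | x in X] <= (Q x)%:E)%E.
  by apply: ereal_inf_lbound; exists x.
rewrite -(fineK Qfin) lee_fin /Q => h.
have := constraint_bounded basic Xx => cC.
have : enorm (c x) ^+ 2 <= Cc ^+ 2.
  by rewrite lerXn2r ?nnegrE ?enorm_ge0// (le_trans (enorm_ge0 _) cC).
by rewrite /Q in h *; lra.
Qed.

Lemma constraint_derive_le x v : X x -> enorm (v *m grad_map c x) <= `|Lc| * enorm v.
Proof.
have [V [oV XV dV lip _]] := constraint_regular basic => Xx.
rewrite /grad_map -deriveEjacobian; last exact/dV/XV.
apply: (@derive_lip_le _ _ _ (@enorm R m) c V) => //.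
- exact: continuous_enorm.
- exact: enormZ.
- exact: XV.
- move=> y z Uy Uz; apply: le_trans (lip _ _ Uy Uz) _.
  by rewrite ler_wpM2r ?enorm_ge0// ler_norm.
- exact/dV/XV.
Qed.

(** Duality: |w|^2 = <u, w A> with A the gradient matrix, and |w A| <= |Lc| |w| is the derivative
    bound. *)
Lemma grad_map_tr_le x (u : 'rV[R]_m) : X x ->
  enorm (u *m (grad_map c x)^T) <= `|Lc| * enorm u.
Proof.
move=> Xx; set w := u *m _.
have : enorm w ^+ 2 <= enorm u * (`|Lc| * enorm w).
  rewrite enormE2 {1}/w dotp_mulmx_tr; apply: le_trans (dotp_le _ _) _.
  by rewrite ler_wpM2l ?enorm_ge0// constraint_derive_le.
have [->|w0] := eqVneq (enorm w) 0; first by rewrite mulr_ge0 ?enorm_ge0.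
by rewrite mulrA expr2 ler_pM2r 1?mulrC// lt_neqAle eq_sym w0 enorm_ge0.
Qed.

Lemma grad_map_diff_le x y (u : 'rV[R]_m) : X x -> X y ->
  enorm (u *m (grad_map c x - grad_map c y)^T) <= `|Lnc| * enorm (x - y) * enorm u.
Proof.
have [V [_ XV _ _ lip]] := constraint_regular basic => Xx Xy.
apply: le_trans (opnorm_ge _ _) _; rewrite ler_wpM2r ?enorm_ge0//.
apply: le_trans (lip _ _ (XV _ Xx) (XV _ Xy)) _.
by rewrite ler_wpM2r ?enorm_ge0// ler_norm.
Qed.

Lemma constraint_lipschitz x y : X x -> X y ->
  enorm (c x - c y) <= `|Lc| * enorm (x - y).
Proof.
have [V [_ XV _ lip _]] := constraint_regular basic => Xx Xy.
apply: le_trans (lip _ _ (XV _ Xx) (XV _ Xy)) _.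
by rewrite ler_wpM2r ?enorm_ge0// ler_norm.
Qed.

Lemma constraint_le x : X x -> enorm (c x) <= `|Cc|.
Proof.
by move=> Xx; apply: le_trans (constraint_bounded basic Xx) (ler_norm _).
Qed.

Lemma grad_map_val_le x : X x -> enorm (gh x) <= `|Lc| * `|Cc|.
Proof.
move=> Xx; apply: le_trans (grad_map_tr_le _ Xx) _.
by rewrite ler_wpM2l ?constraint_le.
Qed.

Lemma grad_map_val_lipschitz x y : X x -> X y ->
  enorm (gh x - gh y) <= (`|Lc| ^+ 2 + `|Lnc| * `|Cc|) * enorm (x - y).
Proof.
move=> Xx Xy.
have -> : gh x - gh y = (c x - c y) *m (grad_map c x)^T +
    c y *m (grad_map c x - grad_map c y)^T.
  by rewrite /grad_map_val linearB /= mulmxBl mulmxBr addrA subrK.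
apply: le_trans (ler_enormD _ _) _; rewrite mulrDl lerD//.
  apply: le_trans (grad_map_tr_le _ Xx) _.
  by rewrite expr2 -mulrA ler_wpM2l// constraint_lipschitz.
apply: le_trans (grad_map_diff_le _ Xx Xy) _.
by rewrite [leRHS]mulrAC ler_wpM2l ?constraint_le// mulr_ge0 ?enorm_ge0.
Qed.

Lemma dotp_constraint_is_derive (u : 'rV[R]_m) x v : X x ->
  is_derive x v (fun z => dotp u (c z)) (dotp (u *m (grad_map c x)^T) v).
Proof.
have [V [_ XV dV _ _]] := constraint_regular basic => Xx.
have dc := dV _ (XV _ Xx).
have Dc : derivable c x v := diff_derivable dc.
have -> : (fun z => dotp u (c z)) = \sum_(i < m) (u 0 i \*: (fun z => c z 0 i)).
  by apply/funext => z; rewrite fct_sumE.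
rewrite dotp_mulmx_tr /grad_map -deriveEjacobian//.
apply: is_derive_sum => i; apply: is_deriveZ.
split; first by have /derivable_mxP := Dc; apply.
by rewrite (derive_mx Dc) mxE.
Qed.

(** The mean value theorem is applied to z |-> <c x, c z> with the left factor frozen, and the rest
    |c y - c x|^2 / 2 is already quadratic. The constant equals that of [grad_map_val_lipschitz], so
    one L2 serves both. *)
Lemma feasibility_descent x y : X x -> X y ->
  enorm (c y) ^+ 2 / 2 <= enorm (c x) ^+ 2 / 2 + dotp (gh x) (y - x) +
    (`|Lc| ^+ 2 + `|Lnc| * `|Cc|) * enorm (y - x) ^+ 2.
Proof.
move=> Xx Xy.
have [t t01 E] := @mean_value_dotp _ _ X (fun z => dotp (c x) (c z))
  (fun z => c x *m (grad_map c z)^T) x y X_segment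
  (fun z v => @dotp_constraint_is_derive (c x) z v) Xx Xy.
have Xz := X_segment Xx Xy t01; set z := x + _ in E Xz.
have h1 : dotp (c x *m (grad_map c z)^T) (y - x) - dotp (gh x) (y - x) <=
    `|Lnc| * `|Cc| * enorm (y - x) ^+ 2.
  rewrite -dotpBl -mulmxBr -linearB/=; apply: le_trans (dotp_le _ _) _.
  rewrite expr2 mulrA ler_wpM2r ?enorm_ge0//.
  apply: le_trans (grad_map_diff_le _ Xz Xx) _.
  rewrite mulrAC ler_pM ?mulr_ge0 ?enorm_ge0//.
    by rewrite ler_wpM2l// constraint_le.
  have /andP[t0 t1] := t01.
  by rewrite /z addrC addKr enormZ ger0_norm// ler_piMl ?enorm_ge0.
have h2 : enorm (c y - c x) ^+ 2 <= `|Lc| ^+ 2 * enorm (y - x) ^+ 2.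
  rewrite -exprMn lerXn2r ?nnegrE ?mulr_ge0 ?enorm_ge0//.
  exact: constraint_lipschitz.
rewrite (half_sqr_enorm_diff (c x) (c y)) E.
have h3 : 0 <= `|Lc| ^+ 2 * enorm (y - x) ^+ 2 by rewrite mulr_ge0 ?sqr_ge0.
exact: half_sqr_combine h1 h2 h3.
Qed.

Lemma error_bound_normal x v : normal_cone X x v ->
  gamma * enorm (c x) `^ theta <= enorm (gh x + v).
Proof.
move=> Nv; rewrite -lee_fin; apply: le_trans (error_bound basic Nv.1) _.
apply: ereal_inf_lbound; exists (gh x + v); first by exists v.
by rewrite sub0r enormN.
Qed.

(** For Lf < 0 the Lipschitz bound fails along every coordinate direction inside the open
    neighbourhood. There is then no coordinate at all, n = 0, and all vectors coincide. *)
Lemma projection_cball_norm (x1 : 'rV[R]_n) : X x1 ->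
  projection (cball Lf) = projection (cball `|Lf|) :> ('rV[R]_n -> 'rV[R]_n).
Proof.
move=> Xx1; have [Lf0|Lf0] := leP 0 Lf; first by rewrite ger0_norm.
apply/funext => z.
have [U [oU XU _ _ lip]] := objective_regular basic.
apply/rowP => i; exfalso.
have [e e0 eU] : exists2 e : R, 0 < e & U (x1 + e *: delta_mx 0 i).
  have c0 : (x1 + h *: (delta_mx 0 i : 'rV[R]_n)) @[h --> (0 : R)] --> x1.
    rewrite -[in X in _ --> X](addr0 x1) -(scale0r (delta_mx 0 i : 'rV[R]_n)).
    by apply: cvgD; [exact: cvg_cst|apply: cvgZr_tmp; exact: cvg_id].
  have : \forall h \near (0 : R), U (x1 + h *: delta_mx 0 i).
    by apply: c0; apply: open_nbhs_nbhs; split => //; exact: XU.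
  move=> /nbhs_normP[e e0 eU]; exists (e / 2); first exact: divr_gt0.
  apply: eU; rewrite /ball_ /= sub0r normrN gtr0_norm ?divr_gt0//.
  by rewrite ltr_pdivrMr// ltr_pMr// ltr1n.
have := lip _ _ eU (XU _ Xx1); rewrite addrAC subrr add0r enormZ (gtr0_norm e0).
have d1 : enorm (delta_mx 0 i : 'rV[R]_n) = 1.
  rewrite /enorm (bigD1 i)//= big1 => [|j ji].
    by rewrite mxE !eqxx expr1n addr0 sqrtr1.
  by rewrite mxE eqxx (negbTE ji) expr0n.
rewrite d1 mulr1 => h; have := le_trans (normr_ge0 _) h.
by rewrite pmulr_lge0// leNgt Lf0.
Qed.

End Problem.

(** * Finite expectations *)

Section Mean.
Context {R : realType} {d : measure_display} {T : measurableType d}.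
Context (P : probability T R).
Implicit Types (Z : T -> R).

(** Integrability and value travel together, so linearity and monotonicity become rules on real
    numbers. *)
Definition has_mean Z a :=
  P.-integrable setT (EFin \o Z) /\ (\int[P]_w (Z w)%:E)%E = a%:E.

Lemma has_mean_cst a : has_mean (fun=> a) a.
Proof.
split; first exact: finite_measure_integrable_cst.
by rewrite integral_cst//= probability_setT mule1.
Qed.

Lemma has_meanD Z1 Z2 a1 a2 : has_mean Z1 a1 -> has_mean Z2 a2 ->
  has_mean (fun w => Z1 w + Z2 w) (a1 + a2).
Proof.
move=> [i1 e1] [i2 e2]; split; first exact: (integrableD measurableT i1 i2).
have := integralD_EFin measurableT i1 i2.
by rewrite /= e1 e2 -EFinD => <-.
Qed.

Lemma has_meanZ Z a k : has_mean Z a -> has_mean (fun w => k * Z w) (k * a).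
Proof.
move=> [i e]; split; first exact: (integrableZl measurableT k i).
by have := integralZl measurableT i k; rewrite /= e -EFinM => <-.
Qed.

Lemma has_mean_sum (I : eqType) (s : seq I) (Q : pred I) (Z : I -> T -> R) a :
  (forall i, i \in s -> Q i -> has_mean (Z i) (a i)) ->
  has_mean (fun w => \sum_(i <- s | Q i) Z i w) (\sum_(i <- s | Q i) a i).
Proof.
elim: s => [|i s IH] h.
  by rewrite big_nil; under eq_fun do rewrite big_nil; exact: has_mean_cst.
have {}IH := IH (fun j js => h j (mem_behead (s := i :: s) js)).
rewrite big_cons; under eq_fun do rewrite big_cons.
by case: ifP => // Qi; apply: has_meanD => //; apply: h => //; rewrite mem_head.
Qed.

Lemma has_mean_bounded Z K : measurable_fun setT Z -> (forall w, 0 <= Z w <= K) ->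
  has_mean Z (fine (\int[P]_w (Z w)%:E)).
Proof.
move=> mZ ZK; have iZ : P.-integrable setT (EFin \o Z).
  apply: measurable_bounded_integrable => //.
    by rewrite -ge0_fin_numE// fin_num_measure.
  exists K; split; first exact: num_real.
  move=> y Ky w _; have /andP[Z0 ZKw] := ZK w.
  by rewrite /= ger0_norm// (le_trans ZKw)// ltW.
by split => //; rewrite fineK//; exact: integrable_fin_num.
Qed.

Lemma has_mean_ge0 Z a : (forall w, 0 <= Z w) -> has_mean Z a -> 0 <= a.
Proof. by move=> Z0 [_ e]; rewrite -lee_fin -e integral_ge0// => w _; rewrite lee_fin. Qed.

Lemma has_mean_le Z1 Z2 a1 a2 : has_mean Z1 a1 -> has_mean Z2 a2 ->
  (forall w, Z1 w <= Z2 w) -> a1 <= a2.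
Proof.
move=> h1 h2 h12; rewrite -subr_ge0.
have := has_meanD h2 (has_meanZ (-1) h1); rewrite mulN1r.
by apply: has_mean_ge0 => w; rewrite mulN1r subr_ge0.
Qed.

End Mean.

(** * Moments of the sampled gradient at a fixed point *)

Section SampledGradient.
Context {R : realType} {n m : nat} {dXi : measure_display}
  {Xi : measurableType dXi} {mu : probability Xi R} {X : set 'rV[R]_n}
  {ft : 'rV[R]_n -> Xi -> R} {c : 'rV[R]_n -> 'rV[R]_m}
  {Lf sigma Lc Lnc Cc gamma theta : R}.
Context (ft_diff : forall s x, differentiable (ft^~ s) x).
Context (basic : basic_assumptions mu X ft c Lf sigma Lc Lnc Cc gamma theta).
Local Notation f := (objective mu ft).
Local Notation gf := (grad f).

(** A partial derivative is the limit of difference quotients along 1 / (N + 1), and integrability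
    makes ft y measurable for y in the neighbourhood U. *)
Lemma measurable_sampled_grad x i : X x ->
  measurable_fun setT (fun s => grad (ft^~ s) x 0 i).
Proof.
move=> Xx; have [U [oU XU iU _ _]] := objective_regular basic.
pose v : 'rV[R]_n := delta_mx 0 i.
have mft y : U y -> measurable_fun setT (ft y).
  by move=> /iU /integrableP[/measurable_EFinP].
(* Shifting the sequence by N0 keeps every evaluation point inside U. *)
have [N0 hN0] : exists N0, forall N, (N0 <= N)%N -> U (N.+1%:R^-1 *: v + x).
  have c0 : (h *: v + x) @[h --> (0 : R)] --> x.
    rewrite -[in X in _ --> X](add0r x) -(scale0r v).
    by apply: cvgD; [apply: cvgZr_tmp; exact: cvg_id|exact: cvg_cst].
  have : \forall h \near (0 : R), U (h *: v + x).
    by apply: c0; apply: open_nbhs_nbhs; split => //; exact: XU.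
  move=> /nbhs_normP[e e0 eU].
  have [N0 _ hN0] := near_infty_natSinv_lt (PosNum e0).
  exists N0 => N NN0; apply: eU; rewrite /ball_ /= sub0r normrN ger0_norm//.
  exact: hN0.
pose q N s := ((N + N0).+1%:R) * (ft ((N + N0).+1%:R^-1 *: v + x) s - ft x s).
apply: (measurable_fun_cvg (h := q)) => [N|s _].
  apply: measurable_funM => //; apply: measurable_funB; apply: mft.
    by apply: hN0; rewrite leq_addl.
  exact: XU.
rewrite mxE; have ds := @diff_derivable _ _ _ _ _ v (ft_diff s x).
pose hs N : R := (N + N0).+1%:R^-1.
have hs0 : hs N @[N --> \oo] --> 0^'.
  move=> A /= [e e0 eA].
  have [N1 _ hN1] := near_infty_natSinv_lt (PosNum e0).
  exists N1 => // N NN1; apply: eA => /=.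
    rewrite /ball_ /= sub0r normrN ger0_norm ?invr_ge0//.
    by apply: hN1 => /=; rewrite (leq_trans NN1)// leq_addr.
  by rewrite /hs invr_neq0.
have := cvg_comp _ _ hs0 ds.
by rewrite (_ : _ \o hs = q^~ s)//; apply/funext => N; rewrite /q /hs /= invrK.
Qed.

Lemma coordB (u v : 'rV[R]_n) i : (u - v) 0 i = u 0 i - v 0 i.
Proof. by rewrite !mxE. Qed.

Lemma measurable_coordD d (T : measurableType d) (y z : T -> 'rV[R]_n) :
  (forall i, measurable_fun setT (fun w => y w 0 i)) ->
  (forall i, measurable_fun setT (fun w => z w 0 i)) ->
  forall i, measurable_fun setT (fun w => (y w + z w) 0 i).
Proof. by move=> my mz i; under eq_fun do rewrite mxE; exact: measurable_funD. Qed.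

Lemma measurable_coordZ d (T : measurableType d) a (y : T -> 'rV[R]_n) :
  (forall i, measurable_fun setT (fun w => y w 0 i)) ->
  forall i, measurable_fun setT (fun w => (a *: y w) 0 i).
Proof. by move=> my i; under eq_fun do rewrite mxE; exact: measurable_funM. Qed.

Lemma measurable_coordB d (T : measurableType d) (y z : T -> 'rV[R]_n) :
  (forall i, measurable_fun setT (fun w => y w 0 i)) ->
  (forall i, measurable_fun setT (fun w => z w 0 i)) ->
  forall i, measurable_fun setT (fun w => (y w - z w) 0 i).
Proof.
by move=> my mz i; under eq_fun do rewrite coordB; exact: measurable_funB.
Qed.

Lemma measurable_enorm_sqr d (T : measurableType d) (y : T -> 'rV[R]_n) :
  (forall i, measurable_fun setT (fun w => y w 0 i)) ->
  measurable_fun setT (fun w => enorm (y w) ^+ 2).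
Proof.
move=> my; apply: measurable_funX.
by apply: measurable_continuous_rV => //; exact: continuous_enorm.
Qed.

Lemma has_mean_sampled_variance x : X x -> exists2 v, v <= sigma ^+ 2 &
  has_mean mu (fun s => enorm (grad (ft^~ s) x - gf x) ^+ 2) v.
Proof.
move=> Xx; have := gradient_variance basic Xx; rewrite unlock => v.
set Q := fun s => enorm (grad (ft^~ s) x - gf x) ^+ 2.
have mQ : measurable_fun setT Q.
  apply: measurable_enorm_sqr; apply: measurable_coordB => i.
    exact: measurable_sampled_grad.
  exact: measurable_cst.
have I0 : (0 <= \int[mu]_s (Q s)%:E)%E.
  by apply: integral_ge0 => s _; rewrite lee_fin sqr_ge0.
have Ifin : (\int[mu]_s (Q s)%:E)%E \is a fin_num.
  by rewrite ge0_fin_numE// (le_lt_trans v)// ltry.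
exists (fine (\int[mu]_s (Q s)%:E)); first by rewrite -lee_fin fineK.
split; last by rewrite fineK.
apply/integrableP; split; first exact/measurable_EFinP.
under eq_integral do rewrite /= ger0_norm ?sqr_ge0//.
by rewrite -ge0_fin_numE.
Qed.

(** Unbiasedness gives the value of the integral; integrability comes from the variance, by |a| <= 1
    + 2 b^2 + 2 q^2 whenever |a - b| <= q. *)
Lemma has_mean_sampled_grad x i : X x ->
  has_mean mu (fun s => grad (ft^~ s) x 0 i) (gf x 0 i).
Proof.
move=> Xx; have := gradient_unbiased basic Xx i; rewrite unlock => e.
split => //.
have [v _ hv] := has_mean_sampled_variance Xx.
have [iQ _] := has_meanD (has_mean_cst mu (1 + 2 * (gf x 0 i) ^+ 2)) (has_meanZ 2 hv).
apply: (le_integrable measurableT _ _ iQ).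
  by apply/measurable_EFinP; exact: measurable_sampled_grad.
move=> s _ /=; rewrite lee_fin [leRHS]ger0_norm; last first.
  by rewrite !addr_ge0// mulr_ge0 ?sqr_ge0.
have := coord_le_enorm (grad (ft^~ s) x - gf x) i.
rewrite coordB.
move: (grad (ft^~ s) x 0 i) (gf x 0 i) (enorm _) => a b q abq.
have : (a - b) ^+ 2 <= q ^+ 2.
  by rewrite -(real_normK (num_real (a - b))) lerXn2r ?nnegrE// (le_trans _ abq).
have a1 : `|a| <= 1 + a ^+ 2 / 2.
  rewrite -(real_normK (num_real a)); have := sqr_ge0 (`|a| - 1).
  by move: `|a| => t; rewrite !expr2; lra.
by have := sqr_ge0 (a - 2 * b); have := sqr_ge0 a; rewrite !expr2 in a1 *; lra.
Qed.

(* The cross term vanishes because the sampled gradient is unbiased. *)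
Lemma mean_momentum_error al x (v : 'rV[R]_n) : X x ->
  exists2 a, a <= (1 - al) ^+ 2 * enorm v ^+ 2 + al ^+ 2 * sigma ^+ 2 &
  has_mean mu (fun s => enorm ((1 - al) *: v + al *: (grad (ft^~ s) x - gf x)) ^+ 2) a.
Proof.
move=> Xx; have [q qs hq] := has_mean_sampled_variance Xx.
pose b i := 2 * al * (1 - al) * v 0 i.
pose Z := fun s => (1 - al) ^+ 2 * enorm v ^+ 2 +
  (al ^+ 2 * enorm (grad (ft^~ s) x - gf x) ^+ 2 +
   \sum_(i < n) b i * (grad (ft^~ s) x 0 i + - gf x 0 i)).
exists ((1 - al) ^+ 2 * enorm v ^+ 2 + (al ^+ 2 * q +
    \sum_(i < n) b i * (gf x 0 i + - gf x 0 i))).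
  rewrite big1 ?addr0 => [|i _]; last by rewrite subrr mulr0.
  by rewrite lerD2l ler_wpM2l ?sqr_ge0.
have -> : (fun s => enorm ((1 - al) *: v + al *: (grad (ft^~ s) x - gf x)) ^+ 2) = Z.
  apply/funext => s; rewrite /Z; set z := grad _ x - gf x.
  have -> : \sum_(i < n) b i * (grad (ft^~ s) x 0 i + - gf x 0 i) =
      2 * al * (1 - al) * dotp v z.
    by rewrite /dotp mulr_sumr; apply: eq_bigr => i _; rewrite /b /z coordB mulrA.
  by clearbody z; rewrite !enormE2 !dotpE (dotpC z v); ring.
apply: has_meanD; first exact: has_mean_cst.
apply: has_meanD; first exact: has_meanZ.
apply: has_mean_sum => i _ _; apply: has_meanZ; apply: has_meanD.
  exact: has_mean_sampled_grad.
exact: has_mean_cst.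
Qed.

End SampledGradient.

(** * The iterates: boundedness, measurability and mean momentum error *)

Section Process.
Context {R : realType} {n m : nat} {dXi : measure_display}
  {Xi : measurableType dXi} {mu : probability Xi R} {X : set 'rV[R]_n}
  {ft : 'rV[R]_n -> Xi -> R} {c : 'rV[R]_n -> 'rV[R]_m}
  {Lf sigma Lc Lnc Cc gamma theta Lnf : R} {x1 : 'rV[R]_n}
  {rho eta alpha : nat -> R}.
Context (X_closed : closed X).
Context (X_segment : forall a b (t : R), X a -> X b -> 0 <= t <= 1 ->
  X (a + t *: (b - a))).
Context (ft_diff : forall s x, differentiable (ft^~ s) x).
Context (ft_C1 : forall s, continuous (grad (ft^~ s))).
Context (basic : basic_assumptions mu X ft c Lf sigma Lc Lnc Cc gamma theta).
Context (f_smooth : forall u v, X u -> X v ->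
  enorm (grad (objective mu ft) u - grad (objective mu ft) v)
    <= Lnf * enorm (u - v)).
Context (x1X : X x1).
Local Notation f := (objective mu ft).
Local Notation gf := (grad f).
Local Notation gh := (grad_map_val c).
Local Notation run := (truncated_polyak_momentum X ft c Lf x1 rho eta alpha).

Let X_nonempty : X !=set0. Proof. by exists x1. Qed.

Lemma grad_lipschitz u v : X u -> X v -> enorm (gf u - gf v) <= `|Lnf| * enorm (u - v).
Proof.
move=> Xu Xv; apply: le_trans (f_smooth Xu Xv) _.
by rewrite ler_wpM2r ?enorm_ge0// ler_norm.
Qed.

Lemma projection_cball_le (u : 'rV[R]_n) : enorm (projection (cball Lf) u) <= `|Lf|.
Proof.
rewrite (projection_cball_norm basic x1X).
exact: (projection_in (cball_nonempty (normr_ge0 Lf)) (@cball_closed R n _)).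
Qed.

Section Run.
Context {xi : nat -> Xi} {x g : nat -> 'rV[R]_n}.
Context (xg : run xi x g).

Lemma run_in k : (0 < k)%N -> X (x k).
Proof.
case: k => // -[_|k _]; first by rewrite (tpm_x1 xg).
by rewrite (tpm_x xg)//; exact: projection_in.
Qed.

Lemma run_momentum_le k : (0 < k)%N -> enorm (g k) <= `|Lf|.
Proof.
case: k => // -[_|k _]; first by rewrite (tpm_g1 xg) projection_cball_le.
by rewrite (tpm_g xg)// projection_cball_le.
Qed.

Lemma run_error_le u k : (0 < k)%N -> X u -> enorm (g k - gf u) <= 2 * `|Lf|.
Proof.
move=> k0 Xu; apply: le_trans (ler_enormB _ _) _.
by rewrite mulr_natl mulr2n lerD ?run_momentum_le ?(grad_objective_le basic).
Qed.

Lemma run_momentum_error k : (0 < k)%N ->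
  enorm (g k.+1 - gf (x k.+1)) <=
  enorm ((1 - alpha k) *: (g k - gf (x k.+1)) +
    alpha k *: (grad (ft^~ (xi k.+1)) (x k.+1) - gf (x k.+1))).
Proof.
move=> k0; rewrite (tpm_g xg)// (projection_cball_norm basic x1X).
by apply: momentum_step => //; apply: (grad_objective_le basic); exact: run_in.
Qed.

Lemma run_step_le k : (0 < k)%N -> 0 <= eta k -> 0 <= rho k ->
  enorm (x k.+1 - x k) <= eta k * (`|Lf| + rho k * (`|Lc| * `|Cc|)).
Proof.
move=> k0 e0 r0; rewrite (tpm_x xg)//.
apply: le_trans (step_norm X_nonempty X_closed X_segment _ (run_in k0) e0) _.
rewrite ler_wpM2l//; apply: le_trans (ler_enormD _ _) _.
rewrite lerD ?run_momentum_le// enormZ ger0_norm// ler_wpM2l//.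
by apply: (grad_map_val_le basic); exact: run_in.
Qed.

End Run.

Section MeasurableRun.
Context {d : measure_display} {T : measurableType d}.
Implicit Types (y z : T -> 'rV[R]_n).

Let proj_lip (u v : 'rV[R]_n) :
  enorm (projection X u - projection X v) <= 1 * enorm (u - v).
Proof. by rewrite mul1r; exact: projection_nonexpansive. Qed.

Lemma measurable_coord_lip K (phi : 'rV[R]_n -> 'rV[R]_n) y i :
  (forall u v, enorm (phi u - phi v) <= K * enorm (u - v)) ->
  (forall i, measurable_fun setT (fun w => y w 0 i)) ->
  measurable_fun setT (fun w => phi (y w) 0 i).
Proof.
move=> lip my; apply: (measurable_continuous_rV (phi := fun u => phi u 0 i)) => //.
exact: continuous_coord lip.
Qed.

(** Composing phi with the projection onto X extends it to a Lipschitz map on the whole space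
    without changing it on X. *)
Lemma measurable_on_domain K (phi : 'rV[R]_n -> 'rV[R]_n) y i : 0 <= K ->
  (forall u v, X u -> X v -> enorm (phi u - phi v) <= K * enorm (u - v)) ->
  (forall w, X (y w)) -> (forall i, measurable_fun setT (fun w => y w 0 i)) ->
  measurable_fun setT (fun w => phi (y w) 0 i).
Proof.
move=> K0 lip Xy my.
under eq_fun do rewrite -(projection_id X_nonempty X_closed (Xy _)).
apply: (measurable_coord_lip i (K := K)
  (phi := fun u => phi (projection X u))) => // u v.
apply: le_trans (lip _ _ _ _) _; [exact: projection_in..|].
by rewrite ler_wpM2l// -[leRHS]mul1r proj_lip.
Qed.

Lemma measurable_grad_sample y (t : T -> Xi) i : (forall w, X (y w)) ->
  (forall i, measurable_fun setT (fun w => y w 0 i)) -> measurable_fun setT t ->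
  measurable_fun setT (fun w => grad (ft^~ (t w)) (y w) 0 i).
Proof.
move=> Xy my mt.
under eq_fun => w do rewrite -[X in grad _ X](projection_id X_nonempty X_closed (Xy w)).
apply: (measurable_caratheodory (H := fun u s => grad (ft^~ s) (projection X u) 0 i)) => //.
  move=> s u; have cp : continuous (projection X).
    apply: (@enorm_continuous_lip _ _ _ _ 1) => a b.
    by apply: le_trans (proj_lip a b); exact: mxnorm_le_enorm.
  have cg := continuous_comp (cp u) (@ft_C1 s (projection X u)).
  exact: (continuous_comp cg (@coord_continuous R 1 n 0 i _)).
by move=> u; apply: (measurable_sampled_grad ft_diff basic); exact: projection_in.
Qed.

(** The space T is arbitrary and only the first K samples are assumed measurable: over the
    sigma-algebra of the first k samples, the last conjunct says that x_{k+1} is determined before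
    sample k + 1 is drawn. *)
Lemma measurable_run (K : nat) (xi : nat -> T -> Xi) (x g : nat -> T -> 'rV[R]_n) :
  (forall w, run (xi^~ w) (x^~ w) (g^~ w)) ->
  (forall j, (0 < j <= K)%N -> measurable_fun setT (xi j)) ->
  forall k, (0 < k <= K)%N ->
    [/\ forall i, measurable_fun setT (fun w => x k w 0 i),
        forall i, measurable_fun setT (fun w => g k w 0 i)
      & forall i, measurable_fun setT (fun w => x k.+1 w 0 i)].
Proof.
move=> xg mxi.
have Xx k w : (0 < k)%N -> X (x k w) := @run_in _ _ _ (xg w) k.
have mball y i : (forall i, measurable_fun setT (fun w => y w 0 i)) ->
    measurable_fun setT (fun w => projection (cball Lf) (y w) 0 i).
  apply: (measurable_coord_lip i (K := 1)) => u v.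
  rewrite (projection_cball_norm basic x1X) mul1r.
  apply: projection_nonexpansive.
  - exact: cball_nonempty.
  - exact: cball_closed.
  - exact: cball_convex.
have mx1 k : (0 < k)%N -> (forall i, measurable_fun setT (fun w => x k w 0 i)) ->
    (forall i, measurable_fun setT (fun w => g k w 0 i)) ->
    forall i, measurable_fun setT (fun w => x k.+1 w 0 i).
  move=> k0 mx mg i; under eq_fun do rewrite (tpm_x (xg _) k0).
  apply: (measurable_coord_lip i proj_lip); apply: measurable_coordB => //.
  apply: measurable_coordZ.
  apply: measurable_coordD => //; apply: measurable_coordZ => {}i.
  have L0 : 0 <= `|Lc| ^+ 2 + `|Lnc| * `|Cc| by rewrite addr_ge0 ?mulr_ge0 ?sqr_ge0.
  apply: (measurable_on_domain i L0 (grad_map_val_lipschitz basic)) => // w.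
  exact: Xx.
elim=> // -[_ K1|k IH kK].
  have mx i : measurable_fun setT (fun w => x 1%N w 0 i).
    by under eq_fun do rewrite (tpm_x1 (xg _)); exact: measurable_cst.
  have mg i : measurable_fun setT (fun w => g 1%N w 0 i).
    under eq_fun do rewrite (tpm_g1 (xg _)).
    apply: (mball) => {}i; apply: (measurable_grad_sample (y := fun=> x1)) => //.
    exact: mxi.
  by split => //; exact: (mx1).
have kK' : (0 < k.+1 <= K)%N by rewrite /= ltnW.
have [mx mg mx'] := IH kK'.
have mg' i : measurable_fun setT (fun w => g k.+2 w 0 i).
  under eq_fun do rewrite (tpm_g (xg _) (ltn0Sn k)).
  apply: (mball); apply: measurable_coordD; apply: measurable_coordZ => // {}i.
  apply: measurable_grad_sample => //; first by move=> w; exact: Xx.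
  exact: mxi.
by split => //; exact: (mx1).
Qed.

End MeasurableRun.

Section Expectation.
Context {dO : measure_display} {Omega : measurableType dO}
  {P : probability Omega R} {xi : nat -> {RV P >-> Xi}}
  {x g : nat -> Omega -> 'rV[R]_n}.
Context (xi_iid : iid_samples mu xi).
Context (xg : forall w, run (xi^~ w) (x^~ w) (g^~ w)).

(** The reference gradient is taken at x_{k+1}, not x_k, because the fresh sample is evaluated there
    and is unbiased there given the past. *)
Lemma momentum_mean_step k a v : (0 < k)%N ->
  has_mean P (fun w => enorm (g k.+1 w - gf (x k.+1 w)) ^+ 2) a ->
  has_mean P (fun w => enorm (g k w - gf (x k.+1 w)) ^+ 2) v ->
  a <= (1 - alpha k) ^+ 2 * v + alpha k ^+ 2 * sigma ^+ 2.
Proof.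
move=> k0 [_ ea] hv; rewrite -lee_fin -ea.
have [_ ev] := has_meanD (has_meanZ ((1 - alpha k) ^+ 2) hv)
  (has_mean_cst P (alpha k ^+ 2 * sigma ^+ 2)).
rewrite -ev.
(* The space Omega with only the events of the first k samples. The error becomes a function of the
   past and an independent copy of the new sample. *)
pose TG := g_sigma_algebraType (samples_upto xi k).
have Xx j w : (0 < j)%N -> X (x j w) := @run_in _ _ _ (xg w) j.
pose err (z : (TG * Xi)%type) := enorm ((1 - alpha k) *: (g k z.1 - gf (x k.+1 z.1)) +
  alpha k *: (grad (ft^~ z.2) (x k.+1 z.1) - gf (x k.+1 z.1))).
pose psi (z : (TG * Xi)%type) := (err z ^+ 2)%:E.
have mxi j : (0 < j <= k)%N -> measurable_fun (setT : set TG) (xi j : TG -> Xi).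
  by move=> jk _ A mA; apply: sub_gen_smallest; exists j => //; exists A.
have kk : (0 < k <= k)%N by rewrite k0 leqnn.
have [_ mg mx] := @measurable_run _ TG k (fun j w => xi j w) x g xg mxi k kk.
have mfst : measurable_fun setT (fst : (TG * Xi)%type -> TG) by exact: measurable_fst.
have msnd : measurable_fun setT (snd : (TG * Xi)%type -> Xi) by exact: measurable_snd.
have mx2 i : measurable_fun setT (fun z : (TG * Xi)%type => x k.+1 z.1 0 i).
  exact: (measurableT_comp (mx i) mfst).
have mg2 i : measurable_fun setT (fun z : (TG * Xi)%type => g k z.1 0 i).
  exact: (measurableT_comp (mg i) mfst).
have mgf2 i : measurable_fun setT (fun z : (TG * Xi)%type => gf (x k.+1 z.1) 0 i).
  apply: (measurable_on_domain _ (normr_ge0 Lnf) grad_lipschitz) => //.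
  by move=> z; exact: Xx.
have mgs i : measurable_fun setT
    (fun z : (TG * Xi)%type => grad (ft^~ z.2) (x k.+1 z.1) 0 i).
  by apply: measurable_grad_sample => // z; exact: Xx.
have mpsi : measurable_fun setT psi.
  apply/measurable_EFinP; apply: measurable_enorm_sqr.
  by apply: measurable_coordD; apply: measurable_coordZ; exact: measurable_coordB.
have GM : samples_upto xi k `<=` measurable by exact: samples_upto_measurable.
apply: (@le_trans _ _ (\int[P]_w psi (w, xi k.+1 w))%E).
  apply: ge0_le_integral_nonmeasurable => w; first by rewrite lee_fin sqr_ge0.
  rewrite lee_fin lerXn2r ?nnegrE ?enorm_ge0//.
  exact: (run_momentum_error (xg w)).
have := @ge0_integral_independent _ _ _ _ Omega TG Xi P mu
  (fun w => w) (xi k.+1) psi.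
move=> ->//.
- apply: ge0_le_integral_nonmeasurable => w.
    by apply: integral_ge0 => s _; rewrite lee_fin sqr_ge0.
  have [b ab [_ eb]] := mean_momentum_error ft_diff basic (alpha k)
    (g k w - gf (x k.+1 w)) (Xx k.+1 w isT).
  by rewrite /psi /err /= eb lee_fin.
- exact: measurable_g_sigma_id.
- by move=> A B mA mB; exact: (independent_next xi_iid).
- by move=> z; rewrite lee_fin sqr_ge0.
Qed.

End Expectation.

End Process.

Lemma sum_telescope_le (R : numDomainType) (d Phi b : nat -> R) k0 k : (k0 <= k)%N ->
  (forall j, (k0 <= j < k)%N -> d j <= Phi j - Phi j.+1 + b j) ->
  \sum_(k0 <= j < k) d j <= Phi k0 - Phi k + \sum_(k0 <= j < k) b j.
Proof.
move=> k0k h; rewrite -opprB -(telescope_sumr Phi k0k) -sumrN -big_split /=.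
by apply: ler_sum_nat => j jk; rewrite opprB; exact: h.
Qed.

(** * The step sizes and what their logarithm buys *)

Section StepSizes.
Context {R : realType}.
Context (kap r L1 L2 : R).
Context (kap_gt0 : 0 < kap) (r_gt0 : 0 < r) (r_le : r <= 1 / 2).
Context (L1_ge0 : 0 <= L1) (L2_ge0 : 0 <= L2).
Implicit Types k : nat.

Definition penalty_step k : R := k%:R `^ r.
Definition descent_step k : R := k%:R `^ (- (1 / 2)) / (kap * ln (k%:R + 2)).
Definition momentum_weight k : R := k%:R `^ (- (1 / 2)).
Local Notation rho := penalty_step.
Local Notation eta := descent_step.
Local Notation alpha := momentum_weight.

Lemma momentum_weight_gt0 k : (0 < k)%N -> 0 < alpha k.
Proof. exact: powR_nat_gt0. Qed.

Lemma penalty_step_gt0 k : (0 < k)%N -> 0 < rho k.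
Proof. exact: powR_nat_gt0. Qed.

Lemma ln_nat2_gt0 k : 0 < ln (k%:R + 2) :> R.
Proof. by apply: ln_gt0; have := ler0n R k; lra. Qed.

Lemma descent_step_gt0 k : (0 < k)%N -> 0 < eta k.
Proof. by move=> k0; rewrite divr_gt0 ?powR_nat_gt0// mulr_gt0// ln_nat2_gt0. Qed.

Lemma momentum_weight_le1 k : (0 < k)%N -> alpha k <= 1.
Proof.
move=> k0; rewrite -[leRHS](powRr0 (k%:R : R)); apply: ler_powR; first by rewrite ler1n.
by rewrite oppr_le0.
Qed.

Lemma momentum_weight_sqr k : (0 < k)%N -> alpha k ^+ 2 = k%:R^-1.
Proof.
move=> k0; rewrite expr2 -powRD; last by rewrite pnatr_eq0 -lt0n k0 implybT.
by rewrite -[RHS]powR_inv1 ?ler0n//; congr powR; lra.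
Qed.

Lemma penalty_momentum_le1 k : (0 < k)%N -> rho k * alpha k <= 1.
Proof.
move=> k0; rewrite /penalty_step -powRD; last by rewrite pnatr_eq0 -lt0n k0 implybT.
rewrite -[leRHS](powRr0 (k%:R : R)); apply: ler_powR; first by rewrite ler1n.
by move: r_le; lra.
Qed.

Lemma descent_stepE k : eta k * (kap * ln (k%:R + 2)) = alpha k.
Proof. by rewrite /descent_step divfK// mulf_neq0// gt_eqF// ln_nat2_gt0. Qed.

Context (k : nat) (k_gt0 : (0 < k)%N).
Context (large : 2 + 4 * L1 ^+ 2 + 4 * L1 + 4 * L2 <= kap * ln (k%:R + 2)).

Let Ll : R := kap * ln (k%:R + 2).
Let Ll_gt0 : 0 < Ll. Proof. by rewrite mulr_gt0// ln_nat2_gt0. Qed.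
Let L1sq : 0 <= L1 ^+ 2. Proof. exact: sqr_ge0. Qed.

(** Multiplying by kap ln (k + 2) turns eta into alpha, and rho alpha <= 1 because r <= 1 / 2; what
    remains is a constant below the threshold [large]. *)
Lemma large_penalty : 4 * L2 * (rho k * eta k) <= 1.
Proof.
rewrite -(ler_pM2r Ll_gt0) mul1r.
have -> : 4 * L2 * (rho k * eta k) * Ll = 4 * L2 * (rho k * (eta k * Ll)) by ring.
rewrite descent_stepE.
apply: le_trans (_ : 4 * L2 * 1 <= _).
  by rewrite ler_wpM2l ?mulr_ge0 ?penalty_momentum_le1.
by rewrite /Ll; move: large L1sq L1_ge0; lra.
Qed.

Lemma large_descent : 4 * (eta k * (L1 + rho k * L2)) <= 1.
Proof.
rewrite -(ler_pM2r Ll_gt0) mul1r.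
have -> : 4 * (eta k * (L1 + rho k * L2)) * Ll =
    4 * L1 * (eta k * Ll) + 4 * L2 * (rho k * (eta k * Ll)) by ring.
rewrite descent_stepE.
have h1 := ler_wpM2l (_ : 0 <= 4 * L1) (momentum_weight_le1 k_gt0).
have h2 := ler_wpM2l (_ : 0 <= 4 * L2) (penalty_momentum_le1 k_gt0).
rewrite !mulr_ge0// !mulr1 in h1 h2; have {h1} h1 := h1 isT; have {h2} h2 := h2 isT.
by rewrite /Ll; move: large L1sq h1 h2; lra.
Qed.

Lemma large_momentum : 2 * eta k <= alpha k.
Proof.
rewrite -descent_stepE mulrC ler_pM2l ?descent_step_gt0//.
by move: large L1sq L1_ge0 L2_ge0; lra.
Qed.

(** The left side is the price of the gradient drift in the momentum recursion, the right side half
    of the displacement weight gained by descent. *)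
Lemma large_lipschitz : L1 ^+ 2 / alpha k <= (4 * eta k)^-1.
Proof.
have e0 := descent_step_gt0 k_gt0; have a0 := momentum_weight_gt0 k_gt0.
rewrite ler_pdivrMr// [leRHS]mulrC ler_pdivlMr; last by rewrite mulr_gt0.
have -> : L1 ^+ 2 * (4 * eta k) = eta k * (4 * L1 ^+ 2) by ring.
by rewrite -descent_stepE ler_pM2l//; move: large L1sq L1_ge0 L2_ge0; lra.
Qed.

End StepSizes.

(** * Estimates valid for every run *)

Section Pathwise.
Context {R : realType} {n m : nat} {dXi : measure_display}
  {Xi : measurableType dXi} {mu : probability Xi R} {X : set 'rV[R]_n}
  {ft : 'rV[R]_n -> Xi -> R} {c : 'rV[R]_n -> 'rV[R]_m}
  {Lf sigma Lc Lnc Cc gamma theta Lnf : R} {x1 : 'rV[R]_n}.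
Context (X_closed : closed X).
Context (X_segment : forall a b (t : R), X a -> X b -> 0 <= t <= 1 ->
  X (a + t *: (b - a))).
Context (basic : basic_assumptions mu X ft c Lf sigma Lc Lnc Cc gamma theta).
Context (f_smooth : forall u v, X u -> X v ->
  enorm (grad (objective mu ft) u - grad (objective mu ft) v)
    <= Lnf * enorm (u - v)).
Context (x1X : X x1).
Context (kap r s : R).
Context (kap_gt0 : 0 < kap) (r_gt0 : 0 < r) (r_le : r <= 1 / 2).
Context (s_gt0 : 0 < s) (s_le1 : s <= 1) (s_theta : s * theta = 2 * r).
Local Notation f := (objective mu ft).
Local Notation gf := (grad f).
Local Notation gh := (grad_map_val c).
Local Notation rho := (penalty_step r).
Local Notation eta := (descent_step kap).
Local Notation run := (truncated_polyak_momentum X ft c Lf x1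
  (penalty_step r) (descent_step kap) (@momentum_weight R)).

Let L1 : R := `|Lnf|.
Let L2 : R := `|Lc| ^+ 2 + `|Lnc| * `|Cc|.
Let L1_ge0 : 0 <= L1. Proof. exact: normr_ge0. Qed.
Let L2_ge0 : 0 <= L2. Proof. by rewrite addr_ge0 ?sqr_ge0 ?mulr_ge0. Qed.
Let X_nonempty : X !=set0. Proof. by exists x1. Qed.

Definition large_index k := (0 < k)%N /\
  2 + 4 * L1 ^+ 2 + 4 * L1 + 4 * L2 <= kap * ln (k%:R + 2).

Section Run.
Context {xi : nat -> Xi} {x g : nat -> 'rV[R]_n}.
Context (xg : run xi x g).
Let xX k : (0 < k)%N -> X (x k). Proof. by move=> k0; exact: (run_in X_closed x1X xg k0). Qed.

(** This is [feasibility_step] divided by tau / 2: since eta = tau / rho, the noise (eta Lf)^2 is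
    tau times Lf^2 tau / rho^2, and rho^-2 is k^(-2r). *)
Lemma run_feasibility_step k : large_index k ->
  enorm (c (x k.+1)) ^+ 2 +
    gamma ^+ 2 / 8 * (rho k * eta k) * (enorm (c (x k.+1)) ^+ 2) `^ theta
  <= enorm (c (x k)) ^+ 2 + 4 * Lf ^+ 2 * (rho k * eta k) * k%:R `^ (- (2 * r)).
Proof.
move=> [k0 lk]; set tau := rho k * eta k.
have rho0 : 0 < rho k by exact: penalty_step_gt0.
have eta0 : 0 < eta k by exact: descent_step_gt0.
have tau0 : 0 < tau by rewrite mulr_gt0.
have g0 := ltW (gamma_gt0 basic).
have := @feasibility_step _ _ X X_nonempty X_closed X_segment
  (fun z => enorm (c z) ^+ 2 / 2) gh (x k) (g k) (rho k) (eta k) `|Lf| L2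
  (gamma * enorm (c (x k.+1)) `^ theta) (xX k0) rho0 eta0 L2_ge0.
rewrite /= -(tpm_x xg k0) mulr_ge0 ?powR_ge0// => /(_ isT).
have xk1 : X (x k.+1) by exact: xX.
move=> /(_ (run_momentum_le basic x1X xg k0))
  /(_ (large_penalty kap_gt0 r_le L1_ge0 L2_ge0 k0 lk))
  /(_ (feasibility_descent X_segment basic (xX k0) xk1))
  /(_ (grad_map_val_lipschitz basic xk1 (xX k0)))
  /(_ (fun v => error_bound_normal basic (v := v))).
rewrite -/tau; set a := enorm (c (x k.+1)); set a0 := enorm (c (x k)).
have a_ge0 : 0 <= a by exact: enorm_ge0.
have -> : (a ^+ 2) `^ theta = (a `^ theta) ^+ 2.
  by rewrite expr2 powRM// -expr2.
have -> : k%:R `^ (- (2 * r)) = (rho k ^+ 2)^-1.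
  by rewrite powRN mulr_natl mulr2n /penalty_step expr2 powRD// ?pnatr_eq0 -?lt0n ?k0 ?implybT.
have -> : (eta k * `|Lf|) ^+ 2 = tau * (Lf ^+ 2 * tau * (rho k ^+ 2)^-1).
  rewrite exprMn real_normK ?num_real// /tau; field; exact: lt0r_neq0.
have -> : (tau * (gamma * a `^ theta)) ^+ 2 = tau * (gamma ^+ 2 * tau * (a `^ theta) ^+ 2).
  by ring.
have -> : 4 * Lf ^+ 2 * tau / rho k ^+ 2 = 4 * (Lf ^+ 2 * tau / rho k ^+ 2) by rewrite !mulrA.
move: (a `^ theta ^+ 2) (Lf ^+ 2 * tau / rho k ^+ 2) (a ^+ 2) (a0 ^+ 2) => w z b b0 h.
have : tau * ((b / 2 - b0 / 2) + gamma ^+ 2 * tau * w / 16) <= tau * (2 * z).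
  by move: h; lra.
rewrite ler_pM2l//; lra.
Qed.

Lemma run_penalty_step k : large_index k ->
  f (x k.+1) + rho k * (enorm (c (x k.+1)) ^+ 2 / 2) +
    enorm (x k.+1 - x k) ^+ 2 / (2 * eta k) <=
  f (x k) + rho k * (enorm (c (x k)) ^+ 2 / 2) +
    eta k * enorm (g k - gf (x k)) ^+ 2.
Proof.
move=> [k0 lk].
have rho0 : 0 < rho k by exact: penalty_step_gt0.
have eta0 : 0 < eta k by exact: descent_step_gt0.
have xk1 : X (x k.+1) by exact: xX.
have := @penalty_descent_step _ _ X X_nonempty X_closed X_segment f
  (fun z => enorm (c z) ^+ 2 / 2) gf gh (x k) (g k) (rho k) (eta k) L1 L2
  (xX k0) rho0 eta0 (large_descent kap_gt0 r_le L1_ge0 L2_ge0 k0 lk).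
rewrite /= -(tpm_x xg k0); apply.
- apply: (@descent_of_lipschitz _ _ X f gf L1) => //; last exact: xX.
  + by move=> z v; exact: (objective_is_derive basic).
  + by move=> u v; exact: (grad_lipschitz f_smooth).
- exact: (feasibility_descent X_segment basic (xX k0) xk1).
Qed.

Lemma run_stationarity k : large_index k ->
  (dist_to 0 (translate (gf (x k.+1) + rho k *: gh (x k.+1)) (normal_cone X (x k.+1)))
   <= (enorm (g k - gf (x k)) + 2 * (enorm (x k.+1 - x k) / eta k))%:E)%E.
Proof.
move=> [k0 lk].
have rho0 : 0 < rho k by exact: penalty_step_gt0.
have eta0 : 0 < eta k by exact: descent_step_gt0.
have xk1 : X (x k.+1) by exact: xX.
have := @stationarity_step _ _ X X_nonempty X_closed X_segment gf gh (x k) (g k)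
  (rho k) (eta k) L1 L2 (xX k0) rho0 eta0
  (large_descent kap_gt0 r_le L1_ge0 L2_ge0 k0 lk).
rewrite /= -(tpm_x xg k0); apply.
- by apply: (grad_lipschitz f_smooth) => //; exact: xX.
- by apply: (grad_map_val_lipschitz basic) => //; exact: xX.
Qed.

(** Before the index becomes large no descent is available; this crude bound keeps the potential at
    the first large index below a constant common to all runs. *)
Lemma run_value_le k : (0 < k)%N -> f (x k) <= f x1 +
  \sum_(1 <= j < k) `|Lf| * (eta j * (`|Lf| + rho j * (`|Lc| * `|Cc|))).
Proof.
case: k => // k _; elim: k => [|k IH].
  by rewrite big_geq// addr0 (tpm_x1 xg).
rewrite big_nat_recr//= addrA.
have := objective_lipschitz basic (xX (ltn0Sn k.+1)) (xX (ltn0Sn k)).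
have := run_step_le X_closed X_segment basic x1X xg (ltn0Sn k)
  (ltW (descent_step_gt0 kap_gt0 (ltn0Sn k))) (ltW (penalty_step_gt0 r (ltn0Sn k))).
move=> /(ler_wpM2l (normr_ge0 Lf)) h1 /(le_trans (ler_norm _)) h2.
by move: IH h1 h2; lra.
Qed.

(** The growth of rho costs M j^(r-s) / j at step j. Bounding j^(r-s) by k^e leaves a harmonic sum,
    and e >= 0 also covers r <= s. *)
Lemma run_penalty_sum k0 k M fl e : (0 < k0)%N -> (k0 <= k)%N ->
  (forall j, (k0 <= j)%N -> large_index j) -> 0 <= M -> 0 <= e -> r - s <= e ->
  (forall j, (k0 <= j)%N -> enorm (c (x j)) ^+ 2 <= M * j%:R `^ (- s)) ->
  (forall z, X z -> fl <= f z) ->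
  \sum_(k0 <= j < k) enorm (x j.+1 - x j) ^+ 2 / (2 * eta j) <=
  f (x k0) + rho k0 * (enorm (c (x k0)) ^+ 2 / 2) - fl +
  \sum_(k0 <= j < k) eta j * enorm (g j - gf (x j)) ^+ 2 +
  M * k%:R `^ e * (2 * ln (k%:R + 2)).
Proof.
move=> k00 k0k lg M0 e0 rse fe flb.
pose Phi j := f (x j) + rho j * (enorm (c (x j)) ^+ 2 / 2).
pose b j := eta j * enorm (g j - gf (x j)) ^+ 2 + M * k%:R `^ e * j%:R^-1.
have step j : (k0 <= j < k)%N ->
    enorm (x j.+1 - x j) ^+ 2 / (2 * eta j) <= Phi j - Phi j.+1 + b j.
  move=> /andP[k0j jk]; have j0 : (0 < j)%N := leq_trans k00 k0j.
  have := run_penalty_step (lg _ k0j).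
  have dr : rho j.+1 - rho j <= rho j / j%:R.
    by apply: powR_succ_le => //; apply/andP; split; [exact: ltW|move: r_le; lra].
  have dr0 : 0 <= rho j.+1 - rho j.
    by rewrite subr_ge0; apply: ler_powR_nat => //; exact: ltW.
  have aj : enorm (c (x j.+1)) ^+ 2 / 2 <= M * j%:R `^ (- s).
    have h1 : M * j.+1%:R `^ (- s) <= M * j%:R `^ (- s).
      rewrite ler_wpM2l// !powRN lef_pV2 ?posrE ?powR_nat_gt0//.
      by apply: ler_powR_nat => //; exact: ltW.
    have := fe j.+1 (leq_trans k0j (leqnSn _)).
    by move: h1 (sqr_ge0 (enorm (c (x j.+1)))); lra.
  have h2 : (rho j.+1 - rho j) * (enorm (c (x j.+1)) ^+ 2 / 2) <=
      M * k%:R `^ e * j%:R^-1.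
    apply: (@le_trans _ _ (rho j / j%:R * (M * j%:R `^ (- s)))).
      by apply: ler_pM => //; rewrite divr_ge0 ?sqr_ge0.
    have -> : rho j / j%:R * (M * j%:R `^ (- s)) =
        M * (rho j * j%:R `^ (- s)) * j%:R^-1 by ring.
    rewrite ler_wpM2r ?invr_ge0// ler_wpM2l// /penalty_step -powRD; last first.
      by rewrite pnatr_eq0 -lt0n j0 implybT.
    apply: (@le_trans _ _ (j%:R `^ e)); first by apply: ler_powR; rewrite ?ler1n.
    by apply: ler_powR_nat => //; exact: ltnW.
  by rewrite /Phi /b; move: h2; lra.
have := sum_telescope_le k0k step.
rewrite /b big_split /= -mulr_sumr.
have Phik : fl <= Phi k.
  have := flb _ (xX (leq_trans k00 k0k)).
  have : 0 <= rho k * (enorm (c (x k)) ^+ 2 / 2).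
    by rewrite mulr_ge0 ?powR_ge0 ?divr_ge0 ?sqr_ge0.
  by rewrite /Phi; lra.
have := ler_wpM2l (mulr_ge0 M0 (powR_ge0 (k%:R : R) e)) (harmonic_le k k00).
by move: Phik; rewrite /Phi; lra.
Qed.

End Run.

Lemma run_feasibility k0 : (0 < k0)%N ->
  (forall k, (k0 <= k)%N -> large_index k /\
    k%:R `^ (- s) * (kap * ln (k%:R + 2)) * 4 <= gamma ^+ 2 / 8) ->
  exists2 M, 0 <= M & forall xi x g, run xi x g ->
    forall k, (k0 <= k)%N -> enorm (c (x k)) ^+ 2 <= M * k%:R `^ (- s).
Proof.
move=> k00 lg.
have c1 : 0 < gamma ^+ 2 / 8 by rewrite divr_gt0// exprn_gt0// (gamma_gt0 basic).
have c2 : 0 <= 4 * Lf ^+ 2 by rewrite mulr_ge0// sqr_ge0.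
have [M M0 hM] := @recursion_rate R theta s r (gamma ^+ 2 / 8) (4 * Lf ^+ 2) kap
  (`|Cc| ^+ 2) k0 (theta_ge1 basic) s_gt0 s_le1 r_gt0 r_le s_theta c1 c2 kap_gt0 k00
  (fun k h => (lg k h).2).
exists M => // xi x g xg; apply: (hM (fun k => enorm (c (x k)) ^+ 2)).
- by move=> k; rewrite sqr_ge0.
- rewrite lerXn2r ?nnegrE ?enorm_ge0//; apply: (constraint_le basic).
  exact: (run_in X_closed x1X xg k00).
- by move=> k k0k; exact: (run_feasibility_step xg (lg k k0k).1).
Qed.

End Pathwise.

Section Arithmetic.
Context {R : realFieldType}.

Lemma half_arith (x y : R) : 2 * x <= y -> x <= y / 2.
Proof. lra. Qed.

Lemma noise_arith (a x al e z v i : R) :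
  a <= x + i * v -> x <= (1 - al) * e + z -> al * e <= e - a + (z + v * i).
Proof. lra. Qed.

Lemma descent_arith (p p' y V fl S S2 z : R) : p <= p' -> y <= V ->
  S <= y + p - fl + S2 + z -> S <= (V + p' - fl + z) + S2.
Proof. lra. Qed.

(** SD and SE are half of the displacement and momentum sums. The momentum inequality charges SD and
    the descent inequality charges SE, so adding them leaves one copy of each on the left. *)
Lemma energy_arith (SD SE N D K L E0 Ek v S : R) :
  2 * SE <= E0 - Ek + N -> 2 * SD <= K + L + S -> S <= SE -> N <= SD + v ->
  E0 <= D -> 0 <= Ek -> SD + SE <= `|K| + L + D + v.
Proof. by have := ler_norm K; lra. Qed.

Lemma energy_const_arith (x K l ke M v B : R) : 0 <= K -> 0 <= v -> 0 <= B ->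
  1 <= l -> 1 <= ke ->
  x <= K + M * ke * (2 * l) + 4 * B + v * (2 * l) ->
  x <= (K + 4 * B + 2 * M + 2 * v) * (l * ke).
Proof.
move=> K0 v0 B0 l1 ke1.
have lke2 : l <= l * ke by rewrite -[leLHS]mulr1 ler_wpM2l// (le_trans ler01).
have lke := le_trans l1 lke2.
have := ler_wpM2l K0 lke; have := ler_wpM2l B0 lke; have := ler_wpM2l v0 lke2; lra.
Qed.

End Arithmetic.

(** * Expected energy along the run *)

Section MeanBound.
Context {R : realType} {n m : nat} {dXi : measure_display}
  {Xi : measurableType dXi} {mu : probability Xi R} {X : set 'rV[R]_n}
  {ft : 'rV[R]_n -> Xi -> R} {c : 'rV[R]_n -> 'rV[R]_m}
  {Lf sigma Lc Lnc Cc gamma theta Lnf : R} {x1 : 'rV[R]_n}.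
Context (X_closed : closed X).
Context (X_segment : forall a b (t : R), X a -> X b -> 0 <= t <= 1 ->
  X (a + t *: (b - a))).
Context (ft_diff : forall s x, differentiable (ft^~ s) x).
Context (ft_C1 : forall s, continuous (grad (ft^~ s))).
Context (basic : basic_assumptions mu X ft c Lf sigma Lc Lnc Cc gamma theta).
Context (f_smooth : forall u v, X u -> X v ->
  enorm (grad (objective mu ft) u - grad (objective mu ft) v)
    <= Lnf * enorm (u - v)).
Context (x1X : X x1).
Context (kap r s : R).
Context (kap_gt0 : 0 < kap) (r_gt0 : 0 < r) (r_le : r <= 1 / 2) (s_gt0 : 0 < s).
Local Notation f := (objective mu ft).
Local Notation gf := (grad f).
Local Notation rho := (penalty_step r).
Local Notation eta := (descent_step kap).
Local Notation alpha := (@momentum_weight R).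
Local Notation run := (truncated_polyak_momentum X ft c Lf x1
  (penalty_step r) (descent_step kap) (@momentum_weight R)).
Local Notation large_index := (@large_index R Lc Lnc Cc Lnf kap).

(** The weights are half of those that descent, (2 eta)^-1, and momentum contraction, alpha,
    provide; the other halves absorb the coupling. *)
Definition step_energy (x x' g : 'rV[R]_n) k : R :=
  (4 * eta k)^-1 * enorm (x' - x) ^+ 2 + alpha k / 2 * enorm (g - gf x) ^+ 2.

Lemma step_energy_ge0 x x' g k : (0 < k)%N -> 0 <= step_energy x x' g k.
Proof.
move=> k0; have := descent_step_gt0 kap_gt0 k0; have := @momentum_weight_gt0 R _ k0.
move=> a0 e0; apply: addr_ge0; apply: mulr_ge0; rewrite ?sqr_ge0//.
  by rewrite invr_ge0 mulr_ge0// ltW.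
by rewrite divr_ge0// ltW.
Qed.

Section Sampled.
Context {d : measure_display} {T : measurableType d} {xi : nat -> T -> Xi}
  {x g : nat -> T -> 'rV[R]_n}.
Context (mxi : forall j, (0 < j)%N -> measurable_fun setT (xi j)).
Context (xg : forall w, run (xi^~ w) (x^~ w) (g^~ w)).

Let xX k w : (0 < k)%N -> X (x k w).
Proof. by move=> k0; exact: (run_in X_closed x1X (xg w) k0). Qed.

Lemma measurable_run_error k l : (0 < k)%N -> (l = k \/ l = k.+1) ->
  measurable_fun setT (fun w => enorm (g k w - gf (x l w)) ^+ 2).
Proof.
move=> k0 kl.
have kk : (0 < k <= k)%N by rewrite k0 leqnn.
have [mx mg mx'] := measurable_run X_closed X_segment ft_diff ft_C1 basic x1X xg
  (fun j jk => mxi (proj1 (andP jk))) kk.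
apply: measurable_enorm_sqr; apply: measurable_coordB => //.
by move=> i; apply: (measurable_on_domain X_closed X_segment x1X i (normr_ge0 Lnf)
  (grad_lipschitz f_smooth)); case: kl => -> // w; exact: xX.
Qed.

Lemma measurable_run_displacement k : (0 < k)%N ->
  measurable_fun setT (fun w => enorm (x k.+1 w - x k w) ^+ 2).
Proof.
move=> k0; have kk : (0 < k <= k)%N by rewrite k0 leqnn.
have [mx mg mx'] := measurable_run X_closed X_segment ft_diff ft_C1 basic x1X xg
  (fun j jk => mxi (proj1 (andP jk))) kk.
by apply: measurable_enorm_sqr; exact: measurable_coordB.
Qed.

Lemma measurable_step_energy k : (0 < k)%N ->
  measurable_fun setT (fun w => step_energy (x k w) (x k.+1 w) (g k w) k).
Proof.
move=> k0; apply: measurable_funD; apply: measurable_funM => //.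
  exact: measurable_run_displacement.
by apply: measurable_run_error => //; left.
Qed.

End Sampled.

Context (k0 : nat) (M fl e : R).
Context (k0_gt0 : (0 < k0)%N).
Context (large : forall j, (k0 <= j)%N -> large_index j).
Context (ln_ge1 : forall j, (k0 <= j)%N -> 1 <= ln (j%:R + 2) :> R).
Context (M_ge0 : 0 <= M) (e_ge0 : 0 <= e) (rs_le : r - s <= e).
Context (feasible : forall xi x g, run xi x g ->
  forall j, (k0 <= j)%N -> enorm (c (x j)) ^+ 2 <= M * j%:R `^ (- s)).
Context (fl_le : forall z, X z -> fl <= f z).

(** An upper bound, common to all runs, for the potential f + rho |c|^2 / 2 at index k0. *)
Let C0 := f x1 +
  \sum_(1 <= j < k0) `|Lf| * (eta j * (`|Lf| + rho j * (`|Lc| * `|Cc|))) +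
  rho k0 * (Cc ^+ 2 / 2).

Definition energy_constant : R :=
  `|C0 - fl| + 4 * Lf ^+ 2 + 2 * M + 2 * sigma ^+ 2.

Lemma mean_energy_bound (dO : measure_display) (Omega : measurableType dO)
    (P : probability Omega R) (xi : nat -> {RV P >-> Xi})
    (x g : nat -> Omega -> 'rV[R]_n) :
  iid_samples mu xi -> (forall w, run (xi^~ w) (x^~ w) (g^~ w)) ->
  exists2 u : nat -> R,
    (forall j, (0 < j)%N ->
      has_mean P (fun w => step_energy (x j w) (x j.+1 w) (g j w) j) (u j)) &
    forall k, (k0 <= k)%N ->
      \sum_(k0 <= j < k) u j <= energy_constant * (ln (k%:R + 2) * k%:R `^ e).
Proof.
move=> iid xg.
have mxi j : (0 < j)%N -> measurable_fun setT (xi j : Omega -> Xi).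
  by move=> _; exact: measurable_funPT.
have xX k w : (0 < k)%N -> X (x k w).
  by move=> kp; exact: (run_in X_closed x1X (xg w) kp).
pose Er k w := enorm (g k w - gf (x k w)) ^+ 2.
pose Ev k w := enorm (g k w - gf (x k.+1 w)) ^+ 2.
pose Dd k w := enorm (x k.+1 w - x k w) ^+ 2.
pose E (Z : Omega -> R) := fine (\int[P]_w (Z w)%:E).
have sqB (y : R) K : 0 <= y -> y <= K -> 0 <= y ^+ 2 <= K ^+ 2.
  by move=> y0 yK; rewrite sqr_ge0 lerXn2r ?nnegrE// (le_trans y0).
have hEr k : (0 < k)%N -> has_mean P (Er k) (E (Er k)).
  move=> kp; apply: (@has_mean_bounded _ _ _ P _ ((2 * `|Lf|) ^+ 2)).
    by apply: (measurable_run_error mxi xg) => //; left.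
  move=> w; apply: sqB; first exact: enorm_ge0.
  by apply: (run_error_le basic x1X (xg w)) => //; exact: xX.
have hEv k : (0 < k)%N -> has_mean P (Ev k) (E (Ev k)).
  move=> kp; apply: (@has_mean_bounded _ _ _ P _ ((2 * `|Lf|) ^+ 2)).
    by apply: (measurable_run_error mxi xg) => //; right.
  move=> w; apply: sqB; first exact: enorm_ge0.
  by apply: (run_error_le basic x1X (xg w)) => //; exact: xX.
have hDd k : (0 < k)%N -> has_mean P (Dd k) (E (Dd k)).
  move=> kp; apply: (@has_mean_bounded _ _ _ P _
    ((eta k * (`|Lf| + rho k * (`|Lc| * `|Cc|))) ^+ 2)).
    exact: (measurable_run_displacement mxi xg).
  move=> w; apply: sqB; first exact: enorm_ge0.
  apply: (run_step_le X_closed X_segment basic x1X (xg w)) => //.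
    by rewrite ltW// descent_step_gt0.
  by rewrite ltW// penalty_step_gt0.
have Er_ge0 k : (0 < k)%N -> 0 <= E (Er k).
  by move=> kp; apply: (has_mean_ge0 _ (hEr k kp)) => w; rewrite sqr_ge0.
have Dd_ge0 k : (0 < k)%N -> 0 <= E (Dd k).
  by move=> kp; apply: (has_mean_ge0 _ (hDd k kp)) => w; rewrite sqr_ge0.
exists (fun j => (4 * eta j)^-1 * E (Dd j) + alpha j / 2 * E (Er j)).
  by move=> j j0; apply: has_meanD; apply: has_meanZ; [exact: hDd|exact: hEr].
move=> k k0k.
have pos j : (k0 <= j)%N -> (0 < j)%N by exact: leq_trans.
(* Moving the reference point from x_j to x_{j+1} costs Lnf^2 |d_j|^2 / alpha_j, and the fresh noise
   alpha_j^2 sigma^2 is exactly sigma^2 / j. *)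
have noise : \sum_(k0 <= j < k) alpha j * E (Er j) <= E (Er k0) - E (Er k) +
    \sum_(k0 <= j < k) ((`|Lnf| ^+ 2 / alpha j) * E (Dd j) + sigma ^+ 2 * j%:R^-1).
  apply: (@sum_telescope_le R (fun j => alpha j * E (Er j)) (fun j => E (Er j))
    (fun j => (`|Lnf| ^+ 2 / alpha j) * E (Dd j) + sigma ^+ 2 * j%:R^-1))
    => // j /andP[k0j jk]; have j0 := pos _ k0j.
  have a0 := @momentum_weight_gt0 R _ j0; have a1 := @momentum_weight_le1 R _ j0.
  have h1 := momentum_mean_step X_closed X_segment ft_diff ft_C1 basic f_smooth x1X
    iid xg j0 (hEr j.+1 (ltn0Sn j)) (hEv j j0).
  have h2 : (1 - alpha j) ^+ 2 * E (Ev j) <=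
      (1 - alpha j) * E (Er j) + (`|Lnf| ^+ 2 / alpha j) * E (Dd j).
    apply: (has_mean_le (has_meanZ _ (hEv j j0))
      (has_meanD (has_meanZ _ (hEr j j0)) (has_meanZ _ (hDd j j0)))) => w.
    have := @momentum_young R (alpha j) (enorm (g j w - gf (x j w)))
      (`|Lnf| * enorm (x j.+1 w - x j w)) (enorm (g j w - gf (x j.+1 w))).
    rewrite a0 a1 !mulr_ge0 ?enorm_ge0//= exprMn [_ * _ / _]mulrAC; apply => //.
    have -> : g j w - gf (x j.+1 w) =
        (g j w - gf (x j w)) + (gf (x j w) - gf (x j.+1 w)) by rewrite addrA subrK.
    apply: le_trans (ler_enormD _ _) _; rewrite lerD2l enormBC.
    by apply: (grad_lipschitz f_smooth); exact: xX.
  rewrite (@momentum_weight_sqr R _ j0) in h1.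
  exact: noise_arith h1 h2.
(* This inequality holds on every run before any averaging; only its expectation is taken here. *)
have descent : \sum_(k0 <= j < k) (2 * eta j)^-1 * E (Dd j) <=
    (C0 - fl + M * k%:R `^ e * (2 * ln (k%:R + 2))) + \sum_(k0 <= j < k) eta j * E (Er j).
  have hm (b : nat -> R) (Z : nat -> Omega -> R) : (forall j, (0 < j)%N ->
      has_mean P (Z j) (E (Z j))) -> has_mean P
      (fun w => \sum_(k0 <= j < k) b j * Z j w) (\sum_(k0 <= j < k) b j * E (Z j)).
    move=> hZ; apply: has_mean_sum => j; rewrite mem_index_iota => /andP[k0j _] _.
    exact/has_meanZ/hZ/pos.
  apply: (has_mean_le (hm (fun j => (2 * eta j)^-1) Dd hDd)
    (has_meanD (has_mean_cst P _) (hm eta Er hEr))).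
  move=> w.
  have := run_penalty_sum X_closed X_segment basic f_smooth x1X kap_gt0 r_gt0 r_le s_gt0
    (xg w) k0_gt0 k0k large M_ge0 e_ge0 rs_le (feasible (xg w)) fl_le.
  under eq_bigr do rewrite mulrC.
  have h2 := run_value_le X_closed X_segment basic x1X kap_gt0 (xg w) k0_gt0.
  have h1 : rho k0 * (enorm (c (x k0 w)) ^+ 2 / 2) <= rho k0 * (Cc ^+ 2 / 2).
    rewrite ler_wpM2l ?powR_ge0// ler_wpM2r ?invr_ge0// lerXn2r ?nnegrE ?enorm_ge0//.
      exact: le_trans (enorm_ge0 _) (constraint_bounded basic (xX k0 w k0_gt0)).
    exact: (constraint_bounded basic (xX k0 w k0_gt0)).
  by move=> h3; exact: descent_arith h1 h2 h3.
pose SD := \sum_(k0 <= j < k) (4 * eta j)^-1 * E (Dd j).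
pose SE := \sum_(k0 <= j < k) alpha j / 2 * E (Er j).
have e1 : \sum_(k0 <= j < k) (2 * eta j)^-1 * E (Dd j) = 2 * SD.
  rewrite /SD mulr_sumr; apply: eq_big_nat => j /andP[k0j _].
  have := descent_step_gt0 kap_gt0 (pos _ k0j) => ep.
  by field; rewrite gt_eqF.
have e2 : \sum_(k0 <= j < k) alpha j * E (Er j) = 2 * SE.
  by rewrite /SE mulr_sumr; apply: eq_bigr => j _; field.
have e3 : \sum_(k0 <= j < k) eta j * E (Er j) <= SE.
  apply: ler_sum_nat => j /andP[k0j _]; rewrite ler_wpM2r ?Er_ge0 ?pos//.
  have [j0 lj] := large k0j.
  have := large_momentum kap_gt0 (normr_ge0 Lnf) _ j0 lj.
  rewrite addr_ge0 ?sqr_ge0 ?mulr_ge0// => /(_ isT) h.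
  exact: half_arith.
have e4 : \sum_(k0 <= j < k) ((`|Lnf| ^+ 2 / alpha j) * E (Dd j) + sigma ^+ 2 * j%:R^-1)
    <= SD + sigma ^+ 2 * (2 * ln (k%:R + 2)).
  rewrite big_split /= lerD//; last first.
    by rewrite -mulr_sumr; apply: ler_wpM2l (harmonic_le k k0_gt0); exact: sqr_ge0.
  apply: ler_sum_nat => j /andP[k0j _]; rewrite ler_wpM2r ?Dd_ge0 ?pos//.
  have [j0 lj] := large k0j.
  apply: (large_lipschitz kap_gt0 (normr_ge0 Lnf) _ j0 lj).
  by rewrite addr_ge0 ?sqr_ge0 ?mulr_ge0.
have e5 : E (Er k0) <= 4 * Lf ^+ 2.
  apply: (has_mean_le (hEr _ k0_gt0) (has_mean_cst P _)) => w.
  have -> : 4 * Lf ^+ 2 = (2 * `|Lf|) ^+ 2.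
    by rewrite exprMn real_normK ?num_real// -natrX.
  rewrite lerXn2r ?nnegrE ?enorm_ge0 ?mulr_ge0//.
  by apply: (run_error_le basic x1X (xg w)) => //; exact: xX.
have Erk := Er_ge0 k (pos _ k0k).
rewrite big_split /= -/SD -/SE /energy_constant.
set l := ln (k%:R + 2); have l1 : 1 <= l by exact: ln_ge1.
have ke1 : 1 <= k%:R `^ e.
  by rewrite -[leLHS](powRr0 (k%:R : R)); apply: ler_powR; rewrite ?ler1n ?pos.
set ke := k%:R `^ e in ke1 *.
rewrite e2 in noise; rewrite e1 in descent.
apply: energy_const_arith; rewrite ?normr_ge0 ?sqr_ge0//.
exact: energy_arith noise descent e3 e4 e5 Erk.
Qed.

End MeanBound.

(** * Expectation at an independent random index *)

Section IndependentIndex.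
Context {R : realType} {dO : measure_display} {Omega : measurableType dO}
  {P : probability Omega R}.

(** V is a function of the samples and the indicator one of the index, so the expectation factors.
    Summed over i, this turns the random index into an average. *)
Lemma integral_independent_index (G : set (set Omega)) (iota : {RV P >-> nat})
    (V : Omega -> R) v i q :
  G `<=` measurable ->
  (forall A B, <<s G >> A -> P (A `&` iota @^-1` B) = P A * P (iota @^-1` B))%E ->
  measurable_fun [set: g_sigma_algebraType G] (V : g_sigma_algebraType G -> R) ->
  (forall w, 0 <= V w) -> has_mean P V v -> P (iota @^-1` [set i]) = q%:E ->
  (\int[P]_w (V w * \1_[set i] (iota w))%:E = (q * v)%:E)%E.
Proof.
move=> GM indep mV V0 hV Pi.
pose TG := g_sigma_algebraType G.
pose psi (z : (TG * nat)%type) := (V z.1 * \1_[set i] z.2)%:E.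
have mpsi : measurable_fun setT psi.
  apply/measurable_EFinP; apply: measurable_funM.
    exact: (measurableT_comp mV (@measurable_fst _ _ TG nat)).
  have mi : measurable_fun setT (\1_[set i] : nat -> R) by exact: measurable_indic.
  exact: (measurableT_comp mi (@measurable_snd _ _ TG nat)).
have := @ge0_integral_independent _ _ _ _ Omega TG nat P (distribution P iota)
  (fun w => w) iota psi.
rewrite /psi /= => -> //.
- have [_ e] := has_meanZ q hV; rewrite -e; apply: eq_integral => w _.
  transitivity (\int[distribution P iota]_s ((V w)%:E * (\1_[set i] s)%:E))%E.
    by apply: eq_integral => s _; rewrite EFinM.
  have -> : (\int[distribution P iota]_s ((V w)%:E * (\1_[set i] s)%:E) =
      (V w)%:E * \int[distribution P iota]_s (\1_[set i] s)%:E)%E.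
    apply: ge0_integralZl; rewrite ?lee_fin//;
      try (by move=> s _; rewrite lee_fin);
      by apply/measurable_EFinP; exact: measurable_indic.
  rewrite integral_indic// setIT /distribution /pushforward [RHS]EFinM muleC.
  by congr (_ * _)%E.
- exact: measurable_g_sigma_id.
- by move=> A B mA mB; exact: indep.
- by move=> z; rewrite lee_fin mulr_ge0.
Qed.

End IndependentIndex.

(** * Numerical inequalities for the final balance *)

Section FinalArithmetic.
Context {R : realType}.

(** The bound is affine in y, so it passes to expectations directly; dl is chosen later to be of the
    order of the expected result. *)
Lemma young_square (dl t y : R) : 0 < dl -> t ^+ 2 <= y -> t <= dl / 2 + y / (2 * dl).
Proof.
move=> dl0 ty; have -> : dl / 2 + y / (2 * dl) = (dl ^+ 2 + y) / (2 * dl).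
  by field; rewrite gt_eqF.
rewrite ler_pdivlMr ?mulr_gt0//.
have := sqr_ge0 (t - dl); rewrite !expr2 in ty *; lra.
Qed.

(** The square is at most 2 a^2 + 8 (d / et)^2. The factor 32 / et turns the weight (4 et)^-1 into
    exactly 8 / et^2, and the momentum weight then has room to spare. *)
Lemma stationarity_square (al et a d Lam : R) : 0 < et -> 2 * et <= al ->
  et^-1 * 32 <= Lam ->
  (a + 2 * (d / et)) ^+ 2 <= Lam * ((4 * et)^-1 * d ^+ 2 + al / 2 * a ^+ 2).
Proof.
move=> et0 etal hL.
have i0 : 0 < et^-1 by rewrite invr_gt0.
have U0 : 0 <= (4 * et)^-1 * d ^+ 2 + al / 2 * a ^+ 2.
  apply: addr_ge0; apply: mulr_ge0; rewrite ?sqr_ge0 ?invr_ge0//.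
    by rewrite mulr_ge0// ltW.
  by rewrite divr_ge0//; lra.
apply: le_trans (ler_wpM2r U0 hL).
have -> : et^-1 * 32 * ((4 * et)^-1 * d ^+ 2 + al / 2 * a ^+ 2) =
    8 * (d / et) ^+ 2 + 16 * (et^-1 * al * a ^+ 2).
  by field; rewrite gt_eqF.
have h : 2 * a ^+ 2 <= et^-1 * al * a ^+ 2.
  rewrite ler_wpM2r ?sqr_ge0//; have := ler_wpM2l (ltW i0) etal.
  by rewrite mulrCA mulVf ?gt_eqF// mulr1.
have := sqr_ge0 (a - 2 * (d / et)); have := sqr_ge0 a.
move: h; move: (et^-1 * al * a ^+ 2) (d / et) => y z; rewrite !expr2; lra.
Qed.

(** The factor 3 rather than 2 comes from rounding; equality holds at k = 3. *)
Lemma half_le_third k : (2 <= k)%N -> (k%:R : R) <= 3 * (k - uphalf k)%:R.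
Proof.
move=> k2; rewrite -natrM ler_nat.
have := odd_double_half k; rewrite uphalf_half; rewrite -muln2; case: (odd k) => /=; lia.
Qed.

Lemma uphalf_ge (l k : nat) : (l * 2 + 2 <= k)%N -> (l <= uphalf k)%N.
Proof.
have := odd_double_half k; rewrite uphalf_half -muln2; case: (odd k) => /=; lia.
Qed.

Lemma uphalf_leq (k : nat) : (uphalf k <= k)%N.
Proof.
have := odd_double_half k; rewrite uphalf_half -muln2; case: (odd k) => /=; lia.
Qed.

Lemma leq_double_uphalf (k i : nat) : (uphalf k < i)%N -> (k <= i * 2)%N.
Proof.
have := odd_double_half k; rewrite uphalf_half -muln2; case: (odd k) => /=; lia.
Qed.

Lemma double_le_const (M x : R) : 0 <= M -> 0 <= x -> 2 * M <= 1 + 2 * M + (x + 1).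
Proof. lra. Qed.

Lemma one_le_const (M x : R) : 0 <= M -> 0 <= x -> 1 <= 1 + 2 * M + (x + 1).
Proof. lra. Qed.

Lemma powRN_le_double (s : R) (i k : nat) : 0 <= s <= 1 -> (0 < i)%N -> (0 < k)%N ->
  (k <= i * 2)%N -> i%:R `^ (- s) <= 2 * k%:R `^ (- s).
Proof.
move=> /andP[s0 s1] i0 k0 ki; rewrite !powRN.
rewrite ler_pdivlMr ?powR_nat_gt0// mulrC ler_pdivrMr ?powR_nat_gt0//.
apply: (@le_trans _ _ ((i * 2)%:R `^ s)); first exact: ler_powR_nat.
rewrite natrM powRM// mulrC ler_wpM2r ?powR_ge0//.
by apply: ler1_powR => //; rewrite ler1n.
Qed.

Lemma scaled_le (y l i D t z : R) : 0 <= y -> 0 <= l * i -> z <= D * t ->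
  y * (l * i * z) <= y * (l * t * D) * i.
Proof.
move=> y0 li0 zDt; have -> : y * (l * t * D) * i = y * (l * i * (D * t)) by ring.
by rewrite ler_wpM2l// ler_wpM2l.
Qed.

Lemma le_mulr1_add (v z : R) : 0 <= z -> v <= v * 1 + z.
Proof. by move=> z0; rewrite mulr1 lerDl. Qed.

(** With b = 96 c1 D the claim reduces to b <= (b + 1)^2; the added 1 keeps dl positive when D =
    0. *)
Lemma final_arith (N3 D W dl c1 ell kp q : R) : 0 < dl -> 0 <= D -> 0 <= W ->
  0 <= c1 -> dl = (96 * c1 * D + 1) * (kp * ell) -> q <= N3 ->
  N3 * W = 96 * c1 * (kp * ell) ^+ 2 ->
  q * (W * D) / (2 * dl) <= dl / 2.
Proof.
move=> dl0 D0 W0 c10 dlE qN NW.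
rewrite ler_pdivrMr ?mulr_gt0//.
have -> : dl / 2 * (2 * dl) = dl * dl by field.
apply: (@le_trans _ _ (N3 * (W * D))); first by rewrite ler_wpM2r ?mulr_ge0.
rewrite mulrA NW dlE; set t := (kp * ell); have t2 := sqr_ge0 t.
set b := 96 * c1; have b0 : 0 <= b * D by rewrite !mulr_ge0.
have -> : b * t ^+ 2 * D = (b * D) * t ^+ 2 by ring.
have -> : (b * D + 1) * t * ((b * D + 1) * t) =
  (b * D) * t ^+ 2 + (b * D * (b * D) + b * D + 1) * t ^+ 2 by ring.
by rewrite lerDl mulr_ge0// addr_ge0// addr_ge0// mulr_ge0.
Qed.

End FinalArithmetic.

(** * From rates to the complexity bound *)

Section Complexity.
Context {R : realType} {n m : nat} {dXi : measure_display}
  {Xi : measurableType dXi} {mu : probability Xi R} {X : set 'rV[R]_n}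
  {ft : 'rV[R]_n -> Xi -> R} {c : 'rV[R]_n -> 'rV[R]_m}
  {Lf sigma Lc Lnc Cc gamma theta Lnf : R} {x1 : 'rV[R]_n}.
Context (X_closed : closed X).
Context (X_segment : forall a b (t : R), X a -> X b -> 0 <= t <= 1 ->
  X (a + t *: (b - a))).
Context (ft_diff : forall s x, differentiable (ft^~ s) x).
Context (ft_C1 : forall s, continuous (grad (ft^~ s))).
Context (basic : basic_assumptions mu X ft c Lf sigma Lc Lnc Cc gamma theta).
Context (f_smooth : forall u v, X u -> X v ->
  enorm (grad (objective mu ft) u - grad (objective mu ft) v)
    <= Lnf * enorm (u - v)).
Context (x1X : X x1).
Context (kap r s p : R).
Context (kap_gt0 : 0 < kap) (r_gt0 : 0 < r) (r_le : r <= 1 / 2).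
Context (s_gt0 : 0 < s) (s_le1 : s <= 1) (s_theta : s * theta = 2 * r).
Context (p_ge1 : 1 <= p) (p_ge4 : 2 / p <= 1 / 2) (p_s : 2 / p <= s).
Local Notation f := (objective mu ft).

Lemma complexity_of_exponents : complexity_bound mu X ft c Lf x1
  (penalty_step r) (descent_step kap) (@momentum_weight R) p.
Proof.
have [fl flb] := objective_lower_bound basic.
pose A : R := 2 + 4 * `|Lnf| ^+ 2 + 4 * `|Lnf| + 4 * (`|Lc| ^+ 2 + `|Lnc| * `|Cc|).
have A0 : 0 <= A by rewrite !addr_ge0 ?mulr_ge0 ?addr_ge0 ?mulr_ge0 ?sqr_ge0.
have B0 : 0 < gamma ^+ 2 / 8 / (kap * 4).
  apply: divr_gt0; last exact: mulr_gt0.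
  by apply: divr_gt0 => //; apply: exprn_gt0; exact: (gamma_gt0 basic).
have [ka ka0 hka] := eventually_ln_ge (1 + A / kap).
have [kb kb0 hkb] := eventually_powRN_ln_le s_gt0 B0.
pose k0 := maxn ka kb.
have k00 : (0 < k0)%N by rewrite leq_max ka0.
have lnA k : (k0 <= k)%N -> 1 + A / kap <= ln (k%:R + 2).
  by move=> kk; apply: hka; rewrite (leq_trans _ kk)// leq_maxl.
have ln1 k : (k0 <= k)%N -> 1 <= ln (k%:R + 2) :> R.
  by move=> /lnA; apply: le_trans; rewrite lerDl divr_ge0// ltW.
have lg k : (k0 <= k)%N -> @large_index R Lc Lnc Cc Lnf kap k.
  move=> kk; split; first exact: leq_trans kk.
  rewrite -/A mulrC -ler_pdivrMr//; apply: le_trans (lnA _ kk).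
  by rewrite lerDr.
have sm k : (k0 <= k)%N -> k%:R `^ (- s) * (kap * ln (k%:R + 2)) * 4 <= gamma ^+ 2 / 8.
  move=> kk; have := hkb k (leq_trans (leq_maxr _ _) kk).
  rewrite ler_pdivlMr ?mulr_gt0//; apply: le_trans.
  by rewrite le_eqVlt; apply/orP; left; apply/eqP; ring.
have [M M0 hM] := run_feasibility X_closed X_segment basic x1X kap_gt0 r_gt0 r_le
  s_gt0 s_le1 s_theta k00 (fun k kk => conj (lg k kk) (sm k kk)).
(* The largest growth k^e of the energy that still gives stationarity of order k^(-1/p). It is
   nonnegative by 2 / p <= 1 / 2, and at least r - s by r <= 1 / 2 and 2 / p <= s. *)
pose e : R := 1 / 2 - 2 / p.
have e0 : 0 <= e by rewrite subr_ge0.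
have rse : r - s <= e by rewrite /e; move: r_le p_s; lra.
have [D DE] : exists D, D = @energy_constant R n dXi Xi mu ft Lf sigma Lc Cc x1 kap r k0 M fl.
  by eexists.
have hD dO (Omega : measurableType dO) (P : probability Omega R)
    (xi : nat -> {RV P >-> Xi}) (x g : nat -> Omega -> 'rV[R]_n)
    (iid : iid_samples mu xi)
    (xg : forall w, truncated_polyak_momentum X ft c Lf x1 (penalty_step r)
      (descent_step kap) (@momentum_weight R) (xi^~ w) (x^~ w) (g^~ w)) :=
  mean_energy_bound X_closed X_segment ft_diff ft_C1 basic f_smooth x1X
    kap_gt0 r_gt0 r_le s_gt0 k00 lg ln1 M0 e0 rse hM flb iid xg.
have c1D : 0 <= 96 * kap * `|D| by rewrite !mulr_ge0// ltW.
(* The part 1 + 2 M serves feasibility, the bracket is the factor in [dl] and serves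
   stationarity. *)
pose C := 1 + 2 * M + (96 * kap * `|D| + 1).
have C0 : 0 <= C by rewrite /C !addr_ge0// mulr_ge0.
(* From 2 k0 + 2 on, [uphalf k] is at least k0, so every index that can be drawn is large. *)
have [T TO hT] := soft_O_powR_ln (k0 * 2 + 2)%N p_ge1 C0.
exists T => // eps eps0 dO Omega P xi iota x g iid xg unif indepI k k2 Tk.
have [Kk hk] := hT eps k eps0 Tk.
have kp0 : (0 < k)%N := ltnW k2.
have k0u : (k0 <= uphalf k)%N by exact: uphalf_ge.
have uk := uphalf_leq k.
have k0k := leq_trans k0u uk.
have [iota_range iota_P] := unif k k2.
have ell1 := ln1 k k0k.
set ell := ln (k%:R + 2) in hk ell1.
set kp := k%:R `^ (- p^-1) in hk.
have kp_gt0 : 0 < kp by exact: powR_nat_gt0.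
have p_gt0 : 0 < p := lt_le_trans ltr01 p_ge1.
have kp2 : kp ^+ 2 = k%:R `^ (- (2 / p)).
  rewrite expr2 /kp -powRD; last by rewrite pnatr_eq0 -lt0n kp0 implybT.
  by congr powR; rewrite mulr_natl mulr2n opprD.
split.
  move=> w; have /andP[i1 i2] := iota_range w; set i := iota k w in i1 i2 *.
  have k0i : (k0 <= i)%N by rewrite (leq_trans k0u)// ltnW.
  have := hM _ _ _ (xg w) i k0i => hMi.
  have i_gt0 : (0 < i)%N := leq_trans k00 k0i.
  have ki : (k <= i * 2)%N by exact: leq_double_uphalf.
  have s01 : 0 <= s <= 1 by rewrite ltW.
  have h1 := ler_wpM2l M0 (powRN_le_double s01 i_gt0 kp0 ki).
  have h2 : k%:R `^ (- s) <= kp ^+ 2.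
    by rewrite kp2; apply: ler_powR; rewrite ?ler1n// lerN2.
  have h3 := ler_wpM2l (mulr_ge0 (ler0n R 2) M0) h2.
  apply: le_trans hk; apply: (@le_trans _ _ (C * kp)); last first.
    by rewrite ler_wpM2l// -[leLHS]mulr1 ler_wpM2l// ltW.
  rewrite -ler_sqr ?nnegrE ?enorm_ge0 ?mulr_ge0 ?(ltW kp_gt0)//.
  have h4 : 2 * M <= C ^+ 2.
    apply: (@le_trans _ _ C); first exact: double_le_const.
    by rewrite expr2 -[leLHS]mulr1 ler_wpM2l//; exact: one_le_const.
  rewrite exprMn; apply: le_trans (ler_wpM2r (sqr_ge0 kp) h4).
  apply: le_trans hMi (le_trans h1 _).
  by rewrite mulrA (mulrC M); exact: h3.
pose dl := (96 * kap * `|D| + 1) * (kp * ell).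
have ell0 : 0 < ell := lt_le_trans ltr01 ell1.
have dl0 : 0 < dl by rewrite !mulr_gt0// ltr_wpDl.
(* This is 32 / eta_k. It dominates 32 / eta_j for all j <= k, so one factor works for the whole
   range of the index. *)
pose Lam : R := 32 * (k%:R `^ (1 / 2) * (kap * ell)).
have Lam0 : 0 <= Lam by rewrite !mulr_ge0 ?powR_ge0 ?(ltW kap_gt0) ?(ltW ell0).
pose U j w := step_energy (mu := mu) (ft := ft) kap (x j w) (x j.+1 w) (g j w) j.
pose V j w := dl / 2 + (Lam / (2 * dl)) * U j w.
have cV : 0 <= Lam / (2 * dl) by rewrite divr_ge0// mulr_ge0// ltW.
have V0 j w : (0 < j)%N -> 0 <= V j w.
  move=> j0; rewrite addr_ge0 ?divr_ge0 ?(ltW dl0)// mulr_ge0//.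
  exact: step_energy_ge0.
have [u hu hsum] := hD dO Omega P xi x g iid xg.
have u0 j : (0 < j)%N -> 0 <= u j.
  by move=> j0; apply: (has_mean_ge0 _ (hu j j0)) => w; exact: step_energy_ge0.
pose N := (k - uphalf k)%N.
pose Ind j w : R := \1_[set j.+1] (iota k w).
have Ind0 j w : 0 <= Ind j w by rewrite /Ind indicE.
have range_gt0 j : j \in index_iota (uphalf k) k -> (0 < j)%N.
  by rewrite mem_index_iota => /andP[uj _]; exact: leq_trans k00 (leq_trans k0u uj).
(* On the event iota = j + 1 the distance is governed by the step from x_j to x_{j+1}, hence the
   shifted range from [uphalf k] to k - 1. The guard 0 < j makes nonnegativity and measurability,
   known from index 1 on, available term by term. *)
apply: (@le_trans _ _ (\int[P]_w
    (\sum_(uphalf k <= j < k | (0 < j)%N) (V j w * Ind j w)%:E))%E).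
  apply: ge0_le_integral_nonmeasurable => w.
    by apply: le_ereal_inf_tmp => _ [z _ <-]; rewrite lee_fin enorm_ge0.
  have /andP[i1 i2] := iota_range w.
  case Ei: (iota k w) i1 i2 => [|j]// uj jk; rewrite ltnS in uj.
  have k0j := leq_trans k0u uj; have j0 := leq_trans k00 k0j.
  have main : enorm (g j w - grad f (x j w)) +
      2 * (enorm (x j.+1 w - x j w) / descent_step kap j) <= V j w.
    rewrite /V [Lam / _ * _]mulrAC; apply: (young_square dl0).
    have ej := descent_step_gt0 kap_gt0 j0.
    apply: (stationarity_square _ _ ej).
      apply: (large_momentum kap_gt0 (normr_ge0 Lnf) _ j0 (lg j k0j).2).
      by rewrite addr_ge0 ?sqr_ge0 ?mulr_ge0.
    rewrite mulrC /Lam ler_pM2l// /descent_step invfM invrK -powRN opprK.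
    have lj : ln (j%:R + 2) <= ell.
      by rewrite ler_ln ?posrE ?ltr_wpDl// lerD2r ler_nat ltnW.
    have hk2 : j%:R `^ (1 / 2) <= k%:R `^ (1 / 2) :> R.
      by apply: ler_powR_nat (ltnW jk); rewrite divr_ge0.
    have hl : kap * ln (j%:R + 2) <= kap * ell by rewrite ler_pM2l.
    have hl0 : 0 <= kap * ln (j%:R + 2) by rewrite mulr_ge0// ltW// ln_nat2_gt0.
    exact: ler_pM (powR_ge0 _ _) hl0 hk2 hl.
  have tail : V j w <= \sum_(uphalf k <= i < k | (0 < i)%N) V i w * Ind i w.
    rewrite big_mkcond (bigD1_seq j) ?iota_uniq ?mem_index_iota ?uj//= j0.
    have -> : Ind j w = 1 by rewrite /Ind indicE Ei mem_set.
    apply: le_mulr1_add; apply: sumr_ge0 => l _.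
    case: (boolP (0 < l)%N) => [l0|_]; last exact: lexx.
    exact: mulr_ge0 (V0 l w l0) (Ind0 l w).
  rewrite sumEFin /=; apply: le_trans (run_stationarity X_closed X_segment basic f_smooth
    x1X kap_gt0 r_le (xg w) (lg j k0j)) _.
  by rewrite lee_fin; exact: le_trans main tail.
have samples_measurable : \bigcup_(j in [set j | (0 < j)%N])
    preimage_set_system setT (xi j) measurable `<=` (measurable : set (set Omega)).
  move=> _ [j _ [B mB <-]]; rewrite setTI -[X in measurable X]setTI.
  exact: measurable_funPT.
pose G := \bigcup_(j in [set j | (0 < j)%N]) preimage_set_system setT (xi j) measurable.
pose TG := g_sigma_algebraType G.
have mxiG l : (0 < l)%N -> measurable_fun [set: TG] (xi l : TG -> Xi).
  by move=> l0 _ B mB; apply: sub_gen_smallest; exists l => //; exists B.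
have mVG j : (0 < j)%N -> measurable_fun [set: TG] (V j : TG -> R).
  move=> j0; apply: measurable_funD => //; apply: measurable_funM => //.
  exact: (measurable_step_energy X_closed X_segment ft_diff ft_C1 basic f_smooth x1X
    (T := TG) (xi := fun l => (xi l : TG -> Xi)) mxiG xg j0).
have hV j : (0 < j)%N -> has_mean P (V j) (dl / 2 + (Lam / (2 * dl)) * u j).
  by move=> j0; apply: has_meanD; [exact: has_mean_cst|exact/has_meanZ/hu].
have VI j : j \in index_iota (uphalf k) k -> (0 < j)%N ->
    (\int[P]_w (V j w * Ind j w)%:E =
     (N%:R^-1 * (dl / 2 + (Lam / (2 * dl)) * u j))%:E)%E.
  move=> jr j0; apply: (integral_independent_index samples_measurable (indepI k k2)
    (mVG j j0) (fun w => V0 j w j0) (hV j j0)).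
  by apply: iota_P; move: jr; rewrite mem_index_iota ltnS.
have mVI j : (0 < j)%N -> measurable_fun [set: Omega] (fun w => (V j w * Ind j w)%:E).
  move=> j0; apply/measurable_EFinP; apply: measurable_funM.
    by have [/integrableP[/measurable_EFinP]] := hV j j0.
  have mi : measurable_fun setT (\1_[set j.+1] : nat -> R) by exact: measurable_indic.
  exact: (measurableT_comp mi (measurable_funPT (iota k))).
pose F j w := if (0 < j)%N then (V j w * Ind j w)%:E else 0%E.
have F0 j w : (0 <= F j w)%E.
  by rewrite /F; case: ifP => // j0; rewrite lee_fin mulr_ge0// V0.
have mF j : measurable_fun [set: Omega] (F j).
  rewrite /F; have [j0|j0] := boolP (0 < j)%N; first exact: mVI.
  exact: measurable_cst.
have -> : (\int[P]_w (\sum_(uphalf k <= j < k | (0 < j)%N) (V j w * Ind j w)%:E) =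
    \sum_(uphalf k <= j < k) \int[P]_w F j w)%E.
  rewrite -ge0_integral_sum//; apply: eq_integral => w _.
  by rewrite big_mkcond.
have -> : (\sum_(uphalf k <= j < k) \int[P]_w F j w =
    \sum_(uphalf k <= j < k) (N%:R^-1 * (dl / 2 + (Lam / (2 * dl)) * u j))%:E)%E.
  apply: eq_big_seq => j jr; have j0 := range_gt0 j jr.
  by rewrite /F j0; exact: VI.
rewrite sumEFin lee_fin -mulr_sumr big_split /= sumr_const_nat -mulr_sumr -/N.
have kN := half_le_third (R := R) k2; rewrite -/N in kN.
have kR0 : 0 < k%:R :> R by rewrite ltr0n.
have N0 : 0 < N%:R :> R by have := lt_le_trans kR0 kN; rewrite pmulr_rgt0.
have N3 : N%:R^-1 <= 3 / k%:R :> R.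
  by rewrite ler_pdivlMr// mulrC ler_pdivrMr.
set S := \sum_(uphalf k <= j < k) u j.
have SD : S <= `|D| * (ell * k%:R `^ e).
  apply: (@le_trans _ _ (\sum_(k0 <= j < k) u j)).
    rewrite (@big_cat_nat _ _ _ (uphalf k) k0 k predT u k0u uk)/= -/S lerDr big_nat; apply: sumr_ge0 => j /andP[k0j _].
    by apply: u0; exact: leq_trans k0j.
  apply: le_trans (hsum k k0k) _; rewrite -DE; apply: ler_wpM2r (ler_norm D).
  by rewrite mulr_ge0 ?powR_ge0// ltW.
pose W := Lam * (ell * k%:R `^ e).
have W0 : 0 <= W by rewrite mulr_ge0// mulr_ge0 ?powR_ge0// ltW.
(* The choice of e gives k^(1/2) k^e = k k^(-2/p), and averaging over about k / 2 indices removes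
   the factor k. The constant is 3 times 32. *)
have NW : 3 / k%:R * W = 96 * kap * (kp * ell) ^+ 2.
  have ke : k%:R `^ (1 / 2) * k%:R `^ e = k%:R * kp ^+ 2.
    rewrite kp2 -[X in _ = X * _]powRr1 ?ler0n// -!powRD; last 2 first.
    - by rewrite pnatr_eq0 -lt0n kp0 implybT.
    - by rewrite pnatr_eq0 -lt0n kp0 implybT.
    by congr powR; rewrite /e; field; rewrite gt_eqF.
  have -> : 3 / k%:R * W =
      96 * kap * ell ^+ 2 * (k%:R `^ (1 / 2) * k%:R `^ e) / k%:R.
    by rewrite /W /Lam; ring.
  by rewrite ke; field; rewrite pnatr_eq0 -lt0n.
have fin := final_arith dl0 (normr_ge0 D) W0 (ltW kap_gt0) (erefl dl) N3 NW.
apply: (@le_trans _ _ (dl / 2 + dl / 2)); last first.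
  rewrite -splitr; apply: le_trans hk; apply: ler_wpM2r.
    by rewrite mulr_ge0// ltW.
  by rewrite /C lerDr addr_ge0// mulr_ge0.
rewrite mulrDr; apply: lerD.
  by rewrite -[dl / 2 *+ N]mulr_natl mulKf// gt_eqF.
have Ni : 0 <= N%:R^-1 :> R by rewrite invr_ge0 ler0n.
by apply: le_trans fin; exact: scaled_le Ni cV SD.
Qed.

End Complexity.

Section Exponents.
Context {R : realFieldType}.
Implicit Types t p : R.

Lemma quarter_le_half t : t < 2 -> t / 4 <= 1 / 2. Proof. lra. Qed.

Lemma half_le1 : 1 / 2 <= 1 :> R. Proof. lra. Qed.

Lemma half_mul t : 1 / 2 * t = 2 * (t / 4). Proof. by field. Qed.

Lemma two_div_four : 2 / 4 <= 1 / 2 :> R. Proof. lra. Qed.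

Lemma two_div_le t p : 0 < t -> 0 < p -> 2 * t <= p -> 2 / p <= t^-1.
Proof.
move=> t0 p0 tp; rewrite ler_pdivrMr//.
by rewrite -(ler_pM2l t0) mulrA divff ?gt_eqF// mul1r mulrC.
Qed.

End Exponents.

Theorem corollary2 (R : realType) (n m : nat) (dXi : measure_display)
    (Xi : measurableType dXi) (mu : probability Xi R) (X : set 'rV[R]_n)
    (ft : 'rV[R]_n -> Xi -> R) (c : 'rV[R]_n -> 'rV[R]_m)
    (Lf sigma Lc Lnc Cc gamma theta Lnf : R) (x1 : 'rV[R]_n)
    (X_closed : closed X) (X_convex : convex_set X)
    (ft_diff : forall s x, differentiable (ft^~ s) x)
    (ft_C1 : forall s, continuous (grad (ft^~ s)))
    (basic : basic_assumptions mu X ft c Lf sigma Lc Lnc Cc gamma theta)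
    (f_smooth : forall u v, X u -> X v ->
       enorm (grad (objective mu ft) u - grad (objective mu ft) v)
         <= Lnf * enorm (u - v))
    (x1X : X x1) :
  (theta < 2 ->
     complexity_bound mu X ft c Lf x1
       (fun k => k%:R `^ (theta / 4))
       (fun k => k%:R `^ (- (1 / 2)) / ln (k%:R + 2))
       (fun k => k%:R `^ (- (1 / 2)))
       4)
  /\
  complexity_bound mu X ft c Lf x1
    (fun k => k%:R `^ (1 / 2))
    (fun k => k%:R `^ (- (1 / 2)) / (4 * ln (k%:R + 2)))
    (fun k => k%:R `^ (- (1 / 2)))
    (Num.max 4 (2 * theta)).
Proof.
have seg := convex_set_segment X_convex.
have th1 := theta_ge1 basic.
have th0 : 0 < theta := lt_le_trans ltr01 th1.
split=> [th2|].
  (* Instance r = theta / 4, s = 1 / 2, p = 4, kap = 1; theta < 2 is what gives r <= 1 / 2. *)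
  have r0 : 0 < theta / 4 by rewrite divr_gt0.
  have r1 := quarter_le_half th2.
  have s0 : 0 < 1 / 2 :> R by rewrite divr_gt0.
  have p1 : 1 <= 4 :> R by rewrite ler1n.
  have -> : (fun k => k%:R `^ (- (1 / 2)) / ln (k%:R + 2)) = descent_step (1 : R).
    by apply/funext => k; rewrite /descent_step (mul1r (ln _)).
  exact: (complexity_of_exponents X_closed seg ft_diff ft_C1 basic f_smooth x1X
    ltr01 r0 r1 s0 half_le1 (half_mul theta) p1 two_div_four two_div_four).
(* Instance r = 1 / 2, s = 1 / theta, kap = 4; the two entries of the maximum are 2 / p <= 1 / 2 and
   2 / p <= s. *)
set p := Num.max 4 (2 * theta).
have p4 : 4 <= p by rewrite le_max lexx.
have pth : 2 * theta <= p by rewrite le_max lexx orbT.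
have p0 : 0 < p by apply: lt_le_trans p4; rewrite ltr0n.
have r0 : 0 < 1 / 2 :> R by rewrite divr_gt0.
have s0 : 0 < theta^-1 by rewrite invr_gt0.
have s1 : theta^-1 <= 1 by rewrite invf_le1.
have st : theta^-1 * theta = 2 * (1 / 2).
  by rewrite mulVf ?gt_eqF// mul1r divff// pnatr_eq0.
have p1 : 1 <= p by apply: le_trans p4; rewrite ler1n.
have p2 : 2 / p <= 1 / 2.
  by rewrite div1r; apply: two_div_le => //; rewrite -natrM.
have p3 : 2 / p <= theta^-1 by exact: two_div_le.
have k4 : 0 < 4 :> R by rewrite ltr0n.
exact: (complexity_of_exponents X_closed seg ft_diff ft_C1 basic f_smooth x1X
  k4 r0 (lexx _) s0 s1 st p1 p2 p3).
Qed.
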